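(* Let $n\ge1$ and $k\ge 0$ be integers, let $\alpha>0$, and let $f\in L^{1,k}(\mathbb{R}^n;\mathbb{R})$. Let $N,\ell\in\{1,\dots,n\}$. (i) There is a constant $C>0$ independent of $\beta$, $t$ and $f$ such that for every $\beta>0$, as $t\to\infty$ (the symbols $o(1)$ denoting quantities tending to $0$ as $t\to\infty$ with $\beta$ fixed), $$\Big\|W_c^{(\alpha,\beta)}(t)*f-\sum_{|\gamma|\le k}m_{f,\gamma}\partial_x^\gamma W_c^{(\alpha,\beta)}(t)\Big\|_{L^2}+\Big\|\tilde W_{c,(N,\ell)}^{(\alpha,\beta)}(t)*f-\sum_{|\gamma|\le k}m_{f,\gamma}\partial_x^\gamma\tilde W_{c,(N,\ell)}^{(\alpha,\beta)}(t)\Big\|_{L^2}$$ $$\le C\big(\beta^{-\frac{n-1}{4}-\frac{k+1}{2}}+\beta^{\frac14}o(1)\big)\|f\|_{L^{1,k}}+C\big(\beta^{-\frac n4-\frac k2}+o(1)\big)\int_{|y|\ge\beta^{1/4}}|y|^k|f(y)|\,dy .$$ If moreover $n\ge3$, or $n\in\{1,2\}$ and $k\ge1$, then there is such a $C$ for which, for every $\beta>0$, as $t\to\infty$, $$\Big\|W_s^{(\alpha,\beta)}(t)*f-\sum_{|\gamma|\le k}m_{f,\gamma}\partial_x^\gamma W_s^{(\alpha,\beta)}(t)\Big\|_{L^2}+\Big\|\tilde W_{s,(N,\ell)}^{(\alpha,\beta)}(t)*f-\sum_{|\gamma|\le k}m_{f,\gamma}\partial_x^\gamma\tilde W_{s,(N,\ell)}^{(\alpha,\beta)}(t)\Big\|_{L^2}$$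 $$\le C\big(\beta^{-\frac{n-3}{4}-\frac{k+1}{2}}+\beta^{\frac14}o(1)\big)\|f\|_{L^{1,k}}+C\big(\beta^{-\frac{n-2}4-\frac k2}+o(1)\big)\int_{|y|\ge\beta^{1/4}}|y|^k|f(y)|\,dy .$$ (ii) Let $\beta>0$ be fixed. If $n=1$, then $$\|W_s^{(\alpha,\beta)}(t)*f-m_{f,0}W_s^{(\alpha,\beta)}(t)\|_{L^2}=o(t^{1/2})\quad\text{as }t\to\infty.$$ If $n=2$, then $$\|W_s^{(\alpha,\beta)}(t)*f-m_{f,0}W_s^{(\alpha,\beta)}(t)\|_{L^2}=o(\sqrt{\log(t+2)}),$$ $$\|\tilde W_{s,(N,\ell)}^{(\alpha,\beta)}(t)*f-m_{f,0}\tilde W_{s,(N,\ell)}^{(\alpha,\beta)}(t)\|_{L^2}=o(\sqrt{\log(t+2)})\quad\text{as }t\to\infty.$$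
   Context: $L^{1,k}(\mathbb{R}^n;\mathbb{R})$ is the space of $f\in L^1$ with $(1+|x|)^kf\in L^1$, with norm $\|f\|_{L^{1,k}}=\|(1+|x|)^kf\|_{L^1}$ (so $L^{1,0}=L^1$ up to equality of norms). For a multi-index $\gamma\in\mathbb{Z}_{\ge0}^n$ with $|\gamma|\le k$, $m_{f,\gamma}:=\frac1{\gamma!}\int_{\mathbb{R}^n}(-x)^\gamma f(x)\,dx$. For $\alpha,\beta>0$, $t>0$, with $\mathcal F^{-1}$ the inverse Fourier transform in $\xi\in\mathbb{R}^n$, $$W_c^{(\alpha,\beta)}(t,x)=\mathcal F^{-1}\big[e^{-\beta|\xi|^2}\cos(t\alpha|\xi|)\big],\qquad W_s^{(\alpha,\beta)}(t,x)=\mathcal F^{-1}\Big[e^{-\beta|\xi|^2}\tfrac{\sin(t\alpha|\xi|)}{\alpha|\xi|}\Big],$$ $$\tilde W_{c,(N,\ell)}^{(\alpha,\beta)}(t,x)=\mathcal F^{-1}\Big[e^{-\beta|\xi|^2}\cos(t\alpha|\xi|)\tfrac{\xi_N\xi_\ell}{|\xi|^2}\Big],\qquad \tilde W_{s,(N,\ell)}^{(\alpha,\beta)}(t,x)=\mathcal F^{-1}\Big[e^{-\beta|\xi|^2}\tfrac{\sin(t\alpha|\xi|)}{\alpha|\xi|}\tfrac{\xi_N\xi_\ell}{|\xi|^2}\Big].$$ The convolution $*$ is in the variable $x$ and, in the tilde terms, is understood as the corresponding Fourier multiplier (with the normalization in which $\mathcal{F}[W*f]$ corresponds to the product of the symbol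 with $\hat f$, $\hat f(0)=\int f\,dx$ up to the same normalizing constant as is used for the terms $m_{f,\gamma}\partial_x^\gamma W$). *)

(* Defs.v *)
From HB Require Import structures.
From mathcomp Require Import all_boot all_order all_algebra.
From mathcomp Require Import all_classical all_reals all_analysis.
From mathcomp Require Import complex.

Set Implicit Arguments.
Unset Strict Implicit.
Unset Printing Implicit Defensive.

Import Order.TTheory GRing.Theory Num.Theory.
Import numFieldNormedType.Exports.

Local Open Scope classical_set_scope.
Local Open Scope ring_scope.
Local Open Scope complex_scope.

(* The product sigma-algebra on row vectors, generated by the coordinates; on
   ['rV[R]_n] it is the Borel sigma-algebra. *)

Definition measure_rV_display : measure_display -> measure_display.
Proof. exact. Qed.

Section measurable_rV.
Context d (T : measurableType d) (n : nat).

Let coords : 'I_n -> 'rV[T]_n -> T := fun i v => v ord0 i.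

Let rV_set0 : g_sigma_preimage coords set0.
Proof. exact: sigma_algebra0. Qed.

Let rV_setC A : g_sigma_preimage coords A -> g_sigma_preimage coords (~` A).
Proof. exact: sigma_algebraC. Qed.

Let rV_bigcup (F : _^nat) : (forall i, g_sigma_preimage coords (F i)) ->
  g_sigma_preimage coords (\bigcup_i (F i)).
Proof. exact: sigma_algebra_bigcup. Qed.

HB.instance Definition _ := @isMeasurable.Build (measure_rV_display d)
  'rV[T]_n (g_sigma_preimage coords) rV_set0 rV_setC rV_bigcup.

End measurable_rV.

Lemma measurable_fun_rV d1 d2 (T1 : measurableType d1) (T2 : measurableType d2)
    (n : nat) (f : T1 -> 'rV[T2]_n) :
  (forall i, measurable_fun [set: T1] (fun x => f x ord0 i)) ->
  measurable_fun [set: T1] f.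
Proof.
move=> mf.
suff prefS : g_sigma_preimage (fun i => (fun v : 'rV[T2]_n => v ord0 i) \o f)
    `<=` measurable.
  rewrite g_sigma_preimage_comp in prefS.
  by move=> _ A mA; apply: prefS; exists A.
apply: smallest_sub; first exact: sigma_algebra_measurable.
rewrite -bigcup_seq; apply: bigcup_sub => i _.
by move=> A [B mB <-]; exact: mf.
Qed.

Section lebesgue_measure_rV.
Context {R : realType}.

Definition rV_cons (n : nat) (p : measurableTypeR R * 'rV[R]_n) :
    'rV[R]_(1 + n) :=
  row_mx (const_mx p.1) p.2.

Lemma measurable_rV_coord (n : nat) (i : 'I_n) :
  measurable_fun [set: 'rV[R]_n] (fun v : 'rV[R]_n => v ord0 i).
Proof.
move=> _ Y mY; rewrite setTI; apply: sub_sigma_algebra => /=.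
rewrite -bigcup_seq/=; exists i => /=; first by rewrite mem_index_enum.
by exists Y => //; rewrite setTI.
Qed.

Lemma measurable_rV_cons (n : nat) :
  measurable_fun [set: measurableTypeR R * 'rV[R]_n] (@rV_cons n).
Proof.
apply: measurable_fun_rV => i; rewrite /rV_cons.
case: (split_ordP i) => j ->.
  under eq_fun do rewrite row_mxEl mxE.
  exact: measurable_fst.
under eq_fun do rewrite row_mxEr.
exact: measurableT_comp (measurable_rV_coord j) measurable_snd.
Qed.

Section lebesgue_rV_step.
Variables (n : nat) (mu : {sigma_finite_measure set 'rV[R]_n -> \bar R}).

Definition lebesgue_step : set 'rV[R]_(1 + n) -> \bar R :=
  pushforward (lebesgue_measure \x mu)%E (@rV_cons n).

Local Notation nu := lebesgue_step.

Let nu_measure : {measure set 'rV[R]_(1 + n) -> \bar R} :=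
  measure_function_pushforward__canonical__measure_function_Measure
    (lebesgue_measure \x mu)%E (@measurable_rV_cons n).

Let nu0 : nu set0 = 0%E. Proof. exact: (measure0 nu_measure). Qed.

Let nu_ge0 A : (0 <= nu A)%E. Proof. exact: (measure_ge0 nu_measure). Qed.

Let nu_additive : semi_sigma_additive nu.
Proof. exact: (@measure_semi_sigma_additive _ _ _ nu_measure). Qed.

Let nu_sigma_finite : sigma_finite setT nu.
Proof.
pose leb : {sigma_finite_measure set (measurableTypeR R) -> \bar R} :=
  lebesgue_measure.
(* Unification only finds the instance for subprobabilities. *)
have [[F FT mF]] := lebesgue_integral_fubini.measure_function_Measure_isSigmaFinite__to__measure_function_isSigmaFinite
  leb mu.
pose h (v : 'rV[R]_(1 + n)) : measurableTypeR R * 'rV[R]_n :=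
  (v ord0 ord0, rsubmx v).
have hK : cancel (@rV_cons n) h.
  move=> [x v]; rewrite /h /rV_cons row_mxKr; congr pair.
  have -> : ord0 = lshift n ord0 :> 'I_(1 + n) by exact: val_inj.
  by rewrite row_mxEl mxE.
have mh : measurable_fun setT h.
  apply/measurable_fun_pairP; split; first exact: measurable_rV_coord.
  apply: measurable_fun_rV => i /=.
  by under eq_fun do rewrite mxE; exact: measurable_rV_coord.
exists (fun i => h @^-1` F i).
  by rewrite -preimage_bigcup -FT preimage_setT.
move=> i; have [mFi Fi_fin] := mF i; split.
  by rewrite -[X in measurable X]setTI; exact: mh.
rewrite /lebesgue_step /pushforward -comp_preimage (_ : h \o _ = id); last exact/funext.
by rewrite preimage_id.
Qed.

HB.instance Definition _ := isMeasure.Build _ _ _ nu nu0 nu_ge0 nu_additive.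
HB.instance Definition _ := @Measure_isSigmaFinite.Build _ _ _ nu
  nu_sigma_finite.

Lemma lebesgue_rV_step :
  exists m : {sigma_finite_measure set 'rV[R]_(1 + n) -> \bar R},
    m = pushforward (lebesgue_measure \x mu)%E (@rV_cons n)
      :> (set _ -> \bar R).
Proof. by exists nu. Qed.

End lebesgue_rV_step.

Fixpoint lebesgue_rV (n : nat) : set 'rV[R]_n -> \bar R :=
  match n with
  | 0 => \d_(0 : 'rV[R]_0)
  | n'.+1 => pushforward (lebesgue_measure \x @lebesgue_rV n')%E (@rV_cons n')
  end.
Arguments lebesgue_rV n _ : clear implicits.

Let lebesgue_rVP (n : nat) :
  exists m : {sigma_finite_measure set 'rV[R]_n -> \bar R},
    m = lebesgue_rV n :> (set _ -> \bar R).
Proof.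
elim: n => [|n [mu muE]]; last first.
  by have [m mE] := lebesgue_rV_step mu; exists m; rewrite mE muE.
pose d0 := (\d_(0 : 'rV[R]_0) : {finite_measure set 'rV[R]_0 -> \bar R}).
by exists d0.
Qed.

Let lebesgue_rV0 n : lebesgue_rV n set0 = 0%E.
Proof. by have [m <-] := lebesgue_rVP n; exact: measure0. Qed.

Let lebesgue_rV_ge0 n A : (0 <= lebesgue_rV n A)%E.
Proof. by have [m <-] := lebesgue_rVP n; exact: measure_ge0. Qed.

Let lebesgue_rV_additive n : semi_sigma_additive (lebesgue_rV n).
Proof.
by have [m <-] := lebesgue_rVP n; exact: measure_semi_sigma_additive.
Qed.

HB.instance Definition _ n := isMeasure.Build _ _ _ (lebesgue_rV n)
  (lebesgue_rV0 n) (@lebesgue_rV_ge0 n) (@lebesgue_rV_additive n).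

Let lebesgue_rV_sigma_finite n : sigma_finite setT (lebesgue_rV n).
Proof. by have [m <-] := lebesgue_rVP n; exact: sigma_finiteT. Qed.

HB.instance Definition _ n := @Measure_isSigmaFinite.Build _ _ _
  (lebesgue_rV n) (@lebesgue_rV_sigma_finite n).

End lebesgue_measure_rV.
Arguments lebesgue_rV {R} n _.

Section fourier.
Context {R : realType} {n : nat}.
Implicit Types (x y xi : 'rV[R]_n) (f : 'rV[R]_n -> R) (u : 'rV[R]_n -> R[i]).

(* The library norm on ['rV[R]_n] is the sup norm. *)
Definition eucl_norm x : R := Num.sqrt (\sum_i x ord0 i ^+ 2).

Definition dotp x y : R := \sum_i x ord0 i * y ord0 i.

Definition expi (theta : R) : R[i] := cos theta +i* sin theta.

Definition cintegral u : R[i] :=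
  (\int[lebesgue_rV n]_x complex.Re (u x))
    +i* (\int[lebesgue_rV n]_x complex.Im (u x)).

(* The normalization for which F[W * f] = F[W] F[f] and F[f](0) = \int f. *)
Definition fourier u xi : R[i] := cintegral (fun x => expi (- dotp x xi) * u x).

Definition inv_fourier u x : R[i] :=
  ((2 * pi) ^- n)%:C * cintegral (fun xi => expi (dotp x xi) * u xi).

Definition convolution u f x : R[i] :=
  cintegral (fun y => u (x - y) * (f y)%:C).

Definition fourier_multiplier (s : 'rV[R]_n -> R) f : 'rV[R]_n -> R[i] :=
  inv_fourier (fun xi => (s xi)%:C * fourier (fun x => (f x)%:C) xi).

Definition partial_deriv (i : 'I_n) u x : R[i] :=
  ('D_(delta_mx ord0 i) (fun z => complex.Re (u z)) x)
    +i* ('D_(delta_mx ord0 i) (fun z => complex.Im (u z)) x).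

Definition multi_deriv (g : 'I_n -> nat) u : 'rV[R]_n -> R[i] :=
  foldr (fun i v => iter (g i) (partial_deriv i) v) u (enum 'I_n).

Definition L2_norm u : \bar R :=
  Lnorm (lebesgue_rV n) 2%:E (fun x => (Normc.normc (u x))%:E).

Definition in_L1w (k : nat) f : Prop :=
  (lebesgue_rV n).-integrable setT (EFin \o f) /\
  (lebesgue_rV n).-integrable setT
    (fun x => ((1 + eucl_norm x) ^+ k * f x)%:E).

Definition L1w_norm (k : nat) f : \bar R :=
  Lnorm (lebesgue_rV n) 1 (fun x => ((1 + eucl_norm x) ^+ k * f x)%:E).

Definition moment f (g : 'I_n -> nat) : R :=
  (\prod_i (g i)`!%:R)^-1 *
  \int[lebesgue_rV n]_x ((\prod_i (- x ord0 i) ^+ g i) * f x).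

(* Every component of a multi-index of length at most [k] is at most [k], so
   these multi-indices are found among the functions ['I_n -> 'I_k.+1]. *)
Definition moment_expansion (k : nat) f u x : R[i] :=
  \sum_(g : {ffun 'I_n -> 'I_k.+1} | (\sum_i g i <= k)%N)
     (moment f (fun i => g i : nat))%:C *
       multi_deriv (fun i => g i : nat) u x.

Definition tail_moment (k : nat) (r : R) f : \bar R :=
  (\int[lebesgue_rV n]_(y in [set y | (r <= eucl_norm y)%R])
     (eucl_norm y ^+ k * `|f y|)%:E)%E.

Section kernels.
Variables (alpha beta t : R).

(* Quotients by [eucl_norm xi] only take the library's junk value at [xi = 0],
   a null set for [n > 0]. *)
Definition symb_c xi : R :=
  expR (- beta * eucl_norm xi ^+ 2) * cos (t * alpha * eucl_norm xi).

Definition symb_s xi : R :=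
  expR (- beta * eucl_norm xi ^+ 2) *
  (sin (t * alpha * eucl_norm xi) / (alpha * eucl_norm xi)).

Definition riesz (N l : 'I_n) xi : R :=
  xi ord0 N * xi ord0 l / eucl_norm xi ^+ 2.

Definition symb_tc (N l : 'I_n) xi : R := symb_c xi * riesz N l xi.

Definition symb_ts (N l : 'I_n) xi : R := symb_s xi * riesz N l xi.

Definition W_c : 'rV[R]_n -> R[i] := inv_fourier (fun xi => (symb_c xi)%:C).

Definition W_s : 'rV[R]_n -> R[i] := inv_fourier (fun xi => (symb_s xi)%:C).

Definition W_tc (N l : 'I_n) : 'rV[R]_n -> R[i] :=
  inv_fourier (fun xi => (symb_tc N l xi)%:C).

Definition W_ts (N l : 'I_n) : 'rV[R]_n -> R[i] :=
  inv_fourier (fun xi => (symb_ts N l xi)%:C).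

(* The quantities [K * f - sum_(|g| <= k) m_(f,g) d^g K]; in the [tilde] terms
   [K *] is the Fourier multiplier. *)
Definition err_c k f x : R[i] :=
  convolution W_c f x - moment_expansion k f W_c x.

Definition err_s k f x : R[i] :=
  convolution W_s f x - moment_expansion k f W_s x.

Definition err_tc k N l f x : R[i] :=
  fourier_multiplier (symb_tc N l) f x - moment_expansion k f (W_tc N l) x.

Definition err_ts k N l f x : R[i] :=
  fourier_multiplier (symb_ts N l) f x - moment_expansion k f (W_ts N l) x.

(* The errors with [m_(f,0) K] in place of the full expansion. *)
Definition err0_s f x : R[i] :=
  convolution W_s f x - (moment f (fun=> 0%N))%:C * W_s x.

Definition err0_ts N l f x : R[i] :=
  fourier_multiplier (symb_ts N l) f x -
    (moment f (fun=> 0%N))%:C * W_ts N l x.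

End kernels.
End fourier.

Canonical pinfty_nbhs_filter_on (R : realType) : filter_on R :=
  FilterType (pinfty_nbhs R) _.

(* [u t = o(g t)] as [t -> +oo]; in particular [u t] is finite for large [t]. *)
Definition ereal_littleo {R : realType} (u : R -> \bar R) (g : R -> R) : Prop :=
  exists2 v : R -> R, (\forall t \near +oo, u t = (v t)%:E) & v =o_+oo g.

(* Main.v *)
Require Import Defs.
From mathcomp Require Import all_boot all_order all_algebra.
From mathcomp Require Import all_classical all_reals all_analysis.
From mathcomp Require Import measurable_realfun complex ring lra.
Import Order.TTheory GRing.Theory Num.Theory.
Import numFieldNormedType.Exports.

(* On the Fourier side the error of a multiplier [s] is [s * (fhat - P)], where
   [P] is the Taylor polynomial of order [k] of [fhat], by the multinomial
   formula.  The remainder of [exp (- i x . xi)], estimated at order [k + 1]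
   for [|x| < r] and at order [k] for [|x| >= r], gives
     |fhat - P| <= r |xi|^(k+1) ||f||_(L^(1,k)) + 2 |xi|^k tail_k(r),
   so that everything reduces, by Plancherel, to bounding the integrals of
   [s^2 |xi|^(2 j)], uniformly in [t]; the terms [o(1)] can be taken to be [0].

   Only one half of Plancherel's theorem is needed, with a non-sharp constant:
   against the weight [exp (- e sum_i |x_i|)], whose transform is a product of
   nonnegative Cauchy kernels, Fubini and AM-GM bound the integral of the squared
   transform, and [e] tends to [0] by monotone convergence.

   The cosine symbols are dominated by [exp (- beta |xi|^2)].  For the sine
   symbols, [min (1, v) <= 2 (1 - exp (- v))] bounds [sin^2 (t alpha |xi|) / |xi|^2]
   by the integral of [2 exp (- c |xi|^2)] over [0 <= c <= (t alpha)^2], so that the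
   integral of the squared symbol is at most a constant times that of
   [(pi / (2 beta + c))^(n/2)]: this is [O(t)] for [n = 1], [O(log t)] for [n = 2]
   and bounded for [n >= 3]. *)

Set Implicit Arguments.
Unset Strict Implicit.

Local Open Scope classical_set_scope.
Local Open Scope ring_scope.

(** * Fubini's theorem and integration over row vectors *)

(** The estimates see a symbol only through pointwise domination, by [gaussian beta] for the cosine
    and by [symb_s] for the sine. The Riesz factor has modulus at most 1, so each tilde term falls
    under the same lemma as its plain companion. The obstacle is the factor |xi|^(-2) of the squared
    sine symbol at low frequency. A single power of |xi| cancels it, so the term weighted by
    |xi|^(k+1) never meets it, and the term weighted by |xi|^k meets it only for k = 0. There it is
    integrable near the origin for n >= 3, while for n = 1, 2 the cutoff supplied by |sin u| <= |u|
    lets the bound grow with t. In (i) the radius is r = beta^(1/4), the source of the 1/4 in the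
    first exponent. In (ii) the radius is instead adapted to f, before t grows. Constants lost on
    the way, in Plancherel's inequality or in the Taylor remainders, are absorbed by C. *)

Lemma integrable_dom d (T : measurableType d) (R : realType)
    (mu : {measure set T -> \bar R}) (f g : T -> R) :
  measurable_fun setT f -> (forall x, `|f x| <= g x) ->
  mu.-integrable setT (EFin \o g) -> mu.-integrable setT (EFin \o f).
Proof.
move=> mf fg ig; apply: (le_integrable _ _ _ ig) => //.
  exact/measurable_EFinP.
by move=> x _ /=; rewrite lee_fin (le_trans (fg x))// ler_norm.
Qed.

Lemma integrable_scale d (T : measurableType d) (R : realType)
    (mu : {measure set T -> \bar R}) (f : T -> R) (c : R) :
  mu.-integrable setT (EFin \o f) ->
  mu.-integrable setT (EFin \o (fun x => c * f x)).
Proof. exact: integrableZl. Qed.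

Section fubini_dominated.
Context d1 d2 (T1 : measurableType d1) (T2 : measurableType d2) (R : realType).
Variable m1 : {sigma_finite_measure set T1 -> \bar R}.
Variable m2 : {sigma_finite_measure set T2 -> \bar R}.
Variables (f : T1 * T2 -> R) (a : T1 -> R) (b : T2 -> R).
Hypothesis mf : measurable_fun setT f.
Hypothesis fab : forall x y, `|f (x, y)| <= a x * b y.
Hypothesis ia : m1.-integrable setT (EFin \o a).
Hypothesis ib : m2.-integrable setT (EFin \o b).

Lemma integrable_section1 x : m2.-integrable setT (EFin \o (fun y => f (x, y))).
Proof.
apply: (@integrable_dom _ _ _ _ _ (fun y => a x * b y)) => //.
  exact: measurableT_comp.
exact: integrable_scale.
Qed.

Lemma integrable_section2 y : m1.-integrable setT (EFin \o (fun x => f (x, y))).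
Proof.
apply: (@integrable_dom _ _ _ _ _ (fun x => b y * a x)) => //.
- exact: measurableT_comp.
- by move=> x; rewrite mulrC.
- exact: integrable_scale.
Qed.

(** By Tonelli it suffices to bound the iterated integral of |f|, and the product majorant makes the
    inner one at most [B * |a x|], with [B] the mass of |b|. *)
Lemma integrable_prod_dom : (m1 \x m2)%E.-integrable setT (EFin \o f).
Proof.
apply/integrable12ltyP; first exact/measurable_EFinP.
pose B := fine (\int[m2]_y `|(b y)%:E|)%E.
have ib' : m2.-integrable setT (EFin \o (fun y => `|b y|)).
  exact: integrable_norm.
have ia' : m1.-integrable setT (EFin \o (fun x => B * `|a x|)).
  exact/integrable_scale/integrable_norm.
have BE : (\int[m2]_y `|(b y)%:E| = B%:E)%E.
  by rewrite fineK//; exact: (integrable_fin_num measurableT ib').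
apply: (@le_lt_trans _ _ (\int[m1]_x (B * `|a x|)%:E)%E); last first.
  exact: (integrable_lty measurableT ia').
apply: ge0_le_integral => //.
- by move=> x _; apply: integral_ge0.
- apply: (measurable_fun_fubini_tonelli_F (fun z => `|(f z)%:E|%E)) => //=.
  by apply/measurable_EFinP; exact: measurableT_comp.
- exact: (measurable_int _ ia').
- move=> x _; rewrite EFinM -BE muleC -ge0_integralZl//; last first.
    exact: (measurable_int _ ib').
  apply: ge0_le_integral => //.
  + by apply: measurableT_comp => //; exact: (measurable_int _ (integrable_section1 x)).
  + exact/measurable_funeM/(measurable_int _ ib').
  + by move=> y _; rewrite /= lee_fin -normrM (le_trans (fab _ _))// ler_norm.
Qed.

(** A real integral is [fine] of the extended one, so nested real integrals match nested extended
    ones only once every section is known to have a finite integral. *)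
Let inner1 x : (\int[m2]_y f (x, y))%:E = (\int[m2]_y (f (x, y))%:E)%E.
Proof.
by rewrite /Rintegral fineK//; exact: (integrable_fin_num measurableT (integrable_section1 x)).
Qed.

Let inner2 y : (\int[m1]_x f (x, y))%:E = (\int[m1]_x (f (x, y))%:E)%E.
Proof.
by rewrite /Rintegral fineK//; exact: (integrable_fin_num measurableT (integrable_section2 y)).
Qed.

Lemma integrable_Rintegral_section1 :
  m1.-integrable setT (EFin \o (fun x => \int[m2]_y f (x, y))).
Proof.
rewrite (_ : _ \o _ = fun x => (\int[m2]_y (f (x, y))%:E)%E); last first.
  by apply/funext => x /=; rewrite inner1.
exact: (integrable_fubini_F integrable_prod_dom).
Qed.

Lemma Rfubini_dom :
  \int[m1]_x \int[m2]_y f (x, y) = \int[m2]_y \int[m1]_x f (x, y).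
Proof.
rewrite /Rintegral; congr fine.
under eq_integral do rewrite -/(Rintegral _ _ _) inner1.
under [RHS]eq_integral do rewrite -/(Rintegral _ _ _) inner2.
exact: (Fubini integrable_prod_dom).
Qed.

End fubini_dominated.

(** * Measurability of coordinate expressions *)

Section rV_measurability.
Context {R : realType} d {T : measurableType d}.

Lemma measurable_cos : measurable_fun setT (@cos R).
Proof. by apply: continuous_measurable_fun; exact: continuous_cos. Qed.

Lemma measurable_sin : measurable_fun setT (@sin R).
Proof. by apply: continuous_measurable_fun; exact: continuous_sin. Qed.

Lemma measurable_sqrtr : measurable_fun setT (@Num.sqrt R).
Proof. by apply: continuous_measurable_fun; exact: sqrt_continuous. Qed.

Lemma measurable_coord_comp n (u : T -> 'rV[R]_n) (i : 'I_n) :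
  measurable_fun setT u -> measurable_fun setT (fun t => u t ord0 i).
Proof. exact: measurableT_comp (measurable_rV_coord i). Qed.

Lemma measurable_dotp n (u v : T -> 'rV[R]_n) :
  measurable_fun setT u -> measurable_fun setT v ->
  measurable_fun setT (fun t => dotp (u t) (v t)).
Proof.
move=> mu mv; rewrite /dotp; apply: measurable_sum => i.
by apply: measurable_funM; exact: measurable_coord_comp.
Qed.

Lemma measurable_eucl_norm n (u : T -> 'rV[R]_n) :
  measurable_fun setT u -> measurable_fun setT (fun t => eucl_norm (u t)).
Proof.
move=> mu; apply: measurableT_comp measurable_sqrtr _.
apply: measurable_sum => i.
by apply: measurable_funX; exact: measurable_coord_comp.
Qed.

Lemma measurable_rV_sub n (u v : T -> 'rV[R]_n) :
  measurable_fun setT u -> measurable_fun setT v ->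
  measurable_fun setT (fun t => u t - v t).
Proof.
move=> mu mv; apply: measurable_fun_rV => i.
under eq_fun do rewrite !mxE.
by apply: measurable_funB; exact: measurable_coord_comp.
Qed.

End rV_measurability.

(** * Iterated and product integrals over row vectors *)

Section rV_integral.
Context {R : realType}.
Implicit Types n : nat.

Lemma rV_cons0 n (p : R * 'rV[R]_n) : @rV_cons R n p ord0 ord0 = p.1.
Proof.
rewrite /rV_cons (_ : ord0 = lshift n ord0 :> 'I_(1 + n)); last exact: val_inj.
by rewrite row_mxEl mxE.
Qed.

Lemma rV_consS n (p : R * 'rV[R]_n) (i : 'I_n) :
  @rV_cons R n p ord0 (lift ord0 i) = p.2 ord0 i.
Proof.
rewrite /rV_cons (_ : lift ord0 i = rshift 1 i :> 'I_(1 + n)); last exact: val_inj.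
by rewrite row_mxEr.
Qed.

(** [lebesgue_rV n.+1] is the pushforward of a product measure along [rV_cons], so change of
    variables and Tonelli peel off the first coordinate: the step of an induction on the
    dimension. *)
Lemma ge0_integral_rV_cons n (F : 'rV[R]_n.+1 -> \bar R) :
  measurable_fun setT F -> (forall x, (0 <= F x)%E) ->
  (\int[lebesgue_rV n.+1]_x F x =
   \int[lebesgue_measure]_x \int[lebesgue_rV n]_v F (@rV_cons R n (x, v)))%E.
Proof.
move=> mF F0.
pose P := measure_function_pushforward__canonical__measure_function_Measure
    (lebesgue_measure \x lebesgue_rV n)%E (@measurable_rV_cons R n).
rewrite (eq_measure_integral P) //.
rewrite (ge0_integral_pushforward (@measurable_rV_cons R n)) //=.
rewrite preimage_setT (fubini_tonelli1 (F \o @rV_cons R n))//=.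
apply: measurableT_comp => //; exact: measurable_rV_cons.
Qed.

(** The counterpart for oscillating integrands; the product majorant supplies the integrability that
    Fubini needs. *)
Lemma Rintegral_rV_cons n (F : 'rV[R]_n.+1 -> R) (a : R -> R)
    (b : 'rV[R]_n -> R) :
  measurable_fun setT F ->
  (forall x v, `|F (@rV_cons R n (x, v))| <= a x * b v) ->
  lebesgue_measure.-integrable setT (EFin \o a) ->
  (lebesgue_rV n).-integrable setT (EFin \o b) ->
  \int[lebesgue_rV n.+1]_x F x =
   \int[lebesgue_measure]_x \int[lebesgue_rV n]_v F (@rV_cons R n (x, v)).
Proof.
move=> mF Fab ia ib.
have mFc : measurable_fun setT (F \o @rV_cons R n).
  by apply: measurableT_comp => //; exact: measurable_rV_cons.
have iF : (lebesgue_measure \x lebesgue_rV n)%E.-integrable setT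
    (EFin \o (F \o @rV_cons R n)).
  exact: (integrable_prod_dom mFc Fab ia ib).
pose P := measure_function_pushforward__canonical__measure_function_Measure
    (lebesgue_measure \x lebesgue_rV n)%E (@measurable_rV_cons R n).
rewrite /Rintegral (eq_measure_integral P) //.
rewrite (integral_pushforward (@measurable_rV_cons R n)) //; last first.
  exact/measurable_EFinP.
congr fine; rewrite preimage_setT -(integral12_prod_meas1 iF).
apply: eq_integral => x _.
rewrite -/(Rintegral _ _ _) /Rintegral fineK//.
exact: (integrable_fin_num measurableT (integrable_section1 mFc Fab ib x)).
Qed.

Lemma measurable_prod_coord n (phi : 'I_n -> R -> R) :
  (forall i, measurable_fun setT (phi i)) ->
  measurable_fun setT (fun x : 'rV[R]_n => \prod_i phi i (x ord0 i)).
Proof.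
move=> mphi; apply: measurable_prod => i _.
by apply: measurableT_comp => //; exact: measurable_rV_coord.
Qed.

Lemma ge0_integral_prod n (phi : 'I_n -> R -> R) (c : 'I_n -> R) :
  (forall i, measurable_fun setT (phi i)) -> (forall i t, 0 <= phi i t) ->
  (forall i, (\int[lebesgue_measure]_t (phi i t)%:E = (c i)%:E)%E) ->
  (\int[lebesgue_rV n]_x (\prod_i phi i (x ord0 i))%:E = (\prod_i c i)%:E)%E.
Proof.
elim: n phi c => [|n ih] phi c mphi phi0 cE.
  (* In dimension 0 the measure is a point mass and both products are empty. *)
  rewrite (@eq_measure_integral _ _ _ _ (\d_(0 : 'rV[R]_0)))//.
  rewrite integral_dirac//.
    by rewrite diracT mul1e !big_ord0.
  by apply/measurable_EFinP; exact: measurable_prod_coord.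
rewrite ge0_integral_rV_cons/=; last 2 first.
- by apply/measurable_EFinP; exact: measurable_prod_coord.
- by move=> x; rewrite lee_fin prodr_ge0.
rewrite big_ord_recl.
transitivity (\int[lebesgue_measure]_x
   ((phi ord0 x)%:E * (\prod_i c (lift ord0 i))%:E))%E.
  apply: eq_integral => x _.
  rewrite -(ih (fun i => phi (lift ord0 i)) (fun i => c (lift ord0 i)))//.
  rewrite -ge0_integralZl//.
  - apply: eq_integral => v _; rewrite big_ord_recl rV_cons0 EFinM.
    by congr (_ * _%:E)%E; apply: eq_bigr => i _; rewrite rV_consS.
  - by apply/measurable_EFinP;
      exact: (measurable_prod_coord (phi := fun i => phi (lift ord0 i))).
  - by move=> v _; rewrite lee_fin prodr_ge0.
  - by rewrite lee_fin.
rewrite ge0_integralZr//.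
- by rewrite cE.
- by apply/measurable_EFinP; exact: mphi.
- by move=> x _; rewrite lee_fin.
- rewrite lee_fin prodr_ge0// => i _; rewrite -lee_fin -cE.
  by apply: integral_ge0 => x _; rewrite lee_fin.
Qed.

Lemma integrable_ge0_integral d (T : measurableType d) (mu : {measure set T -> \bar R})
    (f : T -> R) (c : R) :
  measurable_fun setT f -> (forall x, 0 <= f x) ->
  (\int[mu]_x (f x)%:E <= c%:E)%E -> mu.-integrable setT (EFin \o f).
Proof.
move=> mf f0 fE; apply/integrableP; split; first exact/measurable_EFinP.
under eq_integral do rewrite /= ger0_norm//.
by rewrite (le_lt_trans fE)// ltry.
Qed.

End rV_integral.

(** * Laplace, Cauchy and Gauss integrals *)

Section one_dimensional_integrals.
Context {R : realType}.
Local Notation mu := (@lebesgue_measure R).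

(** Reflecting the negative half-line brings integrals over the line to [0, +oo[, where the improper
    fundamental theorem of calculus applies. *)
Lemma ge0_integral_fold (f : R -> R) : (forall x, 0 <= f x) -> continuous f ->
  (\int[mu]_x (f x)%:E = \int[mu]_(x in `[0%R, +oo[) (f x + f (- x))%:E)%E.
Proof.
move=> f0 cf.
have mf : measurable_fun [set: R] f by exact: continuous_measurable_fun.
have cfN : continuous (fun x => f (- x)).
  by move=> x; apply: continuous_comp; [exact: opp_continuous|exact: cf].
have mfN : measurable_fun [set: R] (fun x => f (- x)).
  exact: continuous_measurable_fun.
have mposnums : measurable [set x : R | 0 <= x]%R by rewrite -set_itvcy.
rewrite -[in LHS](setUv [set x : R | 0 <= x]%R) ge0_integral_setU//= ; last 4 first.
- exact: measurableC.
- by apply/measurable_EFinP; rewrite setUv.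
- by move=> x _; rewrite lee_fin.
- exact/disj_setPCl.
rewrite -set_itvcy setCitvr.
rewrite integral_itv_bndo_bndc; last exact/measurable_EFinP/measurable_funTS.
rewrite -{2}oppr0 ge0_integration_by_substitutionNy//; last first.
  exact: continuous_subspaceT.
rewrite -ge0_integralD//.
- by move=> x _; rewrite lee_fin.
- by apply/measurable_EFinP; apply: measurable_funTS; exact: mf.
- by move=> x _; rewrite lee_fin /=.
- by apply/measurable_EFinP; apply: measurable_funTS; exact: mfN.
Qed.

Lemma continuous_derivable (f : R -> R) :
  (forall x : R, derivable f x 1) -> continuous f.
Proof.
by move=> df x; apply: differentiable_continuous; exact/derivable1_diffP.
Qed.

Lemma ge0_integral_antiderivative (f F : R -> R) (l c : R) :
  (forall x, 0 <= x -> 0 <= f x) -> continuous f ->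
  (forall x : R, is_derive x 1 F (f x)) ->
  F x @[x --> +oo] --> l -> l - F 0 = c ->
  (\int[mu]_(x in `[0%R, +oo[) (f x)%:E = c%:E)%E.
Proof.
move=> f0 cf dF Fl <-.
rewrite (@ge0_continuous_FTC2y _ f F 0 l)//.
- exact: continuous_subspaceT.
- apply: cvg_at_right_filter.
  by apply: continuous_derivable => x; exact: ex_derive.
- by move=> x _; rewrite derive1E derive_val.
Qed.

Lemma cvg_expRN (e : R) : 0 < e -> expR (- (e * x)) @[x --> +oo] --> (0 : R).
Proof.
move=> e0.
have H : e * x @[x --> +oo] --> +oo by apply: gt0_cvgMry => //; exact: cvg_id.
exact: (cvg_comp _ _ H (@cvgr_expR R)).
Qed.

Lemma cvgMr0_bounded (g h : R -> R) (M : R) : (forall x, `|h x| <= M) ->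
  g x @[x --> +oo] --> (0 : R) -> g x * h x @[x --> +oo] --> (0 : R).
Proof.
move=> hM g0; apply/norm_cvg0P.
apply: (@squeeze_cvgr _ _ _ _ (fun=> 0) (fun x => `|g x| * M)).
- by near=> x; rewrite normr_ge0/= normrM ler_wpM2l.
- exact: cvg_cst.
- rewrite -[X in _ --> X](mul0r M); apply: cvgMr_tmp.
  by apply/norm_cvg0P.
Unshelve. all: by end_near. Qed.

Lemma continuous_laplace (e : R) : continuous (fun x : R => expR (- (e * `|x|))).
Proof.
move=> x; apply: (@continuous_comp _ _ _ (fun x : R => `|x|) (fun y => expR (- (e * y)))).
  exact: norm_continuous.
by apply: continuous_derivable => y; exact: ex_derive.
Qed.

Lemma continuous_1cos (z : R) : continuous (fun x : R => 1 + cos (z * x)).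
Proof. by apply: continuous_derivable => y; exact: ex_derive. Qed.

Lemma continuous_1sin (z : R) : continuous (fun x : R => 1 + sin (z * x)).
Proof. by apply: continuous_derivable => y; exact: ex_derive. Qed.

(* [1 + cos] and [1 + sin] make the integrands nonnegative, as required by the
   fundamental theorem of calculus on a half-line. *)
Lemma integral_laplace_cos (e z : R) : 0 < e ->
  (\int[mu]_t (expR (- (e * `|t|)) * (1 + cos (z * t)))%:E =
    (2 / e + 2 * e / (e ^+ 2 + z ^+ 2))%:E)%E.
Proof.
move=> e0.
have D0 : e ^+ 2 + z ^+ 2 != 0.
  by rewrite gt_eqF// ltr_pwDl ?exprn_gt0// sqr_ge0.
rewrite ge0_integral_fold.
rewrite (_ : (\int[mu]_(x in _) _ =
  \int[mu]_(x in `[0%R, +oo[) (2 * (expR (- (e * x)) * (1 + cos (z * x))))%:E)%E); last first.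
  apply: eq_integral => x; rewrite inE/= in_itv/= andbT => x0.
  by rewrite normrN (ger0_norm x0) mulrN cosN mulr_natl mulr2n.
(* The antiderivative keeps the decaying exponential as a factor: the other factor is bounded, so
   the limit at infinity is 0 and the integral equals [- F 0]. *)
pose F x := expR (- (e * x)) * (- (2 / e) + 2 * (z * sin (z * x) - e * cos (z * x)) / (e ^+ 2 + z ^+ 2)).
apply: (@ge0_integral_antiderivative _ F 0).
- move=> x x0; have := cos_geN1 (z * x); have := expR_ge0 (- (e * x)); nra.
- by apply: continuous_derivable => y; exact: ex_derive.
- move=> x; rewrite /F; apply: is_derive_eq.
  by rewrite /GRing.scale/=; field; rewrite D0 gt_eqF.
- apply: (@cvgMr0_bounded _ _ (2 / e + 2 * (`|z| + e) / (e ^+ 2 + z ^+ 2))).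
    move=> x; rewrite (le_trans (ler_normD _ _))// lerD//.
      by rewrite normrN ger0_norm// divr_ge0// ltW.
    have D1 : 0 <= (e ^+ 2 + z ^+ 2)^-1 by rewrite invr_ge0 addr_ge0// sqr_ge0.
    rewrite normrM (ger0_norm D1) ler_wpM2r// normrM (ger0_norm (ler0n _ 2)).
    rewrite ler_wpM2l// (le_trans (ler_normB _ _))// !normrM lerD//.
      by rewrite ler_piMr// ler_norml sin_geN1 sin_le1.
    by rewrite (gtr0_norm e0) ler_piMr ?(ltW e0)// ler_norml cos_geN1 cos_le1.
  exact: cvg_expRN.
- by rewrite /F !mulr0 oppr0 expR0 sin0 cos0; field; rewrite D0 gt_eqF.
- by move=> x; rewrite mulr_ge0 ?expR_ge0// -lerBlDl sub0r cos_geN1.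
- by move=> x; apply: cvgM; [exact: continuous_laplace|exact: continuous_1cos].
Qed.

End one_dimensional_integrals.

Section trigonometric_and_gauss_integrals.
Context {R : realType}.
Local Notation mu := (@lebesgue_measure R).

(** Folding cancels the odd sine, so the value does not depend on [z]; taking [z = 0] gives the mass
    of the weight. *)
Lemma integral_laplace_sin (e z : R) : 0 < e ->
  (\int[mu]_t (expR (- (e * `|t|)) * (1 + sin (z * t)))%:E = (2 / e)%:E)%E.
Proof.
move=> e0; rewrite ge0_integral_fold.
- transitivity (\int[mu]_(x in `[0%R, +oo[) (expR (- (e * x)) * 2)%:E)%E.
    apply: eq_integral.
    move=> x; rewrite inE/= in_itv/= andbT => x0.
    rewrite normrN (ger0_norm x0) mulrN sinN -mulrDr; congr (_ * _)%:E; ring.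
  apply: (@ge0_integral_antiderivative _ _ (fun x => expR (- (e * x)) * - (2 / e)) 0).
  + by move=> x x0; rewrite mulr_ge0 ?expR_ge0.
  + by apply: continuous_derivable => y; exact: ex_derive.
  + move=> x; apply: is_derive_eq.
    by rewrite /GRing.scale/=; field; rewrite gt_eqF.
  + apply: (@cvgMr0_bounded _ _ _ (2 / e)); last exact: cvg_expRN.
    by move=> x; rewrite normrN ger0_norm// divr_ge0// ltW.
  + by rewrite !mulr0 oppr0 expR0; ring.
- by move=> x; rewrite mulr_ge0 ?expR_ge0// -lerBlDl sub0r sin_geN1.
- by move=> x; apply: cvgM; [exact: continuous_laplace|exact: continuous_1sin].
Qed.

Lemma integral_laplace (e : R) : 0 < e ->
  (\int[mu]_t (expR (- (e * `|t|)))%:E = (2 / e)%:E)%E.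
Proof.
move=> e0; rewrite -(integral_laplace_sin 0 e0); apply: eq_integral => t _.
by rewrite mul0r sin0 addr0 mulr1.
Qed.

Lemma integrable_laplace (e : R) : 0 < e ->
  mu.-integrable setT (EFin \o (fun t => expR (- (e * `|t|)))).
Proof.
move=> e0; apply: (@integrable_ge0_integral R _ _ _ _ (2 / e)).
- exact: continuous_measurable_fun (@continuous_laplace _ e).
- by move=> x; exact: expR_ge0.
- by rewrite integral_laplace.
Qed.

(** Subtracts the mass of [w], undoing the shift by 1 that made the integrands nonnegative. *)
Let Rintegral_sub1 (w g : R -> R) (a b : R) : (forall t, `|g t| <= 1) ->
  measurable_fun setT g ->
  mu.-integrable setT (EFin \o w) -> (forall t, 0 <= w t) ->
  (\int[mu]_t (w t)%:E = b%:E)%E ->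
  (\int[mu]_t (w t * (1 + g t))%:E = (b + a)%:E)%E ->
  \int[mu]_t (w t * g t) = a.
Proof.
move=> g1 mg iw w0 wb wgE.
have iwg : mu.-integrable setT (EFin \o (fun t => w t * g t)).
  apply: (integrable_dom _ _ iw).
    by apply: measurable_funM => //; apply/measurable_EFinP; exact: (measurable_int _ iw).
  by move=> t; rewrite normrM (ger0_norm (w0 t)) ler_piMr.
apply: (@addrI _ b); rewrite -[RHS]/(fine (b + a)%:E) -wgE.
rewrite -[in LHS]/(fine b%:E) -wb -/(Rintegral _ _ _) -RintegralD//.
by apply: eq_Rintegral => t _; rewrite mulrDr mulr1.
Qed.

Lemma Rintegral_laplace_cos (e z : R) : 0 < e ->
  \int[mu]_t (expR (- (e * `|t|)) * cos (z * t)) = 2 * e / (e ^+ 2 + z ^+ 2).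
Proof.
move=> e0; apply: (Rintegral_sub1 _ _ (integrable_laplace e0) _ (integral_laplace e0)).
- by move=> t; rewrite ler_norml cos_geN1 cos_le1.
- apply: continuous_measurable_fun.
  by apply: continuous_derivable => y; exact: ex_derive.
- by move=> t; exact: expR_ge0.
- exact: integral_laplace_cos.
Qed.

Lemma Rintegral_laplace_sin (e z : R) : 0 < e ->
  \int[mu]_t (expR (- (e * `|t|)) * sin (z * t)) = 0.
Proof.
move=> e0; apply: (Rintegral_sub1 _ _ (integrable_laplace e0) _ (integral_laplace e0)).
- by move=> t; rewrite ler_norml sin_geN1 sin_le1.
- apply: continuous_measurable_fun.
  by apply: continuous_derivable => y; exact: ex_derive.
- by move=> t; exact: expR_ge0.
- by rewrite addr0; exact: integral_laplace_sin.
Qed.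

Lemma continuous_cauchy (e y : R) : 0 < e ->
  continuous (fun t : R => 2 * e / (e ^+ 2 + (t - y) ^+ 2)).
Proof.
move=> e0 t; apply: cvgM; first exact: cvg_cst.
apply: (@cvgV _ _ _ _ (fun t : R => e ^+ 2 + (t - y) ^+ 2)).
  by rewrite gt_eqF// ltr_pwDl ?exprn_gt0// sqr_ge0.
move: t; apply: (@continuous_derivable _ (fun t : R => e ^+ 2 + (t - y) ^+ 2)) => t.
exact: ex_derive.
Qed.

Lemma integral_cauchy (e y : R) : 0 < e ->
  (\int[mu]_t (2 * e / (e ^+ 2 + (t - y) ^+ 2))%:E = (2 * pi)%:E)%E.
Proof.
move=> e0.
have D0 t : 0 < e ^+ 2 + t ^+ 2.
  by rewrite ltr_pwDl ?exprn_gt0// sqr_ge0.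
have f0 t : 0 <= 2 * e / (e ^+ 2 + t ^+ 2).
  by rewrite divr_ge0 ?mulr_ge0// ltW.
rewrite ge0_integral_fold//; last exact: continuous_cauchy.
(* One arctangent comes from each half-line. At 0 they cancel by oddness, and each tends to pi / 2,
   which leaves 2 * pi whatever [y] is. *)
pose F x := 2 * atan ((x - y) * e^-1) + 2 * atan ((x + y) * e^-1).
apply: (@ge0_integral_antiderivative _ _ F (2 * pi)).
- by move=> x _; rewrite addr_ge0.
- have c1 : continuous (fun x : R => 2 * e / (e ^+ 2 + (- x - y) ^+ 2)).
    move=> x; apply: (@continuous_comp _ _ _ -%R (fun t => 2 * e / (e ^+ 2 + (t - y) ^+ 2))).
      exact: opp_continuous.
    exact: continuous_cauchy.
  by move=> x; apply: cvgD; [exact: continuous_cauchy|exact: c1].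
- move=> x; rewrite /F; apply: is_derive_eq.
  have := D0 (x - y); have := D0 (- x - y).
  rewrite /GRing.scale/= => d1 d2; field.
  by rewrite !gt_eqF.
- rewrite (_ : 2 * pi = 2 * (pi / 2) + 2 * (pi / 2)); last by field.
  have lim (c : R) : atan ((x + c) * e^-1) @[x --> +oo] --> pi / 2.
    have H : (x + c) * e^-1 @[x --> +oo] --> +oo.
      apply/cvgryPge => A; near=> x.
      by rewrite ler_pdivlMr// -lerBlDr; near: x; apply: nbhs_pinfty_ge; exact: num_real.
    exact: (cvg_comp _ _ H (@cvgy_atan R)).
  by apply: cvgD; apply: cvgM; (try exact: cvg_cst); exact: lim.
- rewrite /F sub0r add0r mulNr atanN; ring.
Unshelve. all: by end_near. Qed.

(** Rescaling by [Num.sqrt c] in the standard Gaussian integral. *)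
Lemma integral_gauss (c : R) : 0 < c ->
  (\int[mu]_t (expR (- (c * t ^+ 2)))%:E = (Num.sqrt (pi / c))%:E)%E.
Proof.
move=> c0; pose s := Num.sqrt c; have s0 : 0 < s by rewrite sqrtr_gt0.
have dF (x : R) : is_derive x 1 (fun x => s * x) s.
  by apply: is_derive_eq; rewrite /GRing.scale/= mulr1.
have dFE : (fun x => s * x)^`()%classic = cst s.
  by apply/funext => x; rewrite derive1E derive_val.
have := @increasing_ge0_integration_by_substitutionT R (fun x => s * x) (@gauss_fun R).
rewrite dFE integralT_gauss => /(_ _ _ _ _ _ _ _ _ _)/esym H.
have {}H : (\int[mu]_t (s * expR (- (c * t ^+ 2)))%:E = (Num.sqrt pi)%:E)%E.
  rewrite -H.
  - apply: eq_integral => t _; rewrite !fctE /gauss_fun exprMn sqr_sqrtr ?ltW//.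
    by rewrite mulrC.
  - by move=> x y xy; rewrite ltr_pM2l.
  - by move=> x; exact: cvg_cst.
  - exact: is_cvg_cst.
  - exact: is_cvg_cst.
  - by move=> x; exact: ex_derive.
  - apply/cvgrNyPle => A; near=> x.
    by rewrite mulrC -ler_pdivlMr//; near: x; apply: nbhs_ninfty_le; exact: num_real.
  - by apply: gt0_cvgMry => //; exact: cvg_id.
  - exact: continuous_gauss_fun.
  - exact: gauss_fun_ge0.
have mg : measurable_fun setT (fun t : R => expR (- (c * t ^+ 2))).
  apply: continuous_measurable_fun.
  by apply: continuous_derivable => y; exact: ex_derive.
rewrite sqrtrM ?pi_ge0// sqrtrV ?ltW// mulrC EFinM -H.
under [in RHS]eq_integral do rewrite EFinM.
rewrite ge0_integralZl//.
- by rewrite muleA -EFinM mulVf ?gt_eqF// mul1e.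
- exact/measurable_EFinP.
- by rewrite lee_fin ltW.
Unshelve. all: by end_near. Qed.

End trigonometric_and_gauss_integrals.

(** * Plancherel's inequality *)

Section laplace_weight.
Context {R : realType}.
Local Notation mu := (@lebesgue_measure R).

(** The l^1 norm in the exponent makes the weight a product over coordinates, so that its integral
    and its Fourier transform both reduce to dimension one. *)
Definition laplace_weight n (e : R) (x : 'rV[R]_n) : R :=
  \prod_i expR (- (e * `|x ord0 i|)).

Definition cauchy_kernel n (e : R) (z : 'rV[R]_n) : R :=
  \prod_i (2 * e / (e ^+ 2 + z ord0 i ^+ 2)).

Lemma measurable_laplace_weight n e : measurable_fun setT (@laplace_weight n e).
Proof.
apply: (@measurable_prod_coord _ _ (fun _ t => expR (- (e * `|t|)))) => i.
exact: continuous_measurable_fun (@continuous_laplace _ e).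
Qed.

Lemma laplace_weightE n e (x : 'rV[R]_n) :
  laplace_weight e x = expR (- (e * \sum_i `|x ord0 i|)).
Proof. by rewrite mulr_sumr -sumrN expR_sum. Qed.

Lemma laplace_weight_gt0 n e (x : 'rV[R]_n) : 0 < laplace_weight e x.
Proof. by rewrite laplace_weightE expR_gt0. Qed.

Lemma integrable_laplace_weight n e : 0 < e ->
  (lebesgue_rV n).-integrable setT (EFin \o (@laplace_weight n e)).
Proof.
move=> e0; apply: (@integrable_ge0_integral R _ _ _ _ (\prod_(i < n) (2 / e))).
- exact: measurable_laplace_weight.
- by move=> x; exact/ltW/laplace_weight_gt0.
- rewrite (@ge0_integral_prod _ _ (fun _ t => expR (- (e * `|t|))) (fun=> 2 / e))//.
  + by move=> _; exact: continuous_measurable_fun (@continuous_laplace _ e).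
  + by move=> _; exact: integral_laplace.
Qed.

Lemma laplace_weight_cons n e (p : R * 'rV[R]_n) :
  laplace_weight e (@rV_cons R n p) = expR (- (e * `|p.1|)) * laplace_weight e p.2.
Proof.
rewrite /laplace_weight big_ord_recl rV_cons0; congr (_ * _).
by apply: eq_bigr => i _; rewrite rV_consS.
Qed.

Lemma dotp_cons n (z : 'rV[R]_n.+1) (p : R * 'rV[R]_n) :
  dotp z (@rV_cons R n p) =
  z ord0 ord0 * p.1 + dotp (\row_i z ord0 (lift ord0 i)) p.2.
Proof.
rewrite /dotp big_ord_recl rV_cons0; congr (_ + _).
by apply: eq_bigr => i _; rewrite rV_consS mxE.
Qed.

Lemma measurable_dotp_r n (z : 'rV[R]_n) : measurable_fun setT (dotp z).
Proof. exact: measurable_dotp. Qed.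

Lemma measurable_cos_dotp n (z : 'rV[R]_n) : measurable_fun setT (fun x => cos (dotp z x)).
Proof. by apply: measurableT_comp measurable_cos _; exact: measurable_dotp. Qed.

Lemma measurable_sin_dotp n (z : 'rV[R]_n) : measurable_fun setT (fun x => sin (dotp z x)).
Proof. by apply: measurableT_comp measurable_sin _; exact: measurable_dotp. Qed.

Lemma cos_max (x : R) : `|cos x| <= 1.
Proof. by rewrite ler_norml cos_geN1 cos_le1. Qed.

Lemma sin_max (x : R) : `|sin x| <= 1.
Proof. by rewrite ler_norml sin_geN1 sin_le1. Qed.

Lemma integrable_bounded_mul d (T : measurableType d) (nu : {measure set T -> \bar R})
    (w g : T -> R) : nu.-integrable setT (EFin \o w) ->
  measurable_fun setT g -> (forall x, `|g x| <= 1) ->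
  nu.-integrable setT (EFin \o (fun x => w x * g x)).
Proof.
move=> iw mg g1; apply: (integrable_dom _ _ (integrable_norm iw)).
  by apply: measurable_funM => //; apply/measurable_EFinP; exact: (measurable_int _ iw).
by move=> x; rewrite /= normrM ler_piMr.
Qed.

Lemma Rintegral_lin2 d (T : measurableType d) (nu : {measure set T -> \bar R})
    (f g : T -> R) (a b : R) : nu.-integrable setT (EFin \o f) ->
  nu.-integrable setT (EFin \o g) ->
  \int[nu]_x (a * f x + b * g x) = a * \int[nu]_x f x + b * \int[nu]_x g x.
Proof.
move=> fi gi; rewrite RintegralD//; last 2 first.
- exact: integrable_scale.
- exact: integrable_scale.
by rewrite !RintegralZl.
Qed.

(** The two identities go through one induction because the addition formulas, applied when the
    first coordinate is split off, mix the cosine and the sine of the remaining ones. *)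
Lemma laplace_weight_transform n (e : R) (z : 'rV[R]_n) : 0 < e ->
  \int[lebesgue_rV n]_x (laplace_weight e x * cos (dotp z x)) = cauchy_kernel e z /\
  \int[lebesgue_rV n]_x (laplace_weight e x * sin (dotp z x)) = 0.
Proof.
move=> e0; elim: n z => [|n ih] z.
  have int0 (F : 'rV[R]_0 -> R) : \int[lebesgue_rV 0]_x F x = F 0.
    have -> : F = cst (F 0) by apply/funext => x /=; rewrite thinmx0.
    rewrite /Rintegral (@eq_measure_integral _ _ _ _ (\d_(0 : 'rV[R]_0)))//.
    rewrite integral_dirac//.
      by rewrite (_ : dirac _ _ = 1%E) ?mul1e//; exact: diracT.
    exact/measurable_EFinP/measurable_cst.
  rewrite !int0 /laplace_weight /cauchy_kernel /dotp !big_ord0.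
  by rewrite sin0 cos0 mulr1 mulr0.
pose z' := \row_i z ord0 (lift ord0 i).
have [ihc ihs] := ih z'.
have iw := integrable_laplace e0.
have iW := @integrable_laplace_weight n _ e0.
have iWc := integrable_bounded_mul iW (measurable_cos_dotp z') (fun=> cos_max _).
have iWs := integrable_bounded_mul iW (measurable_sin_dotp z') (fun=> sin_max _).
pose w0 (t : R) := expR (- (e * `|t|)).
have bnd (g : 'rV[R]_n.+1 -> R) x v : (forall x, `|g x| <= 1) ->
    `|laplace_weight e (@rV_cons R n (x, v)) * g (@rV_cons R n (x, v))| <=
    w0 x * laplace_weight e v.
  move=> g1; rewrite normrM laplace_weight_cons ger0_norm ?ler_piMr//.
    by rewrite mulr_ge0 ?expR_ge0//; exact/ltW/laplace_weight_gt0.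
  by rewrite mulr_ge0 ?expR_ge0//; exact/ltW/laplace_weight_gt0.
have mcos (c : R) : measurable_fun setT (fun t : R => cos (c * t)).
  apply: continuous_measurable_fun.
  by apply: continuous_derivable => y; exact: ex_derive.
have msin (c : R) : measurable_fun setT (fun t : R => sin (c * t)).
  apply: continuous_measurable_fun.
  by apply: continuous_derivable => y; exact: ex_derive.
have -> : cauchy_kernel e z = 2 * e / (e ^+ 2 + z ord0 ord0 ^+ 2) * cauchy_kernel e z'.
  rewrite /cauchy_kernel big_ord_recl; congr (_ * _).
  by apply: eq_bigr => i _; rewrite mxE.
have iwc := integrable_bounded_mul iw (mcos (z ord0 ord0)) (fun=> cos_max _).
have iws := integrable_bounded_mul iw (msin (z ord0 ord0)) (fun=> sin_max _).
split.
- rewrite (@Rintegral_rV_cons _ _ _ w0 (laplace_weight e))//; last 2 first.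
  + apply: measurable_funM; first exact: measurable_laplace_weight.
    exact: measurable_cos_dotp.
  + by move=> x v; apply: (bnd (fun x => cos (dotp z x))) => ?; exact: cos_max.
  rewrite -(Rintegral_laplace_cos _ e0) -RintegralZr//.
  apply: eq_Rintegral => x _.
  transitivity (\int[lebesgue_rV n]_v
    (w0 x * cos (z ord0 ord0 * x) * (laplace_weight e v * cos (dotp z' v)) +
     - (w0 x * sin (z ord0 ord0 * x)) * (laplace_weight e v * sin (dotp z' v)))).
    apply: eq_Rintegral => v _.
    by rewrite laplace_weight_cons dotp_cons cosD /w0 /=; ring.
  by rewrite Rintegral_lin2// ihc ihs mulr0 addr0.
- rewrite (@Rintegral_rV_cons _ _ _ w0 (laplace_weight e))//; last 2 first.
  + apply: measurable_funM; first exact: measurable_laplace_weight.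
    exact: measurable_sin_dotp.
  + by move=> x v; apply: (bnd (fun x => sin (dotp z x))) => ?; exact: sin_max.
  rewrite -(mul0r (cauchy_kernel e z')) -(Rintegral_laplace_sin (z ord0 ord0) e0) -RintegralZr//.
  apply: eq_Rintegral => x _.
  transitivity (\int[lebesgue_rV n]_v
    (w0 x * sin (z ord0 ord0 * x) * (laplace_weight e v * cos (dotp z' v)) +
     w0 x * cos (z ord0 ord0 * x) * (laplace_weight e v * sin (dotp z' v)))).
    apply: eq_Rintegral => v _.
    by rewrite laplace_weight_cons dotp_cons sinD /w0 /=; ring.
  by rewrite Rintegral_lin2// ihc ihs mulr0 addr0.
Qed.

Lemma cauchy_kernel_ge0 n (e : R) (z : 'rV[R]_n) : 0 < e -> 0 <= cauchy_kernel e z.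
Proof.
move=> e0; apply: prodr_ge0 => i _.
by rewrite divr_ge0 ?mulr_ge0// ?addr_ge0 ?sqr_ge0// ltW.
Qed.

Lemma measurable_cauchy_kernel n (e : R) : 0 < e ->
  measurable_fun setT (@cauchy_kernel n e).
Proof.
move=> e0; apply: (@measurable_prod_coord _ _ (fun _ t => 2 * e / (e ^+ 2 + t ^+ 2))) => i.
apply: continuous_measurable_fun.
have := @continuous_cauchy R _ 0 e0.
by under eq_fun do rewrite subr0.
Qed.

Lemma integral_cauchy_kernel n (e : R) (y : 'rV[R]_n) : 0 < e ->
  (\int[lebesgue_rV n]_x (cauchy_kernel e (x - y))%:E = ((2 * pi) ^+ n)%:E)%E.
Proof.
move=> e0.
transitivity (\int[lebesgue_rV n]_x
   (\prod_i (2 * e / (e ^+ 2 + (x ord0 i - y ord0 i) ^+ 2)))%:E)%E.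
  apply: eq_integral => x _; congr EFin; apply: eq_bigr => i _.
  by rewrite !mxE.
rewrite (@ge0_integral_prod _ _ (fun i t => 2 * e / (e ^+ 2 + (t - y ord0 i) ^+ 2)) (fun=> 2 * pi)).
- by rewrite prodr_const card_ord.
- by move=> i; apply: continuous_measurable_fun; exact: continuous_cauchy.
- by move=> i t; rewrite divr_ge0 ?mulr_ge0// ?addr_ge0 ?sqr_ge0// ltW.
- by move=> i; exact: integral_cauchy.
Qed.

Lemma cauchy_kernelC n (e : R) (x y : 'rV[R]_n) :
  cauchy_kernel e (x - y) = cauchy_kernel e (y - x).
Proof. apply: eq_bigr => i _; rewrite !mxE; congr (_ / (_ + _)); ring. Qed.

End laplace_weight.

Section plancherel.
Context {R : realType} {n : nat}.
Local Notation mu := (lebesgue_rV n : {sigma_finite_measure set 'rV[R]_n -> \bar R}).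

(** The majorant is uniform in [x], hence not integrable in [x]. Multiplying by a positive
    integrable weight produces a product majorant, to which Fubini applies; the weight is then
    divided out. *)
Lemma measurable_Rintegral_param (f : 'rV[R]_n * 'rV[R]_n -> R) (b : 'rV[R]_n -> R) :
  measurable_fun setT f -> (forall x y, `|f (x, y)| <= b y) ->
  mu.-integrable setT (EFin \o b) ->
  measurable_fun setT (fun x => \int[mu]_y f (x, y)).
Proof.
move=> mf fb ib; pose w := @laplace_weight R n 1.
have w0 x : 0 < w x by exact: laplace_weight_gt0.
have mw : measurable_fun setT w by exact: measurable_laplace_weight.
pose wf := fun p : 'rV[R]_n * 'rV[R]_n => w p.1 * f p.
have mwf : measurable_fun setT wf.
  by apply: measurable_funM => //; apply: measurableT_comp.
have wfb x y : `|wf (x, y)| <= w x * b y.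
  by rewrite /wf normrM gtr0_norm// ler_wpM2l// ltW.
have iw : mu.-integrable setT (EFin \o w) by exact: integrable_laplace_weight.
have /(measurable_int _)/measurable_EFinP := integrable_Rintegral_section1 mwf wfb iw ib.
move=> mW; have -> : (fun x => \int[mu]_y f (x, y)) =
   (fun x => (w x)^-1 * \int[mu]_y wf (x, y)).
  apply/funext => x; rewrite -RintegralZl//; last exact: integrable_section1 wfb ib x.
  by apply: eq_Rintegral => y _; rewrite /wf mulKf// gt_eqF.
apply: measurable_funM => //.
rewrite (_ : (fun x => (w x)^-1) = fun x => expR (1 * \sum_i `|x ord0 i|)); last first.
  by apply/funext => x; rewrite /w laplace_weightE expRN invrK.
apply: measurableT_comp => //.
apply: measurable_funM => //; apply: measurable_sum => i.
by apply: measurableT_comp => //; exact: measurable_rV_coord.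
Qed.

Variable a : 'rV[R]_n -> R.
Hypothesis ia : mu.-integrable setT (EFin \o a).

(** With [sin_transform], the two parts of the integral of exp (i x . y) a(y), kept apart so that
    Plancherel's inequality is argued with real integrals only. *)
Definition cos_transform (x : 'rV[R]_n) := \int[mu]_y (cos (dotp x y) * a y).
Definition sin_transform (x : 'rV[R]_n) := \int[mu]_y (sin (dotp x y) * a y).

Let ma : measurable_fun setT a.
Proof. by apply/measurable_EFinP; exact: (measurable_int _ ia). Qed.

Let A := \int[mu]_y `|a y|.

Lemma measurable_cos_transform : measurable_fun setT cos_transform.
Proof.
apply: (@measurable_Rintegral_param (fun p => cos (dotp p.1 p.2) * a p.2) (fun y => `|a y|)).
- apply: measurable_funM; last exact: measurableT_comp.
  by apply: measurableT_comp measurable_cos _; exact: measurable_dotp.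
- by move=> x y; rewrite normrM ler_piMl// cos_max.
- exact: integrable_norm.
Qed.

Lemma measurable_sin_transform : measurable_fun setT sin_transform.
Proof.
apply: (@measurable_Rintegral_param (fun p => sin (dotp p.1 p.2) * a p.2) (fun y => `|a y|)).
- apply: measurable_funM; last exact: measurableT_comp.
  by apply: measurableT_comp measurable_sin _; exact: measurable_dotp.
- by move=> x y; rewrite normrM ler_piMl// sin_max.
- exact: integrable_norm.
Qed.

Let icos x : mu.-integrable setT (EFin \o (fun y => cos (dotp x y) * a y)).
Proof.
have := integrable_bounded_mul ia (measurable_cos_dotp x) (fun=> cos_max _).
by under eq_fun do rewrite mulrC.
Qed.

Let isin x : mu.-integrable setT (EFin \o (fun y => sin (dotp x y) * a y)).
Proof.
have := integrable_bounded_mul ia (measurable_sin_dotp x) (fun=> sin_max _).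
by under eq_fun do rewrite mulrC.
Qed.

Lemma le_cos_transform x : `|cos_transform x| <= A.
Proof.
apply: (le_trans (le_normr_Rintegral _ (icos x))) => //.
apply: le_Rintegral => //.
- exact: integrable_norm (icos x).
- exact: integrable_norm.
- by move=> y _; rewrite normrM ler_piMl// cos_max.
Qed.

Lemma le_sin_transform x : `|sin_transform x| <= A.
Proof.
apply: (le_trans (le_normr_Rintegral _ (isin x))) => //.
apply: le_Rintegral => //.
- exact: integrable_norm (isin x).
- exact: integrable_norm.
- by move=> y _; rewrite normrM ler_piMl// sin_max.
Qed.

Lemma dotpBl (x y z : 'rV[R]_n) : dotp (x - y) z = dotp x z - dotp y z.
Proof.
by rewrite /dotp -sumrB; apply: eq_bigr => i _; rewrite !mxE mulrBl.
Qed.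

Lemma dotpC (x y : 'rV[R]_n) : dotp x y = dotp y x.
Proof. by apply: eq_bigr => i _; rewrite mulrC. Qed.

(** The squared transform is the double integral of a(y) a(z) cos (x . (y - z)); integrating in [x]
    against the weight turns the cosine into the Cauchy kernel. *)
Lemma weighted_transform_identity (e : R) : 0 < e ->
  \int[mu]_x (laplace_weight e x * (cos_transform x ^+ 2 + sin_transform x ^+ 2)) =
  \int[mu]_x (a x * \int[mu]_y (a y * cauchy_kernel e (x - y))).
Proof.
move=> e0; pose w := @laplace_weight R n e.
have w0 x : 0 < w x by exact: laplace_weight_gt0.
have mw : measurable_fun setT w by exact: measurable_laplace_weight.
have iw : mu.-integrable setT (EFin \o w) by exact: integrable_laplace_weight.
have mC := measurable_cos_transform; have mS := measurable_sin_transform.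
have mcosd d (T : measurableType d) (u v : T -> 'rV[R]_n) :
    measurable_fun setT u -> measurable_fun setT v ->
    measurable_fun setT (fun t => cos (dotp (u t) (v t))).
  by move=> mu' mv; apply: measurableT_comp measurable_cos _; exact: measurable_dotp.
have msind d (T : measurableType d) (u v : T -> 'rV[R]_n) :
    measurable_fun setT u -> measurable_fun setT v ->
    measurable_fun setT (fun t => sin (dotp (u t) (v t))).
  by move=> mu' mv; apply: measurableT_comp measurable_sin _; exact: measurable_dotp.
(* Only one factor of each square is opened into an integral. The other stays closed and is bounded
   by the L^1 norm [A], so that [f1] has a product majorant and Fubini applies in two variables. *)
pose f1 (p : 'rV[R]_n * 'rV[R]_n) := w p.1 * (cos (dotp p.1 p.2) * cos_transform p.1 +
    sin (dotp p.1 p.2) * sin_transform p.1) * a p.2.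
have mf1 : measurable_fun setT f1.
  apply: measurable_funM; last exact: measurableT_comp.
  apply: measurable_funM; first exact: measurableT_comp.
  apply: measurable_funD; apply: measurable_funM.
  - exact: mcosd.
  - exact: measurableT_comp mC _.
  - exact: msind.
  - exact: measurableT_comp mS _.
have A0 : 0 <= A by exact: Rintegral_ge0.
have f1b x y : `|f1 (x, y)| <= (2 * A * w x) * `|a y|.
  rewrite /f1/= !normrM ler_wpM2r// (gtr0_norm (w0 x)) mulrC ler_wpM2r ?(ltW (w0 x))//.
  rewrite (le_trans (ler_normD _ _))// mulr_natl mulr2n lerD// normrM -[leRHS]mul1r.
    by rewrite ler_pM// ?cos_max ?le_cos_transform.
  by rewrite ler_pM// ?sin_max ?le_sin_transform.
have iAw := integrable_scale (2 * A) iw.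
transitivity (\int[mu]_x \int[mu]_y f1 (x, y)).
  apply: eq_Rintegral => x _; rewrite /f1 /=.
  transitivity (\int[mu]_y (w x * cos_transform x * (cos (dotp x y) * a y) +
      w x * sin_transform x * (sin (dotp x y) * a y))).
    rewrite (Rintegral_lin2 _ _ (icos x) (isin x)) -/(cos_transform x) -/(sin_transform x) /w. ring.
  by apply: eq_Rintegral => y _; ring.
rewrite (Rfubini_dom mf1 f1b iAw (integrable_norm ia)).
apply: eq_Rintegral => y _.
(* For fixed [y] the second factor is opened in turn, and the addition formula merges the two
   oscillations into the cosine of a difference. *)
pose f2 (p : 'rV[R]_n * 'rV[R]_n) := w p.1 * a p.2 * cos (dotp (y - p.2) p.1).
have mf2 : measurable_fun setT f2.
  apply: measurable_funM.
    by apply: measurable_funM; exact: measurableT_comp.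
  by apply: mcosd => //; apply: measurable_rV_sub.
have f2b x z : `|f2 (x, z)| <= w x * `|a z|.
  by rewrite /f2/= !normrM (gtr0_norm (w0 x)) ler_piMr// ?mulr_ge0 ?cos_max// ltW.
transitivity (a y * \int[mu]_x \int[mu]_z f2 (x, z)).
  rewrite -RintegralZl//; last first.
    exact: (integrable_Rintegral_section1 mf2 f2b iw (integrable_norm ia)).
  apply: eq_Rintegral => x _; rewrite /f1 /=.
  transitivity (a y * \int[mu]_z (w x * cos (dotp x y) * (cos (dotp x z) * a z) +
      w x * sin (dotp x y) * (sin (dotp x z) * a z))).
    by rewrite (Rintegral_lin2 _ _ (icos x) (isin x)) -/(cos_transform x) -/(sin_transform x) /w; ring.
  congr (_ * _); apply: eq_Rintegral => z _; rewrite /f2 /=.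
  by rewrite dotpBl cosB !(dotpC x); ring.
congr (_ * _).
rewrite (Rfubini_dom mf2 f2b iw (integrable_norm ia)).
apply: eq_Rintegral => z _.
have [<- _] := laplace_weight_transform (y - z) e0.
rewrite -RintegralZl//; last first.
  exact: (integrable_bounded_mul iw (measurable_cos_dotp _) (fun=> cos_max _)).
by apply: eq_Rintegral => x _; rewrite /f2/= /w; ring.
Qed.

End plancherel.

(** If the extended integral on the left is infinite, its [fine] value is 0 and the bound is
    trivial. *)
Lemma Rintegral_le_integral_abs d (T : measurableType d) (R : realType)
    (nu : {measure set T -> \bar R}) (F : T -> R) : measurable_fun setT F ->
  (`|\int[nu]_x F x|%:E <= \int[nu]_x `|F x|%:E)%E.
Proof.
move=> mF; have mF' : measurable_fun setT (EFin \o F) by exact/measurable_EFinP.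
have := le_abse_integral nu measurableT mF'.
rewrite /Rintegral/=; case: (integral _ _ _) => [r| |] //= _.
  by rewrite normr0; apply: integral_ge0.
by rewrite normr0; apply: integral_ge0.
Qed.

Section plancherel_inequality.
Context {R : realType} {n : nat}.
Local Notation mu := (lebesgue_rV n : {sigma_finite_measure set 'rV[R]_n -> \bar R}).

(** Each factor peaks at 0 with value 2 / e. The blow-up as [e] vanishes is harmless: the bound only
    serves to show that an inner integral is measurable. *)
Lemma cauchy_kernel_le (e : R) (z : 'rV[R]_n) : 0 < e ->
  cauchy_kernel e z <= \prod_(i < n) (2 / e).
Proof.
move=> e0; apply: ler_prod => i _.
rewrite divr_ge0 ?mulr_ge0 ?addr_ge0 ?sqr_ge0 ?(ltW e0)//=.
rewrite ler_pdivrMr; last by rewrite ltr_pwDl ?exprn_gt0// sqr_ge0.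
rewrite mulrDr expr2 mulrA divfK ?gt_eqF// lerDl.
by rewrite mulr_ge0 ?sqr_ge0// divr_ge0// ltW.
Qed.

Variable a : 'rV[R]_n -> R.
Hypothesis ia : mu.-integrable setT (EFin \o a).

Let ma : measurable_fun setT a.
Proof. by apply/measurable_EFinP; exact: (measurable_int _ ia). Qed.

Let mK e : 0 < e -> measurable_fun setT
  (fun p : 'rV[R]_n * 'rV[R]_n => cauchy_kernel e (p.1 - p.2)).
Proof.
move=> e0.
have mm : measurable_fun setT (fun p : 'rV[R]_n * 'rV[R]_n => p.1 - p.2) by exact: measurable_rV_sub.
exact: (measurableT_comp (measurable_cauchy_kernel e0) mm).
Qed.

Lemma weighted_plancherel (e : R) : 0 < e ->
  (\int[mu]_x (laplace_weight e x *
      (cos_transform a x ^+ 2 + sin_transform a x ^+ 2))%:E <=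
   (2 * (2 * pi) ^+ n)%:E * \int[mu]_x (a x ^+ 2)%:E)%E.
Proof.
move=> e0; pose K (x y : 'rV[R]_n) := cauchy_kernel e (x - y).
have K0 x y : 0 <= K x y by exact: cauchy_kernel_ge0.
have mKr x : measurable_fun setT (K x).
  have mx : measurable_fun setT (fun y : 'rV[R]_n => x - y) by exact: measurable_rV_sub.
  exact: (measurableT_comp (measurable_cauchy_kernel e0) mx).
pose A := \int[mu]_y `|a y|.
have iF : mu.-integrable setT (EFin \o (fun x => laplace_weight e x *
      (cos_transform a x ^+ 2 + sin_transform a x ^+ 2))).
  apply: (@integrable_dom _ _ _ _ _ (fun x => 2 * A ^+ 2 * laplace_weight e x)).
  - apply: measurable_funM; first exact: measurable_laplace_weight.
    by apply: measurable_funD; apply: measurable_funX;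
      [exact: measurable_cos_transform|exact: measurable_sin_transform].
  - move=> x; rewrite normrM (gtr0_norm (laplace_weight_gt0 _ _)) mulrC.
    rewrite ler_wpM2r ?(ltW (laplace_weight_gt0 _ _))//.
    rewrite ger0_norm ?addr_ge0 ?sqr_ge0// mulr_natl mulr2n lerD//.
      by rewrite -real_normK ?num_real// lerXn2r ?nnegrE// ?Rintegral_ge0// le_cos_transform.
    by rewrite -real_normK ?num_real// lerXn2r ?nnegrE// ?Rintegral_ge0// le_sin_transform.
  - exact/integrable_scale/integrable_laplace_weight.
rewrite -[leLHS]fineK; last exact: (integrable_fin_num measurableT iF).
rewrite -/(Rintegral _ _ _) weighted_transform_identity//.
(* The inequality |a(x) a(y)| <= a(x)^2 + a(y)^2 is AM-GM up to a factor 2; each of the two terms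
   contributes (2 pi)^n, whence the constant 2 (2 pi)^n. *)
apply: (@le_trans _ _ (\int[mu]_x \int[mu]_y
    ((a x ^+ 2 * K x y)%:E + (a y ^+ 2 * K x y)%:E))%E).
  have mI : measurable_fun setT (fun x => a x * \int[mu]_y (a y * cauchy_kernel e (x - y))).
    apply: measurable_funM => //.
    apply: (@measurable_Rintegral_param _ _
      (fun p => a p.2 * cauchy_kernel e (p.1 - p.2))
      (fun y => (\prod_(i < n) (2 / e)) * `|a y|)).
    - by apply: measurable_funM; [exact: measurableT_comp|exact: mK].
    - move=> x y; rewrite normrM /= mulrC ler_wpM2r// ger0_norm.
        exact: cauchy_kernel_le.
      exact: cauchy_kernel_ge0.
    - exact: (integrable_scale _ (integrable_norm ia)).
  apply: (@le_trans _ _ (`|\int[mu]_x (a x * \int[mu]_y (a y * cauchy_kernel e (x - y)))|%:E)%E).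
    by rewrite lee_fin ler_norm.
  apply: (le_trans (Rintegral_le_integral_abs _ mI)).
  apply: ge0_le_integral => //.
  - by apply/measurable_EFinP; exact: measurableT_comp.
  - apply: (measurable_fun_fubini_tonelli_F (fun p =>
      ((a p.1 ^+ 2 * K p.1 p.2)%:E + (a p.2 ^+ 2 * K p.1 p.2)%:E)%E)) => /=.
      apply: emeasurable_funD; apply/measurable_EFinP; apply: measurable_funM; try exact: mK.
        by apply: measurable_funX; exact: measurableT_comp.
      by apply: measurable_funX; exact: measurableT_comp.
    by move=> p; rewrite -EFinD lee_fin addr_ge0// mulr_ge0 ?sqr_ge0.
  - move=> x _; rewrite normrM.
    have m1 : measurable_fun setT (fun y => a y * K x y) by exact: measurable_funM.
    apply: (@le_trans _ _ (`|a x|%:E * \int[mu]_y `|a y * K x y|%:E)%E).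
      by rewrite EFinM lee_wpmul2l// Rintegral_le_integral_abs.
    rewrite -ge0_integralZl//; last first.
      by apply/measurable_EFinP; exact: measurableT_comp.
    apply: ge0_le_integral => //.
    + apply: measurable_funeM; apply/measurable_EFinP; exact: measurableT_comp.
    + apply: emeasurable_funD; apply/measurable_EFinP; apply: measurable_funM => //.
      exact: measurable_funX.
    + move=> y _; rewrite -EFinM -EFinD lee_fin normrM (ger0_norm (K0 _ _)) mulrA -mulrDl.
      rewrite ler_wpM2r// -(real_normK (num_real (a x))) -(real_normK (num_real (a y))).
      by have := sqr_ge0 (`|a x| - `|a y|); have := normr_ge0 (a x); have := normr_ge0 (a y); nra.
have mJ1 : measurable_fun setT (fun p : 'rV[R]_n * 'rV[R]_n => (a p.1 ^+ 2 * K p.1 p.2)%:E).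
  apply/measurable_EFinP; apply: measurable_funM; last exact: mK.
  by apply: measurable_funX; exact: measurableT_comp.
have mJ2 : measurable_fun setT (fun p : 'rV[R]_n * 'rV[R]_n => (a p.2 ^+ 2 * K p.1 p.2)%:E).
  apply/measurable_EFinP; apply: measurable_funM; last exact: mK.
  by apply: measurable_funX; exact: measurableT_comp.
have J1 p : (0 <= (a p.1 ^+ 2 * K p.1 p.2)%:E)%E.
  by rewrite lee_fin mulr_ge0 ?sqr_ge0.
have J2 p : (0 <= (a p.2 ^+ 2 * K p.1 p.2)%:E)%E.
  by rewrite lee_fin mulr_ge0 ?sqr_ge0.
have ma2 : measurable_fun setT (fun x => (a x ^+ 2)%:E).
  by apply/measurable_EFinP; exact: measurable_funX.
(* The kernel has total mass (2 pi)^n whatever [e] is, so the final bound does not depend on [e]. *)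
have eqK x : (\int[mu]_y (a x ^+ 2 * K x y)%:E = (a x ^+ 2)%:E * ((2 * pi) ^+ n)%:E)%E.
  under eq_integral do rewrite EFinM.
  have mKx : measurable_fun setT (fun y => (K x y)%:E).
    by apply/measurable_EFinP; exact: mKr.
  rewrite ge0_integralZl//; last 2 first.
  - by move=> y _; rewrite lee_fin.
  - by rewrite lee_fin sqr_ge0.
  congr (_ * _)%E; rewrite -(integral_cauchy_kernel x e0).
  by apply: eq_integral => y _; rewrite /K cauchy_kernelC.
have int1 : (\int[mu]_x \int[mu]_y (a x ^+ 2 * K x y)%:E =
    ((2 * pi) ^+ n)%:E * \int[mu]_x (a x ^+ 2)%:E)%E.
  under eq_integral do rewrite eqK muleC.
  rewrite ge0_integralZl//.
    by move=> x _; rewrite lee_fin sqr_ge0.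
  by rewrite lee_fin exprn_ge0// mulr_ge0// pi_ge0.
have int2 : (\int[mu]_x \int[mu]_y (a y ^+ 2 * K x y)%:E =
    ((2 * pi) ^+ n)%:E * \int[mu]_x (a x ^+ 2)%:E)%E.
  (* Tonelli and the symmetry of the kernel bring this term back to the previous one. *)
  have := fubini_tonelli (m1 := mu) (m2 := mu) _ mJ2 J2.
  move=> /= ->; rewrite -int1.
  apply: eq_integral => x _; apply: eq_integral => y _.
  by rewrite /K cauchy_kernelC.
have mJ1x x : measurable_fun setT (fun y => (a x ^+ 2 * K x y)%:E).
  by apply/measurable_EFinP; apply: measurable_funM.
have mJ2x x : measurable_fun setT (fun y => (a y ^+ 2 * K x y)%:E).
  by apply/measurable_EFinP; apply: measurable_funM => //; exact: measurable_funX.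
have -> : (\int[mu]_x \int[mu]_y ((a x ^+ 2 * K x y)%:E + (a y ^+ 2 * K x y)%:E) =
    \int[mu]_x (\int[mu]_y (a x ^+ 2 * K x y)%:E + \int[mu]_y (a y ^+ 2 * K x y)%:E))%E.
  apply: eq_integral => x _; apply: ge0_integralD => //.
  - by move=> y _; exact: (J1 (x, y)).
  - by move=> y _; exact: (J2 (x, y)).
have mI1 := measurable_fun_fubini_tonelli_F (m2 := mu) _ mJ1 J1.
have mI2 := measurable_fun_fubini_tonelli_F (m2 := mu) _ mJ2 J2.
have -> : (\int[mu]_x (\int[mu]_y (a x ^+ 2 * K x y)%:E + \int[mu]_y (a y ^+ 2 * K x y)%:E) =
    \int[mu]_x \int[mu]_y (a x ^+ 2 * K x y)%:E + \int[mu]_x \int[mu]_y (a y ^+ 2 * K x y)%:E)%E.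
  apply: ge0_integralD => //.
  - by move=> x _; apply: integral_ge0 => y _; exact: (J1 (x, y)).
  - by move=> x _; apply: integral_ge0 => y _; exact: (J2 (x, y)).
have c0 : (0 <= ((2 * pi) ^+ n : R)%:E)%E by rewrite lee_fin exprn_ge0// mulr_ge0// pi_ge0.
rewrite int1 int2 (_ : 2 * (2 * pi) ^+ n = (2 * pi) ^+ n + (2 * pi) ^+ n :> R); last by ring.
by rewrite EFinD ge0_muleDl.
Qed.

Lemma plancherel_le :
  (\int[mu]_x (cos_transform a x ^+ 2 + sin_transform a x ^+ 2)%:E <=
   (2 * (2 * pi) ^+ n)%:E * \int[mu]_x (a x ^+ 2)%:E)%E.
Proof.
pose F x := cos_transform a x ^+ 2 + sin_transform a x ^+ 2.
have F0 x : 0 <= F x by rewrite addr_ge0 ?sqr_ge0.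
have mF : measurable_fun setT F.
  by apply: measurable_funD; apply: measurable_funX;
    [exact: measurable_cos_transform|exact: measurable_sin_transform].
(* The parameter 1 / (j + 1) is positive and decreasing in [j], so the weights increase to 1. *)
pose g (j : nat) x := (laplace_weight (j.+1%:R^-1) x * F x)%:E.
have w0 j (x : 'rV[R]_n) : 0 < laplace_weight j x by exact: laplace_weight_gt0.
have glim x : g ^~ x @ \oo --> (F x)%:E.
  apply: cvg_EFin; first by apply: nearW.
  have cw : (fun j : nat => laplace_weight (j.+1%:R^-1) x) @ \oo --> (1 : R).
    under eq_fun do rewrite laplace_weightE.
    have c0 := cvgN (cvgMr_tmp (b := \sum_i `|x ord0 i|) (@cvg_harmonic R)).
    rewrite mul0r oppr0 in c0.
    have := cvg_comp _ _ (c0 _ _) (@continuous_expR R 0); rewrite expR0.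
    by move=> /(_ _ _) H; apply: H.
  by have := cvgMr_tmp (b := F x) cw; rewrite mul1r; move=> /(_ _) H; apply: H.
have mg j : measurable_fun setT (g j).
  by apply/measurable_EFinP; apply: measurable_funM => //; exact: measurable_laplace_weight.
have g0 j x : (0 <= g j x)%E by rewrite lee_fin mulr_ge0// ltW.
have gnd x : {homo g ^~ x : i j / (i <= j)%N >-> (i <= j)%E}.
  move=> i j ij; rewrite /g lee_fin ler_wpM2r// !laplace_weightE ler_expR lerN2.
  rewrite ler_wpM2r ?sumr_ge0// lef_pV2 ?posrE ?ltr0n// ler_nat; exact: ij.
have -> : (\int[mu]_x (F x)%:E = \int[mu]_x (limn (g ^~ x)))%E.
  by apply: eq_integral => x _; apply/esym/cvg_lim.
rewrite monotone_convergence//.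
apply: lime_le.
  by apply: ereal_nondecreasing_is_cvgn => i j ij; apply: ge0_le_integral => // x _; exact: gnd.
by apply: nearW => j; apply: weighted_plancherel; rewrite invr_gt0 ltr0n.
Qed.

End plancherel_inequality.

(** * Complex-valued integrals *)

Section complex_integral.
Context {R : realType}.
Local Open Scope complex_scope.
Implicit Types z w : R[i].

Lemma Re_mulc z w : complex.Re (z * w) =
  complex.Re z * complex.Re w - complex.Im z * complex.Im w.
Proof. by case: z w => [a b] [c d]. Qed.

Lemma Im_mulc z w : complex.Im (z * w) =
  complex.Re z * complex.Im w + complex.Im z * complex.Re w.
Proof. by case: z w => [a b] [c d]. Qed.

Lemma Re_addc z w : complex.Re (z + w) = complex.Re z + complex.Re w.
Proof. by case: z w => [a b] [c d]. Qed.

Lemma Im_addc z w : complex.Im (z + w) = complex.Im z + complex.Im w.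
Proof. by case: z w => [a b] [c d]. Qed.

Lemma Re_oppc z : complex.Re (- z) = - complex.Re z.
Proof. by case: z. Qed.

Lemma Im_oppc z : complex.Im (- z) = - complex.Im z.
Proof. by case: z. Qed.

Lemma Re_sum I (r : seq I) P (F : I -> R[i]) :
  complex.Re (\sum_(i <- r | P i) F i) = \sum_(i <- r | P i) complex.Re (F i).
Proof. exact: (big_morph _ Re_addc). Qed.

Lemma Im_sum I (r : seq I) P (F : I -> R[i]) :
  complex.Im (\sum_(i <- r | P i) F i) = \sum_(i <- r | P i) complex.Im (F i).
Proof. exact: (big_morph _ Im_addc). Qed.

Lemma complex_ext z w :
  complex.Re z = complex.Re w -> complex.Im z = complex.Im w -> z = w.
Proof. by case: z w => [a b] [c d] /= -> ->. Qed.

Lemma normc_sqr z : Normc.normc z ^+ 2 = complex.Re z ^+ 2 + complex.Im z ^+ 2.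
Proof. by case: z => a b /=; rewrite sqr_sqrtr// addr_ge0 ?sqr_ge0. Qed.

Lemma normc_ge0 z : 0 <= Normc.normc z.
Proof. by case: z => a b /=; exact: sqrtr_ge0. Qed.

Lemma le_Re_normc z : `|complex.Re z| <= Normc.normc z.
Proof.
rewrite -(@ler_pXn2r _ 2) ?nnegrE ?normc_ge0// normc_sqr real_normK ?num_real//.
by rewrite lerDl sqr_ge0.
Qed.

Lemma le_Im_normc z : `|complex.Im z| <= Normc.normc z.
Proof.
rewrite -(@ler_pXn2r _ 2) ?nnegrE ?normc_ge0// normc_sqr real_normK ?num_real//.
by rewrite lerDr sqr_ge0.
Qed.

Lemma normc_real (a : R) : Normc.normc a%:C = `|a|.
Proof. by rewrite /= expr0n addr0 sqrtr_sqr. Qed.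

Lemma normc_expi (a : R) : Normc.normc (expi a) = 1.
Proof. by rewrite /= cos2Dsin2 sqrtr1. Qed.

Lemma expiD (a b : R) : expi (a + b) = expi a * expi b.
Proof.
apply: complex_ext; rewrite ?Re_mulc ?Im_mulc /=; first exact: cosD.
by rewrite sinD addrC; ring.
Qed.

(** Componentwise, in agreement with [cintegral], which integrates the two parts separately. *)
Definition cmeasurable d (T : measurableType d) (u : T -> R[i]) :=
  measurable_fun setT (fun x => complex.Re (u x)) /\
  measurable_fun setT (fun x => complex.Im (u x)).

Lemma cmeasurableM d (T : measurableType d) (u v : T -> R[i]) :
  cmeasurable u -> cmeasurable v -> cmeasurable (fun x => u x * v x).
Proof.
move=> [ur ui] [vr vi]; split.
  under eq_fun do rewrite Re_mulc.
  by apply: measurable_funB; apply: measurable_funM.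
under eq_fun do rewrite Im_mulc.
by apply: measurable_funD; apply: measurable_funM.
Qed.

Lemma cmeasurable_real d (T : measurableType d) (a : T -> R) :
  measurable_fun setT a -> cmeasurable (fun x => (a x)%:C).
Proof. by move=> ma; split => //=; exact: measurable_cst. Qed.

Lemma cmeasurable_expi d (T : measurableType d) (a : T -> R) :
  measurable_fun setT a -> cmeasurable (fun x => expi (a x)).
Proof.
move=> ma; split; first exact: (measurableT_comp measurable_cos ma).
exact: (measurableT_comp measurable_sin ma).
Qed.

Lemma measurable_normc d (T : measurableType d) (u : T -> R[i]) :
  cmeasurable u -> measurable_fun setT (fun x => Normc.normc (u x)).
Proof.
move=> [ur ui].
rewrite (_ : (fun _ => _) = fun x => Num.sqrt (complex.Re (u x) ^+ 2 + complex.Im (u x) ^+ 2)).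
  apply: measurableT_comp measurable_sqrtr _.
  by apply: measurable_funD; exact: measurable_funX.
by apply/funext => x; case: (u x).
Qed.

Section integral.
Context {n : nat}.
Local Notation mu := (lebesgue_rV n : {sigma_finite_measure set 'rV[R]_n -> \bar R}).
Implicit Types u v : 'rV[R]_n -> R[i].

Definition cintegrable u :=
  mu.-integrable setT (EFin \o (fun x => complex.Re (u x))) /\
  mu.-integrable setT (EFin \o (fun x => complex.Im (u x))).

Lemma cintegrable_dom u (g : 'rV[R]_n -> R) : cmeasurable u ->
  (forall x, Normc.normc (u x) <= g x) -> mu.-integrable setT (EFin \o g) ->
  cintegrable u.
Proof.
move=> [mr mi] ug ig; split; apply: (integrable_dom _ _ ig) => // x.
  exact: le_trans (le_Re_normc _) _.
exact: le_trans (le_Im_normc _) _.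
Qed.

Lemma cintegralD u v : cintegrable u -> cintegrable v ->
  cintegral (fun x => u x + v x) = cintegral u + cintegral v.
Proof.
move=> [ur ui] [vr vi]; apply: complex_ext; rewrite ?Re_addc ?Im_addc /= -RintegralD//.
  by apply: eq_Rintegral => x _; rewrite Re_addc.
by apply: eq_Rintegral => x _; rewrite Im_addc.
Qed.

Lemma cintegrableD u v : cintegrable u -> cintegrable v ->
  cintegrable (fun x => u x + v x).
Proof.
move=> [ur ui] [vr vi]; split.
  under eq_fun do rewrite Re_addc.
  exact: (integrableD measurableT ur vr).
under eq_fun do rewrite Im_addc.
exact: (integrableD measurableT ui vi).
Qed.

Lemma cintegralZ (c : R[i]) u : cintegrable u ->
  cintegral (fun x => c * u x) = c * cintegral u.
Proof.
move=> [ur ui]; apply: complex_ext; rewrite ?Re_mulc ?Im_mulc /=.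
  rewrite -mulNr -Rintegral_lin2//.
  by apply: eq_Rintegral => x _; rewrite Re_mulc mulNr.
rewrite addrC -Rintegral_lin2//.
by apply: eq_Rintegral => x _; rewrite Im_mulc addrC.
Qed.

Lemma cintegrableZ (c : R[i]) u : cintegrable u ->
  cintegrable (fun x => c * u x).
Proof.
move=> [ur ui]; split.
  under eq_fun do rewrite Re_mulc -mulNr.
  exact: (integrableD measurableT (integrable_scale _ ur) (integrable_scale _ ui)).
under eq_fun do rewrite Im_mulc.
exact: (integrableD measurableT (integrable_scale _ ui) (integrable_scale _ ur)).
Qed.

Lemma cintegral_fubini (u : 'rV[R]_n -> 'rV[R]_n -> R[i]) (a b : 'rV[R]_n -> R) :
  cmeasurable (fun p : 'rV[R]_n * 'rV[R]_n => u p.1 p.2) ->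
  (forall x y, Normc.normc (u x y) <= a x * b y) ->
  mu.-integrable setT (EFin \o a) -> mu.-integrable setT (EFin \o b) ->
  cintegral (fun x => cintegral (fun y => u x y)) =
  cintegral (fun y => cintegral (fun x => u x y)).
Proof.
move=> [mr mi] uab ia ib; apply: complex_ext => /=.
  apply: (Rfubini_dom mr _ ia ib) => x y /=.
  exact: le_trans (le_Re_normc _) _.
apply: (Rfubini_dom mi _ ia ib) => x y /=.
exact: le_trans (le_Im_normc _) _.
Qed.

Lemma eq_cintegral u v : (forall x, u x = v x) -> cintegral u = cintegral v.
Proof. by move=> uv; congr cintegral; exact/funext. Qed.

End integral.
End complex_integral.

(** * Taylor remainders and the multinomial formula *)

Section taylor.
Context {R : realType}.
Local Open Scope complex_scope.

(** [0 -i* 1] is -i: these are the parts of (-i)^m, the numerators of the Taylor coefficients of exp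
    (- i x). *)
Definition expNi_re (m : nat) : R := complex.Re ((0 -i* 1) ^+ m).
Definition expNi_im (m : nat) : R := complex.Im ((0 -i* 1) ^+ m).

Lemma expNi_reS m : expNi_re m.+1 = expNi_im m.
Proof. by rewrite /expNi_re exprS Re_mulc /= mul0r sub0r mulN1r opprK. Qed.

Lemma expNi_imS m : expNi_im m.+1 = - expNi_re m.
Proof. by rewrite /expNi_im exprS Im_mulc /= mul0r add0r mulN1r. Qed.

(* Real and imaginary parts of the Taylor remainder of [exp (- i x)]: the first
   [m] terms of the expansion are removed. *)
Definition taylor_re (m : nat) (x : R) :=
  cos x - \sum_(j < m) expNi_re j * (x ^+ j / j`!%:R).
Definition taylor_im (m : nat) (x : R) :=
  - sin x - \sum_(j < m) expNi_im j * (x ^+ j / j`!%:R).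

(** Differentiating x^j / j! lowers the index, so the coefficient sequence is shifted by one and the
    sum loses a term. *)
Lemma is_derive_taylor_sum (c : nat -> R) m (x : R) :
  is_derive x 1 (fun x => \sum_(j < m.+1) c j * (x ^+ j / j`!%:R))
    (\sum_(j < m) c j.+1 * (x ^+ j / j`!%:R)).
Proof.
elim: m => [|m ih].
  rewrite big_ord0 (_ : (fun _ => _) = cst (c 0%N * (1 / 0`!%:R))).
    exact: is_derive_cst.
  by apply/funext => y; rewrite big_ord1 expr0.
rewrite (_ : (fun _ => _) = (fun x => \sum_(j < m.+1) c j * (x ^+ j / j`!%:R)) +
    (fun x => c m.+1 * (x ^+ m.+1 / m.+1`!%:R))); last first.
  by apply/funext => y; rewrite big_ord_recr.
rewrite big_ord_recr /=; apply: is_deriveD.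
have dX : is_derive x 1 (fun y : R => y ^+ m.+1) (m.+1%:R * x ^+ m).
  have := @is_deriveX R R id m.+1 x 1 1 (is_derive_id _ _).
  rewrite /GRing.scale/= mulr1 (_ : id ^+ m.+1 = fun y : R => y ^+ m.+1)//.
  by apply/funext => y; rewrite exprfctE.
have f0 : ((m.+1)`!%:R : R) != 0 by rewrite pnatr_eq0 -lt0n fact_gt0.
have -> : c m.+1 * (x ^+ m / m`!%:R) = (c m.+1 / m.+1`!%:R) * (m.+1%:R * x ^+ m).
  move: f0; rewrite factS natrM mulf_eq0 negb_or => /andP[f1 f2].
  by field; rewrite f2 addrC natr1 f1.
rewrite (_ : (fun y : R => c m.+1 * (y ^+ m.+1 / (m.+1)`!%:R)) = (c m.+1 / m.+1`!%:R) *: (fun y : R => y ^+ m.+1)).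
  exact: is_deriveZ.
by apply/funext => y; rewrite /GRing.scale/= mulrA mulrAC.
Qed.

(** The derivative of exp (- i x) is - i exp (- i x), so differentiation exchanges the two
    remainders, up to sign, and lowers their order. *)
Lemma taylor_reS m (x : R) : is_derive x 1 (taylor_re m.+1) (taylor_im m x).
Proof.
have d := is_derive_taylor_sum expNi_re m x.
apply: is_derive_eq; rewrite /taylor_im; congr (_ - _).
by apply: eq_bigr => j _; rewrite expNi_reS.
Qed.

Lemma taylor_imS m (x : R) : is_derive x 1 (taylor_im m.+1) (- taylor_re m x).
Proof.
have d := is_derive_taylor_sum expNi_im m x.
apply: is_derive_eq; rewrite /taylor_re opprB addrC; congr (_ + _).
by rewrite -sumrN; apply: eq_bigr => j _; rewrite expNi_imS mulNr opprK.
Qed.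

Lemma taylor_re0 m : taylor_re m.+1 0 = 0.
Proof.
rewrite /taylor_re cos0 big_ord_recl big1 => [|i _].
  by rewrite /expNi_re !expr0 fact0 /= divr1 mulr1 addr0 subrr.
by rewrite expr0n mul0r mulr0.
Qed.

Lemma taylor_im0 m : taylor_im m.+1 0 = 0.
Proof.
rewrite /taylor_im sin0 big_ord_recl big1 => [|i _].
  by rewrite /expNi_im !expr0 fact0 /= mul0r addr0 subr0 oppr0.
by rewrite expr0n mul0r mulr0.
Qed.

(** The mean value theorem replaces an integration; the factor 1 / (m + 1) lost in this way only
    affects constants. *)
Lemma mvt_bound (f df : R -> R) (m : nat) (x : R) :
  (forall x : R, is_derive x 1 f (df x)) -> f 0 = 0 ->
  (forall x, `|df x| <= `|x| ^+ m) -> `|f x| <= `|x| ^+ m.+1.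
Proof.
move=> fdf f0 dfm.
have cf : continuous f by apply: continuous_derivable => y; exact: ex_derive.
have [x0|x0] := leP 0 x.
  have [|c] := @MVT_segment R f df 0 x x0 (fun y _ => fdf y).
    exact: continuous_subspaceT.
  rewrite in_itv/= => /andP[c0 cx]; rewrite f0 !subr0 => ->.
  rewrite normrM exprSr ler_wpM2r// (le_trans (dfm _))// lerXn2r ?nnegrE//.
  by rewrite !ger0_norm.
have [|c] := @MVT_segment R f df x 0 (ltW x0) (fun y _ => fdf y).
  exact: continuous_subspaceT.
rewrite in_itv/= => /andP[xc c0]; rewrite f0 !sub0r => /(congr1 Num.norm).
rewrite normrM !normrN => ->.
rewrite exprSr ler_wpM2r// (le_trans (dfm _))// lerXn2r ?nnegrE//.
by rewrite !ler0_norm ?lerN2// ltW.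
Qed.

Lemma taylor_bound m x : `|taylor_re m x| <= `|x| ^+ m /\ `|taylor_im m x| <= `|x| ^+ m.
Proof.
elim: m x => [|m ih] x.
  by rewrite /taylor_re /taylor_im !big_ord0 !subr0 normrN expr0 cos_max sin_max.
split; first apply: mvt_bound (@taylor_reS m) (taylor_re0 m) _ => y.
  exact: (ih y).2.
by apply: mvt_bound (@taylor_imS m) (taylor_im0 m) _ => y; rewrite normrN; exact: (ih y).1.
Qed.

Lemma expNi_le1 m : `|expNi_re m| <= 1 /\ `|expNi_im m| <= 1.
Proof.
elim: m => [|m [ihr ihi]].
  by rewrite /expNi_re /expNi_im expr0 /= normr1 normr0.
by rewrite expNi_reS expNi_imS normrN.
Qed.

Lemma fact_inv_le1 m : (m`!%:R : R)^-1 <= 1.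
Proof. by rewrite invf_le1 ?ltr0n ?fact_gt0// ler1n fact_gt0. Qed.

(** The remainder of order m + 1 is that of order m minus one term, and both are at most |x|^m. This
    version serves where |y| is large, since one more power there would cost one more moment of
    [f]. *)
Lemma taylor_bound_double m x :
  `|taylor_re m.+1 x| <= 2 * `|x| ^+ m /\ `|taylor_im m.+1 x| <= 2 * `|x| ^+ m.
Proof.
have [br bi] := taylor_bound m x; have [er ei] := expNi_le1 m.
have last_term (c : R) : `|c| <= 1 -> `|c * (x ^+ m / m`!%:R)| <= `|x| ^+ m.
  move=> c1; rewrite !normrM normrX -[leRHS]mul1r ler_pM// ler_piMr ?exprn_ge0//.
  by rewrite ger0_norm ?invr_ge0// fact_inv_le1.
split.
- rewrite /taylor_re big_ord_recr/= opprD addrA -/(taylor_re m x).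
  by rewrite (le_trans (ler_normB _ _))// mulr_natl mulr2n lerD// last_term.
- rewrite /taylor_im big_ord_recr/= opprD addrA -/(taylor_im m x).
  by rewrite (le_trans (ler_normB _ _))// mulr_natl mulr2n lerD// last_term.
Qed.

End taylor.

(** * Sums over multi-indices *)

Section multinomial.
Context {R : realType}.

(** The polynomials are truncations of exp (z X). Cutting beyond degree [k] leaves the coefficients
    of the product up to [k] intact, and these are the ones of exp ((sum z) X); the induction step
    is the binomial formula. *)
Lemma coef_prod_exp (k : nat) I (r : seq I) (z : I -> R) j : (j <= k)%N ->
  (\prod_(i <- r) \poly_(l < k.+1) (z i ^+ l / l`!%:R))`_j =
  (\sum_(i <- r) z i) ^+ j / j`!%:R.
Proof.
elim: r j => [|i r ih] j jk.
  by rewrite !big_nil coef1 expr0n; case: j {jk} => [|j] /=; rewrite ?fact0 ?divr1 ?mul0r.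
rewrite !big_cons coefMr exprDn mulr_suml; apply: eq_bigr => l _.
have lj : (l <= j)%N by rewrite -ltnS.
rewrite coef_poly ltnS (leq_trans (leq_subr _ _) jk) ih; last exact: leq_trans lj jk.
have f0 p : (p`!%:R : R) != 0 by rewrite pnatr_eq0 -lt0n fact_gt0.
have b0 : ('C(j, l)%:R : R) != 0 by rewrite pnatr_eq0 -lt0n bin_gt0.
rewrite -(bin_fact lj) !natrM -[X in _ = X / _]mulr_natr.
by field; rewrite b0 !f0.
Qed.

(** The factor [c] depends on a multi-index only through its length, so the sum is grouped by
    length; each group is a coefficient of the product of truncated exponentials. *)
Lemma multinomial_sum (k n : nat) (z : 'I_n -> R) (c : nat -> R) :
  \sum_(g : {ffun 'I_n -> 'I_k.+1} | (\sum_i g i <= k)%N)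
    c (\sum_i g i)%N * \prod_i (z i ^+ g i / (g i)`!%:R) =
  \sum_(j < k.+1) c j * ((\sum_i z i) ^+ j / j`!%:R).
Proof.
transitivity (\sum_(j < k.+1) c j *
    \sum_(g : {ffun 'I_n -> 'I_k.+1} | (\sum_i g i)%N == j)
      \prod_i (z i ^+ g i / (g i)`!%:R)).
  under [RHS]eq_bigr do rewrite mulr_sumr.
  rewrite (exchange_big_dep (fun g : {ffun 'I_n -> 'I_k.+1} => (\sum_i g i <= k)%N))/=; last first.
    by move=> j g _ /eqP ->; rewrite -ltnS.
  apply: eq_bigr => g gk.
  rewrite (big_pred1 (Ordinal (gk : (\sum_i g i < k.+1)%N)))//.
apply: eq_bigr => j _; congr (_ * _).
rewrite -(@coef_prod_exp k _ (index_enum 'I_n)); last by rewrite -ltnS.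
under [in RHS]eq_bigr do rewrite poly_def.
(* Distributing the product over the sums yields one monomial X^|g| for each function [g], and the
   coefficient of X^j keeps those of length [j]. *)
rewrite bigA_distr_bigA /= coef_sum big_mkcond /=; apply: eq_bigr => g _.
under [in RHS]eq_bigr do rewrite -mul_polyC.
rewrite [in RHS]big_split /= -(big_morph _ (@polyCM R) (@polyC1 R)) mul_polyC coefZ prodrXr coefXn eq_sym.
by case: eqP => _; rewrite ?mulr1 ?mulr0.
Qed.

End multinomial.

Section cauchy_schwarz.
Context {R : realType} {n : nat}.
Implicit Types x y : 'rV[R]_n.

Lemma eucl_norm_ge0 x : 0 <= eucl_norm x.
Proof. exact: sqrtr_ge0. Qed.

Lemma eucl_norm_sqr x : eucl_norm x ^+ 2 = \sum_i x ord0 i ^+ 2.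
Proof. by rewrite sqr_sqrtr// sumr_ge0// => i _; exact: sqr_ge0. Qed.

Lemma le_coord_eucl_norm x i : `|x ord0 i| <= eucl_norm x.
Proof.
rewrite -(@ler_pXn2r _ 2) ?nnegrE ?eucl_norm_ge0// eucl_norm_sqr.
rewrite real_normK ?num_real// (bigD1 i)//= lerDl sumr_ge0// => j _.
exact: sqr_ge0.
Qed.

(** Cauchy-Schwarz through Lagrange's identity: the defect of the squared inequality is half a sum
    of squares. *)
Lemma dotp_le x y : `|dotp x y| <= eucl_norm x * eucl_norm y.
Proof.
rewrite -(@ler_pXn2r _ 2) ?nnegrE ?mulr_ge0 ?eucl_norm_ge0//.
rewrite exprMn !eucl_norm_sqr real_normK ?num_real//.
have : 0 <= \sum_i \sum_j (x ord0 i * y ord0 j - x ord0 j * y ord0 i) ^+ 2.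
  by apply: sumr_ge0 => i _; apply: sumr_ge0 => j _; exact: sqr_ge0.
have -> : \sum_i \sum_j (x ord0 i * y ord0 j - x ord0 j * y ord0 i) ^+ 2 =
   2 * ((\sum_i x ord0 i ^+ 2) * (\sum_i y ord0 i ^+ 2)) - 2 * (dotp x y) ^+ 2.
  transitivity (\sum_i \sum_j (x ord0 i ^+ 2 * y ord0 j ^+ 2 + y ord0 i ^+ 2 * x ord0 j ^+ 2
    - 2 * ((x ord0 i * y ord0 i) * (x ord0 j * y ord0 j)))).
    by apply: eq_bigr => i _; apply: eq_bigr => j _; ring.
  under eq_bigr => i _.
    rewrite sumrB big_split /= -!mulr_sumr; over.
  rewrite sumrB big_split /= -!mulr_sumr -!mulr_suml -/(dotp x y); ring.
by rewrite subr_ge0 ler_pM2l.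
Qed.

End cauchy_schwarz.

(** * Derivatives of inverse Fourier transforms *)

Section derivative_under_integral.
Context {R : realType} {n : nat}.
Local Notation mu := (lebesgue_rV n : {sigma_finite_measure set 'rV[R]_n -> \bar R}).
Variables (phi dphi : R -> R) (a : 'rV[R]_n -> R) (i : 'I_n).
Hypotheses (mphi : measurable_fun setT phi) (mdphi : measurable_fun setT dphi).
Hypotheses (phi1 : forall t, `|phi t| <= 1) (dphi1 : forall t, `|dphi t| <= 1).
Hypothesis phi_taylor : forall t u, `|phi (t + u) - phi t - u * dphi t| <= 2 * u ^+ 2.
Hypothesis ia : mu.-integrable setT (EFin \o a).
Hypothesis ia1 : mu.-integrable setT (EFin \o (fun y : 'rV[R]_n => y ord0 i * a y)).
Hypothesis ia2 : mu.-integrable setT (EFin \o (fun y : 'rV[R]_n => y ord0 i ^+ 2 * a y)).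

(** The pair [phi], [dphi] is cos, -sin or sin, cos. The quadratic remainder bounds the error of the
    difference quotient by 2 |h| times a second moment, so the limit is reached at an explicit rate,
    without a convergence theorem. *)
Lemma is_derive_transform (x : 'rV[R]_n) :
  is_derive x (delta_mx ord0 i) (fun x : 'rV[R]_n => \int[mu]_y (phi (dotp x y) * a y))
    (\int[mu]_y (dphi (dotp x y) * (y ord0 i * a y))).
Proof.
have iphi z : mu.-integrable setT (EFin \o (fun y : 'rV[R]_n => phi (dotp z y) * a y)).
  have := integrable_bounded_mul ia (measurableT_comp mphi (measurable_dotp_r z)) (fun=> phi1 _).
  by under eq_fun do rewrite mulrC.
have idphi z : mu.-integrable setT (EFin \o (fun y : 'rV[R]_n => dphi (dotp z y) * (y ord0 i * a y))).
  have := integrable_bounded_mul ia1 (measurableT_comp mdphi (measurable_dotp_r z)) (fun=> dphi1 _).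
  by under eq_fun do rewrite mulrC.
have ia2' := integrable_norm ia2.
pose M := \int[mu]_y `|y ord0 i ^+ 2 * a y|.
have M0 : 0 <= M by exact: Rintegral_ge0.
pose T x := \int[mu]_y (phi (dotp x y) * a y).
pose L := \int[mu]_y (dphi (dotp x y) * (y ord0 i * a y)).
have dotpE (h : R) y : dotp (h *: delta_mx ord0 i + x) y = dotp x y + h * y ord0 i.
  rewrite addrC /dotp; under eq_bigr do rewrite !mxE mulrDl.
  rewrite big_split /=; congr (_ + _); rewrite (bigD1 i)//= !eqxx mulr1 big1 ?addr0//.
  by move=> j ji; rewrite (negbTE ji) mulr0 mul0r.
have bound (h : R) : h != 0 ->
    `|L - h^-1 * (T (h *: delta_mx ord0 i + x) - T x)| <= `|h| * (2 * M).
  move=> h0.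
  (* With every coefficient written out, even 1, two uses of [Rintegral_lin2] merge the three
     integrals into one. *)
  have -> : L - h^-1 * (T (h *: delta_mx ord0 i + x) - T x) =
     - h^-1 * (1 * (1 * T (h *: delta_mx ord0 i + x) + (-1) * T x) + (- h) * L).
    by field.
  have m0 : mu.-integrable setT (EFin \o (fun y : 'rV[R]_n =>
      1 * (phi (dotp (h *: delta_mx ord0 i + x) y) * a y) +
      -1 * (phi (dotp x y) * a y))).
    exact: (integrableD measurableT (integrable_scale 1 (iphi _)) (integrable_scale (-1) (iphi _))).
  rewrite /T /L -Rintegral_lin2// -Rintegral_lin2//.
  rewrite normrM normrN normfV.
  rewrite ler_pdivrMl ?normr_gt0//.
  apply: (@le_trans _ _ (\int[mu]_y (2 * `|h| ^+ 2 * `|y ord0 i ^+ 2 * a y|))); last first.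
    by rewrite RintegralZl// -/M; lra.
  have mm : mu.-integrable setT (EFin \o (fun x0 : 'rV[R]_n => 1 *
      (1 * (phi (dotp (h *: delta_mx ord0 i + x) x0) * a x0) +
       -1 * (phi (dotp x x0) * a x0)) +
      - h * (dphi (dotp x x0) * (x0 ord0 i * a x0)))).
    exact: (integrableD measurableT (integrable_scale 1 m0) (integrable_scale (- h) (idphi x))).
  apply: (le_trans (le_normr_Rintegral _ mm)) => //.
  apply: le_Rintegral => //.
  - exact: (integrable_norm mm).
  - exact: integrable_scale.
  - move=> y _; rewrite dotpE (_ : _ + _ = (phi (dotp x y + h * y ord0 i) - phi (dotp x y)
      - (h * y ord0 i) * dphi (dotp x y)) * a y); last by ring.
    rewrite normrM (le_trans (ler_wpM2r (normr_ge0 _) (phi_taylor _ _)))//.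
    rewrite normrM (ger0_norm (sqr_ge0 (y ord0 i))) exprMn real_normK ?num_real//.
    by rewrite !mulrA.
have cvgL : h^-1 *: ((T \o shift x) (h *: delta_mx ord0 i) - T x) @[h --> 0^'] --> L.
  apply/cvgrPdist_le => e e0; near=> h.
  have h0 : h != 0 by near: h; exact: nbhs_dnbhs_neq.
  apply: le_trans (bound h h0) _.
  have hd : `|h| <= e / (2 * M + 1).
    by near: h; apply: dnbhs0_le; rewrite divr_gt0// ltr_wpDl// mulr_ge0.
  rewrite (le_trans (ler_wpM2r _ hd)) ?mulr_ge0//.
  rewrite mulrAC ler_pdivrMr ?ltr_wpDl ?mulr_ge0//.
  by rewrite ler_wpM2l ?lerDl// ltW.
apply: DeriveDef; first by apply/cvg_ex; exists L.
exact: (cvg_lim _ cvgL).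
Unshelve. all: by end_near. Qed.

End derivative_under_integral.

Section derivatives_of_kernels.
Context {R : realType} {n : nat}.
Local Open Scope complex_scope.
Local Notation mu := (lebesgue_rV n : {sigma_finite_measure set 'rV[R]_n -> \bar R}).

Let trig_taylor (u : R) : `|cos u - 1| <= u ^+ 2 /\ `|sin u - u| <= u ^+ 2.
Proof.
have [] := taylor_bound 2 u.
rewrite /taylor_re /taylor_im !big_ord_recl !big_ord0 /= !expNi_reS !expNi_imS.
rewrite /expNi_re /expNi_im !expr0 fact0 /= !expr1 !divr1 !addr0 -(real_normK (num_real u)).
move=> h1 h2; split.
  by move: h1; rewrite (_ : cos u - _ = cos u - 1)//; ring.
by move: h2; rewrite (_ : - sin u - _ = u - sin u); [rewrite distrC|ring].
Qed.

Let combo (a b c d e : R) : `|a| <= 1 -> `|b| <= 1 -> `|c| <= e -> `|d| <= e ->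
  `|a * c + b * d| <= 2 * e.
Proof.
move=> a1 b1 ce de; rewrite (le_trans (ler_normD _ _))// mulr_natl mulr2n !normrM.
by rewrite lerD// -[leRHS]mul1r ler_pM.
Qed.

Let cos_taylor (t u : R) : `|cos (t + u) - cos t - u * - sin t| <= 2 * u ^+ 2.
Proof.
have [c s] := trig_taylor u.
rewrite cosD (_ : _ - _ = cos t * (cos u - 1) + (- sin t) * (sin u - u)); last by ring.
by apply: combo; rewrite ?normrN ?cos_max ?sin_max.
Qed.

Let sin_taylor (t u : R) : `|sin (t + u) - sin t - u * cos t| <= 2 * u ^+ 2.
Proof.
have [c s] := trig_taylor u.
rewrite sinD (_ : _ - _ = sin t * (cos u - 1) + cos t * (sin u - u)); last by ring.
by apply: combo; rewrite ?cos_max ?sin_max.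
Qed.

(** Finiteness of all moments is stable under multiplication by a coordinate, which is the effect of
    a partial derivative on the Fourier side; derivatives can therefore be iterated. *)
Definition rapid (h : 'rV[R]_n -> R[i]) := cmeasurable h /\
  forall m, mu.-integrable setT (EFin \o (fun x => eucl_norm x ^+ m * Normc.normc (h x))).

Let normN_sin_le1 (t : R) : `|- sin t| <= 1.
Proof. by rewrite normrN sin_max. Qed.

Let mNsin : measurable_fun setT (fun t : R => - sin t).
Proof. exact: measurableT_comp measurable_sin. Qed.

(** [p] stands for the real or the imaginary part. *)
Lemma rapid_coord (h : 'rV[R]_n -> R[i]) (i : 'I_n) m (p : R[i] -> R) : rapid h ->
  measurable_fun setT (fun x => p (h x)) -> (forall z, `|p z| <= Normc.normc z) ->
  mu.-integrable setT (EFin \o (fun x : 'rV[R]_n => x ord0 i ^+ m * p (h x))).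
Proof.
move=> [_ ih] mp p1; apply: (integrable_dom _ _ (ih m)).
  by apply: measurable_funM => //; apply: measurable_funX; exact: measurable_rV_coord.
move=> x; rewrite normrM normrX ler_pM ?exprn_ge0//.
by rewrite lerXn2r ?nnegrE ?eucl_norm_ge0// le_coord_eucl_norm.
Qed.

Lemma rapid_mul_coord (h : 'rV[R]_n -> R[i]) (i : 'I_n) : rapid h ->
  rapid (fun x => (0 +i* x ord0 i) * h x).
Proof.
move=> [mh ih]; have mi : cmeasurable (fun x : 'rV[R]_n => 0 +i* x ord0 i).
  by split => /=; [exact: measurable_cst|exact: measurable_rV_coord].
split=> [|m]; first exact: cmeasurableM.
apply: (integrable_dom _ _ (ih m.+1)).
  apply: measurable_funM; last exact/measurable_normc/cmeasurableM.
  by apply: measurable_funX; exact: measurable_eucl_norm.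
move=> x; rewrite Normc.normcM /= expr0n /= add0r sqrtr_sqr !normrM normr_id exprS.
rewrite (ger0_norm (normc_ge0 _)) normrX (ger0_norm (eucl_norm_ge0 _)) mulrA.
rewrite ler_wpM2r ?normc_ge0// mulrC ler_wpM2r ?exprn_ge0 ?eucl_norm_ge0//.
exact: le_coord_eucl_norm.
Qed.

Lemma rapid_cintegrable (h : 'rV[R]_n -> R[i]) : rapid h -> cintegrable h.
Proof.
move=> [mh ih]; apply: cintegrable_dom mh _ (ih 0%N) => x.
by rewrite expr0 mul1r.
Qed.

Lemma integrable_cos_mul (a : 'rV[R]_n -> R) (x : 'rV[R]_n) :
  mu.-integrable setT (EFin \o a) ->
  mu.-integrable setT (EFin \o (fun y => cos (dotp x y) * a y)).
Proof.
move=> ia; have := integrable_bounded_mul ia (measurable_cos_dotp x) (fun=> cos_max _).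
by under eq_fun do rewrite mulrC.
Qed.

Lemma integrable_sin_mul (a : 'rV[R]_n -> R) (x : 'rV[R]_n) :
  mu.-integrable setT (EFin \o a) ->
  mu.-integrable setT (EFin \o (fun y => sin (dotp x y) * a y)).
Proof.
move=> ia; have := integrable_bounded_mul ia (measurable_sin_dotp x) (fun=> sin_max _).
by under eq_fun do rewrite mulrC.
Qed.

Lemma Re_inv_fourier (h : 'rV[R]_n -> R[i]) x : cintegrable h ->
  complex.Re (inv_fourier h x) = (2 * pi) ^- n *
    (cos_transform (fun y => complex.Re (h y)) x - sin_transform (fun y => complex.Im (h y)) x).
Proof.
move=> [ir ii]; rewrite /inv_fourier Re_mulc /= mul0r subr0; congr (_ * _).
rewrite -RintegralB//; last 2 first.
- exact: integrable_cos_mul.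
- exact: integrable_sin_mul.
by apply: eq_Rintegral => y _; rewrite Re_mulc.
Qed.

Lemma Im_inv_fourier (h : 'rV[R]_n -> R[i]) x : cintegrable h ->
  complex.Im (inv_fourier h x) = (2 * pi) ^- n *
    (cos_transform (fun y => complex.Im (h y)) x + sin_transform (fun y => complex.Re (h y)) x).
Proof.
move=> [ir ii]; rewrite /inv_fourier Im_mulc /= mul0r addr0; congr (_ * _).
rewrite -RintegralD//; last 2 first.
- exact: integrable_cos_mul.
- exact: integrable_sin_mul.
by apply: eq_Rintegral => y _; rewrite Im_mulc.
Qed.

Lemma is_derive_cos_transform (h : 'rV[R]_n -> R[i]) (i : 'I_n) (p : R[i] -> R) x :
  rapid h -> measurable_fun setT (fun x => p (h x)) ->
  (forall z, `|p z| <= Normc.normc z) ->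
  is_derive x (delta_mx ord0 i) (cos_transform (fun y => p (h y)))
    (- sin_transform (fun y : 'rV[R]_n => y ord0 i * p (h y)) x).
Proof.
move=> rh mp p1; have i0 := rapid_coord i 0 rh mp p1.
have i1 := rapid_coord i 1 rh mp p1; have i2 := rapid_coord i 2 rh mp p1.
have i0' : mu.-integrable setT (EFin \o (fun x => p (h x))).
  by move: i0; under eq_fun do rewrite expr0 mul1r.
have := is_derive_transform measurable_cos mNsin cos_max normN_sin_le1 cos_taylor i0' i1 i2 x.
rewrite -/(cos_transform _) (_ : \int[mu]_y _ = - sin_transform (fun y : 'rV[R]_n => y ord0 i * p (h y)) x)//.
rewrite -mulN1r -RintegralZl//; last exact: integrable_sin_mul.
by apply: eq_Rintegral => y _; ring.
Qed.

Lemma is_derive_sin_transform (h : 'rV[R]_n -> R[i]) (i : 'I_n) (p : R[i] -> R) x :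
  rapid h -> measurable_fun setT (fun x => p (h x)) ->
  (forall z, `|p z| <= Normc.normc z) ->
  is_derive x (delta_mx ord0 i) (sin_transform (fun y => p (h y)))
    (cos_transform (fun y : 'rV[R]_n => y ord0 i * p (h y)) x).
Proof.
move=> rh mp p1; have i0 := rapid_coord i 0 rh mp p1.
have i1 := rapid_coord i 1 rh mp p1; have i2 := rapid_coord i 2 rh mp p1.
have i0' : mu.-integrable setT (EFin \o (fun x => p (h x))).
  by move: i0; under eq_fun do rewrite expr0 mul1r.
exact: (is_derive_transform measurable_sin measurable_cos sin_max cos_max sin_taylor i0' i1 i2 x).
Qed.

Lemma partial_deriv_inv_fourier (h : 'rV[R]_n -> R[i]) (i : 'I_n) : rapid h ->
  partial_deriv i (inv_fourier h) = inv_fourier (fun x => (0 +i* x ord0 i) * h x).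
Proof.
move=> rh; have [mr mi] := rh.1.
have ih := rapid_cintegrable rh; have ih' := rapid_cintegrable (rapid_mul_coord i rh).
have cr x := is_derive_cos_transform i x rh mr le_Re_normc.
have ci x := is_derive_cos_transform i x rh mi le_Im_normc.
have sr x := is_derive_sin_transform i x rh mr le_Re_normc.
have si x := is_derive_sin_transform i x rh mi le_Im_normc.
have ReE : (fun y : 'rV[R]_n => complex.Re ((0 +i* y ord0 i) * h y)) =
    (fun y : 'rV[R]_n => - (y ord0 i * complex.Im (h y))).
  by apply/funext => y; rewrite Re_mulc /= mul0r sub0r.
have ImE : (fun y : 'rV[R]_n => complex.Im ((0 +i* y ord0 i) * h y)) =
    (fun y : 'rV[R]_n => y ord0 i * complex.Re (h y)).
  by apply/funext => y; rewrite Im_mulc /= mul0r add0r.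
have iy : mu.-integrable setT (EFin \o (fun y : 'rV[R]_n => y ord0 i * complex.Im (h y))).
  exact: (rapid_coord i 1 rh mi le_Im_normc).
have cosN x : cos_transform (fun y : 'rV[R]_n => - (y ord0 i * complex.Im (h y))) x =
    - cos_transform (fun y : 'rV[R]_n => y ord0 i * complex.Im (h y)) x.
  rewrite -mulN1r -RintegralZl//; last exact: integrable_cos_mul.
  by apply: eq_Rintegral => y _; ring.
have sinN x : sin_transform (fun y : 'rV[R]_n => - (y ord0 i * complex.Im (h y))) x =
    - sin_transform (fun y : 'rV[R]_n => y ord0 i * complex.Im (h y)) x.
  rewrite -mulN1r -RintegralZl//; last exact: integrable_sin_mul.
  by apply: eq_Rintegral => y _; ring.
apply/funext => x; apply: complex_ext.
  rewrite Re_inv_fourier// [LHS]/=.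
  have -> : (fun z => complex.Re (inv_fourier h z)) =
      (2 * pi) ^- n *: (cos_transform (fun y => complex.Re (h y)) - sin_transform (fun y => complex.Im (h y))).
    by apply/funext => z; rewrite Re_inv_fourier.
  rewrite derive_val; congr (_ * _); rewrite addrC ReE ImE cosN//.
rewrite Im_inv_fourier// [LHS]/=.
have -> : (fun z => complex.Im (inv_fourier h z)) =
    (2 * pi) ^- n *: (cos_transform (fun y => complex.Im (h y)) + sin_transform (fun y => complex.Re (h y))).
  by apply/funext => z; rewrite Im_inv_fourier.
by rewrite derive_val; congr (_ * _); rewrite addrC ReE ImE sinN.
Qed.

(** Induction on the power of one coordinate, nested in an induction along [enum 'I_n]; rapidity is
    carried along because the next derivative requires it. *)
Lemma multi_deriv_inv_fourier (h : 'rV[R]_n -> R[i]) (g : 'I_n -> nat) : rapid h ->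
  multi_deriv g (inv_fourier h) =
  inv_fourier (fun x => \prod_i (0 +i* x ord0 i) ^+ g i * h x).
Proof.
move=> rh; rewrite /multi_deriv.
have iter_deriv (u : 'rV[R]_n -> R[i]) i m : rapid u ->
    rapid (fun x => (0 +i* x ord0 i) ^+ m * u x) /\
    iter m (partial_deriv i) (inv_fourier u) =
    inv_fourier (fun x => (0 +i* x ord0 i) ^+ m * u x).
  move=> ru; elim: m => [|m [ihr ihm]].
    by under eq_fun do rewrite expr0 mul1r.
  under eq_fun do rewrite exprS -mulrA.
  split; first exact: rapid_mul_coord.
  by rewrite iterS ihm partial_deriv_inv_fourier//; congr inv_fourier; apply/funext => x; rewrite exprS mulrA.
suff [_ ->] : rapid (fun x => \prod_(i <- enum 'I_n) (0 +i* x ord0 i) ^+ g i * h x) /\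
    foldr (fun i => iter (g i) (partial_deriv i)) (inv_fourier h) (enum 'I_n) =
    inv_fourier (fun x => \prod_(i <- enum 'I_n) (0 +i* x ord0 i) ^+ g i * h x).
  by congr inv_fourier; apply/funext => x; rewrite big_enum.
elim: (enum 'I_n) => [|i s [ihr ihs]] /=.
  by under eq_fun do rewrite big_nil mul1r.
have [r e] := iter_deriv _ i (g i) ihr.
by under eq_fun do rewrite big_cons -mulrA; rewrite ihs e; split.
Qed.

End derivatives_of_kernels.

(** * The error as an inverse Fourier transform *)

Section fourier_linearity.
Context {R : realType} {n : nat}.
Local Open Scope complex_scope.
Local Notation mu := (lebesgue_rV n : {sigma_finite_measure set 'rV[R]_n -> \bar R}).
Implicit Types (s f : 'rV[R]_n -> R) (u v : 'rV[R]_n -> R[i]).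

Lemma cintegrable_section (u : 'rV[R]_n -> 'rV[R]_n -> R[i]) (a b : 'rV[R]_n -> R) :
  cmeasurable (fun p : 'rV[R]_n * 'rV[R]_n => u p.1 p.2) ->
  (forall x y, Normc.normc (u x y) <= a x * b y) ->
  mu.-integrable setT (EFin \o a) -> mu.-integrable setT (EFin \o b) ->
  cintegrable (fun x => cintegral (fun y => u x y)).
Proof.
move=> [mr mi] uab ia ib; split => /=.
  apply: (integrable_Rintegral_section1 mr _ ia ib) => x y /=.
  exact: le_trans (le_Re_normc _) _.
apply: (integrable_Rintegral_section1 mi _ ia ib) => x y /=.
exact: le_trans (le_Im_normc _) _.
Qed.

Lemma cmeasurable_integrable u : cintegrable u -> cmeasurable u.
Proof.
by move=> [ur ui]; split; apply/measurable_EFinP; [exact: (measurable_int _ ur)|exact: (measurable_int _ ui)].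
Qed.

Lemma cintegrable_normc u : cintegrable u ->
  mu.-integrable setT (EFin \o (fun x => Normc.normc (u x))).
Proof.
move=> iu; have [ur ui] := iu.
apply: (integrable_dom (measurable_normc (cmeasurable_integrable iu)) _
  (integrableD measurableT (integrable_norm ur) (integrable_norm ui))) => x.
rewrite ger0_norm ?normc_ge0//=.
rewrite -(@ler_pXn2r _ 2) ?nnegrE ?normc_ge0 ?addr_ge0// normc_sqr sqrrD !real_normK ?num_real//.
by rewrite addrAC lerDl mulrn_wge0// mulr_ge0.
Qed.

Lemma cintegrable_expi u x : cintegrable u -> cintegrable (fun y => expi (dotp x y) * u y).
Proof.
move=> iu; apply: cintegrable_dom (cintegrable_normc iu).
  apply: cmeasurableM; last exact: cmeasurable_integrable.
  by apply: cmeasurable_expi; exact: measurable_dotp_r.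
by move=> y; rewrite Normc.normcM normc_expi mul1r.
Qed.

Lemma inv_fourierD u v x : cintegrable u -> cintegrable v ->
  inv_fourier (fun y => u y + v y) x = inv_fourier u x + inv_fourier v x.
Proof.
move=> iu iv; rewrite /inv_fourier -mulrDr -cintegralD; last 2 first.
- exact: cintegrable_expi.
- exact: cintegrable_expi.
by congr (_ * _); apply: eq_cintegral => y; rewrite mulrDr.
Qed.

Lemma inv_fourierZ c u x : cintegrable u ->
  inv_fourier (fun y => c * u y) x = c * inv_fourier u x.
Proof.
move=> iu; rewrite /inv_fourier mulrCA; congr (_ * _).
rewrite -cintegralZ; last exact: cintegrable_expi.
by apply: eq_cintegral => y; rewrite mulrCA.
Qed.

Lemma cintegrable_zero : cintegrable (fun _ : 'rV[R]_n => 0 : R[i]).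
Proof. by split => /=; exact: (@integrable0 _ _ _ _ setT). Qed.

Lemma inv_fourier_sum I (r : seq I) (P : pred I) (F : I -> 'rV[R]_n -> R[i]) x :
  (forall i, P i -> cintegrable (F i)) ->
  cintegrable (fun y => \sum_(i <- r | P i) F i y) /\
  inv_fourier (fun y => \sum_(i <- r | P i) F i y) x = \sum_(i <- r | P i) inv_fourier (F i) x.
Proof.
move=> iF; elim: r => [|i r [ihi ihe]].
  under eq_fun do rewrite big_nil; split; first exact: cintegrable_zero.
  rewrite big_nil; have := inv_fourierZ 0 x cintegrable_zero.
  by under eq_fun do rewrite mul0r; rewrite mul0r.
have [Pi|Pi] := boolP (P i).
  under eq_fun do rewrite big_cons Pi.
  split; first by apply: cintegrableD => //; exact: iF.
  by rewrite inv_fourierD ?ihe; [rewrite big_cons Pi|exact: iF|].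
under eq_fun do rewrite big_cons (negbTE Pi).
by split => //; rewrite big_cons (negbTE Pi).
Qed.

Lemma Rintegral_sum I (r : seq I) (P : pred I) (F : I -> 'rV[R]_n -> R) :
  (forall i, P i -> mu.-integrable setT (EFin \o F i)) ->
  mu.-integrable setT (EFin \o (fun y => \sum_(i <- r | P i) F i y)) /\
  \int[mu]_y \sum_(i <- r | P i) F i y = \sum_(i <- r | P i) \int[mu]_y F i y.
Proof.
move=> iF; elim: r => [|i r [ihi ihe]].
  rewrite big_nil; under eq_Rintegral do rewrite big_nil; split.
    by under eq_fun do rewrite big_nil; exact: (@integrable0 _ _ _ _ setT).
  by rewrite /Rintegral integral0.
have [Pi|Pi] := boolP (P i).
  split.
    under eq_fun do rewrite big_cons Pi.
    exact: (integrableD measurableT (iF _ Pi) ihi).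
  rewrite big_cons Pi -ihe -RintegralD//; last exact: iF.
  by apply: eq_Rintegral => y _; rewrite big_cons Pi.
split; first by under eq_fun do rewrite big_cons (negbTE Pi).
rewrite big_cons (negbTE Pi) -ihe.
by apply: eq_Rintegral => y _; rewrite big_cons (negbTE Pi).
Qed.

Lemma Re_fourier f xi : mu.-integrable setT (EFin \o f) ->
  complex.Re (fourier (fun x => (f x)%:C) xi) = cos_transform f xi.
Proof.
move=> _ /=; apply: eq_Rintegral => y _.
by rewrite mulr0 subr0 cosN dotpC.
Qed.

Lemma Im_fourier f xi : mu.-integrable setT (EFin \o f) ->
  complex.Im (fourier (fun x => (f x)%:C) xi) = - sin_transform f xi.
Proof.
move=> fi /=; rewrite -mulN1r -RintegralZl//; last exact: integrable_sin_mul.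
apply: eq_Rintegral => y _.
by rewrite mulr0 add0r sinN dotpC mulN1r mulNr.
Qed.

Lemma cintegrable_mul_fourier s f : mu.-integrable setT (EFin \o s) ->
  mu.-integrable setT (EFin \o f) ->
  cintegrable (fun xi => (s xi)%:C * fourier (fun x => (f x)%:C) xi).
Proof.
move=> si fi.
have ms : measurable_fun setT s by apply/measurable_EFinP; exact: (measurable_int _ si).
pose A := \int[mu]_y `|f y|.
apply: (@cintegrable_dom _ _ _ (fun xi => (2 * A) * `|s xi|)).
- apply: cmeasurableM; first exact: cmeasurable_real.
  split; under eq_fun do rewrite ?Re_fourier ?Im_fourier//.
    exact: measurable_cos_transform.
  by apply: measurableT_comp => //; exact: measurable_sin_transform.
- move=> x; rewrite Normc.normcM normc_real mulrC ler_wpM2r//.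
  rewrite -(@ler_pXn2r _ 2) ?nnegrE ?normc_ge0 ?mulr_ge0// ?Rintegral_ge0//.
  rewrite normc_sqr Re_fourier// Im_fourier// sqrrN.
  have := le_cos_transform fi x; have := le_sin_transform fi x; rewrite -/A.
  rewrite -(real_normK (num_real (cos_transform f x))) -(real_normK (num_real (sin_transform f x))).
  have := normr_ge0 (cos_transform f x); have := normr_ge0 (sin_transform f x); nra.
- exact: (integrable_scale _ (integrable_norm si)).
Qed.

(** Fubini exchanges the two integrals, and exp (i (x - y) . xi) splits off the Fourier transform of
    [f]. The plain kernels thus become multipliers, which the tilde ones are by definition. *)
Lemma convolutionE s f x : mu.-integrable setT (EFin \o s) ->
  mu.-integrable setT (EFin \o f) ->
  convolution (inv_fourier (fun xi => (s xi)%:C)) f x = fourier_multiplier s f x.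
Proof.
move=> si fi.
have ms : measurable_fun setT s by apply/measurable_EFinP; exact: (measurable_int _ si).
have mf : measurable_fun setT f by apply/measurable_EFinP; exact: (measurable_int _ fi).
have csi : cintegrable (fun xi => (s xi)%:C) by split => //=; exact: (@integrable0 _ _ _ _ setT).
have cfi : cintegrable (fun xi => (f xi)%:C) by split => //=; exact: (@integrable0 _ _ _ _ setT).
pose U y xi := expi (dotp (x - y) xi) * (s xi)%:C * (f y)%:C.
have mU : cmeasurable (fun p : 'rV[R]_n * 'rV[R]_n => U p.1 p.2).
  apply: cmeasurableM; first apply: cmeasurableM.
  - by apply: cmeasurable_expi; apply: measurable_dotp => //; exact: measurable_rV_sub.
  - by apply: cmeasurable_real; exact: measurableT_comp.
  - by apply: cmeasurable_real; exact: measurableT_comp.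
have bU y xi : Normc.normc (U y xi) <= `|f y| * `|s xi|.
  by rewrite !Normc.normcM normc_expi !normc_real mul1r mulrC.
have ifn := integrable_norm fi; have isn := integrable_norm si.
rewrite /convolution.
transitivity (cintegral (fun y => ((2 * pi) ^- n)%:C * cintegral (fun xi => U y xi))).
  apply: eq_cintegral => y; rewrite /inv_fourier -mulrA; congr (_ * _).
  rewrite mulrC -cintegralZ; last exact: cintegrable_expi.
  by apply: eq_cintegral => xi; rewrite /U mulrC.
rewrite cintegralZ; last exact: cintegrable_section mU bU ifn isn.
rewrite /fourier_multiplier /inv_fourier; congr (_ * _).
rewrite (cintegral_fubini mU bU ifn isn); apply: eq_cintegral => xi.
rewrite /fourier mulrA -cintegralZ; last first.
  apply: cintegrable_dom (cintegrable_normc cfi).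
    apply: cmeasurableM; last exact: cmeasurable_integrable.
    apply: cmeasurable_expi; apply: measurableT_comp => //; exact: measurable_dotp.
  by move=> y; rewrite Normc.normcM normc_expi mul1r.
by apply: eq_cintegral => y; rewrite /U dotpBl expiD; ring.
Qed.

End fourier_linearity.

(** * The Taylor polynomial of the transform, in terms of moments *)

Section moment_expansion.
Context {R : realType} {n : nat}.
Local Open Scope complex_scope.
Local Notation mu := (lebesgue_rV n : {sigma_finite_measure set 'rV[R]_n -> \bar R}).
Implicit Types (s f : 'rV[R]_n -> R) (u v : 'rV[R]_n -> R[i]).

(** The polynomial P of the overview in multi-index form: each derivative of order [g] acts as
    multiplication by (i xi)^g. *)
Definition moment_symbol k f (xi : 'rV[R]_n) : R[i] :=
  \sum_(g : {ffun 'I_n -> 'I_k.+1} | (\sum_i g i <= k)%N)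
     (moment f (fun i => g i : nat))%:C * \prod_i (0 +i* xi ord0 i) ^+ g i.

Lemma rapid_prod_coord u (g : 'I_n -> nat) : rapid u ->
  rapid (fun x => \prod_i (0 +i* x ord0 i) ^+ g i * u x).
Proof.
move=> ru; elim: (index_enum _) => [|i s ih].
  by under eq_fun do rewrite big_nil mul1r.
under eq_fun do rewrite big_cons -mulrA.
elim: (g i) => [|m ihm]; first by under eq_fun do rewrite expr0 mul1r.
under eq_fun do rewrite exprS -mulrA.
exact: rapid_mul_coord.
Qed.

Lemma moment_expansion_inv_fourier k f u x : rapid u ->
  cintegrable (fun xi => moment_symbol k f xi * u xi) /\
  moment_expansion k f (inv_fourier u) x =
  inv_fourier (fun xi => moment_symbol k f xi * u xi) x.
Proof.
move=> ru.
pose F (g : {ffun 'I_n -> 'I_k.+1}) (xi : 'rV[R]_n) := (moment f (fun i => g i : nat))%:C *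
   (\prod_i (0 +i* xi ord0 i) ^+ g i * u xi).
have ic (g : {ffun 'I_n -> 'I_k.+1}) :
    cintegrable (fun xi : 'rV[R]_n => \prod_i (0 +i* xi ord0 i) ^+ g i * u xi).
  exact: rapid_cintegrable (rapid_prod_coord (fun i => g i : nat) ru).
have iF (g : {ffun 'I_n -> 'I_k.+1}) : (\sum_i g i <= k)%N -> cintegrable (F g).
  by move=> _; apply: cintegrableZ.
have FE : (fun xi => moment_symbol k f xi * u xi) =
    (fun xi => \sum_(g : {ffun 'I_n -> 'I_k.+1} | (\sum_i g i <= k)%N) F g xi).
  apply/funext => xi; rewrite /moment_symbol mulr_suml.
  by apply: eq_bigr => g _; rewrite /F mulrA.
have [isum esum] := inv_fourier_sum (index_enum _) x iF.
rewrite FE; split => //; rewrite esum /moment_expansion.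
apply: eq_bigr => g _; rewrite inv_fourierZ// multi_deriv_inv_fourier//.
Qed.

(** Coordinatewise (- y) (i xi) = (- i) (xi y). The powers of -i collect into a factor depending on
    the length of [g] alone, as [multinomial_sum] requires. *)
Lemma prod_coord_pow (g : 'I_n -> nat) (xi y : 'rV[R]_n) :
  (\prod_i (- y ord0 i) ^+ g i)%:C * \prod_i (0 +i* xi ord0 i) ^+ g i =
  (0 -i* 1) ^+ (\sum_i g i) * (\prod_i (xi ord0 i * y ord0 i) ^+ g i)%:C.
Proof.
rewrite !rmorph_prod -big_split -prodrXr -big_split /=; apply: eq_bigr => i _.
rewrite !rmorphXn /= -!exprMn; congr (_ ^+ _).
by apply: complex_ext; rewrite ?Re_mulc ?Im_mulc /=; ring.
Qed.

Section in_L1w.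
Variables (k : nat) (f : 'rV[R]_n -> R).
Hypothesis fk : in_L1w k f.

Let mf : measurable_fun setT f.
Proof. by apply/measurable_EFinP; exact: (measurable_int _ fk.1). Qed.

Let ifk : mu.-integrable setT (EFin \o (fun y => (1 + eucl_norm y) ^+ k * `|f y|)).
Proof.
have := integrable_norm fk.2; rewrite (_ : Num.norm \o _ = (fun y => (1 + eucl_norm y) ^+ k * `|f y|))//.
by apply/funext => y /=; rewrite normrM ger0_norm// exprn_ge0// addr_ge0// eucl_norm_ge0.
Qed.

(** Since 1 + |y| is at least 1, raising its exponent from the length of [g] to [k] only increases
    the bound. *)
Lemma integrable_moment (g : 'I_n -> nat) : (\sum_i g i <= k)%N ->
  mu.-integrable setT (EFin \o (fun y : 'rV[R]_n => \prod_i (- y ord0 i) ^+ g i * f y)).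
Proof.
move=> gk; apply: (integrable_dom _ _ ifk).
  apply: measurable_funM => //.
  apply: (@measurable_prod_coord _ _ (fun i t => (- t) ^+ g i)) => i.
  exact: measurable_funX.
move=> y; rewrite normrM ler_wpM2r// normr_prod.
apply: (@le_trans _ _ (\prod_i (1 + eucl_norm y) ^+ g i)).
  apply: ler_prod => i _; rewrite normr_ge0 normrX normrN lerXn2r ?nnegrE ?addr_ge0 ?eucl_norm_ge0//.
  by rewrite (le_trans (le_coord_eucl_norm _ _))// lerDr.
by rewrite prodrXr ler_weXn2l// lerDl eucl_norm_ge0.
Qed.

(** Under the integral sign the multinomial formula resums the monomials into a polynomial in xi .
    y; subtracting it from the exponential leaves the one-variable Taylor remainder. *)
Lemma fourier_sub_moment_symbol xi :
  let D := fourier (fun x => (f x)%:C) xi - moment_symbol k f xi in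
  [/\ complex.Re D = \int[mu]_y (taylor_re k.+1 (dotp xi y) * f y),
      complex.Im D = \int[mu]_y (taylor_im k.+1 (dotp xi y) * f y),
      mu.-integrable setT (EFin \o (fun y => taylor_re k.+1 (dotp xi y) * f y)) &
      mu.-integrable setT (EFin \o (fun y => taylor_im k.+1 (dotp xi y) * f y))].
Proof.
move=> D.
pose G (c : nat -> R) (g : {ffun 'I_n -> 'I_k.+1}) (y : 'rV[R]_n) :=
  c (\sum_i g i)%N * \prod_i ((xi ord0 i * y ord0 i) ^+ g i / (g i)`!%:R) * f y.
pose d (g : {ffun 'I_n -> 'I_k.+1}) : R := (\prod_i (g i)`!%:R)^-1.
(* Covers both parts at once: [p] is the real or the imaginary part, and [c] the corresponding part
   of (-i)^m. *)
have mul_re (p : R[i] -> R) (c : nat -> R) :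
    (forall m (a : R), p ((0 -i* 1) ^+ m * a%:C) = c m * a) ->
    (forall (a : R) z, p (a%:C * z) = a * p z) ->
    forall g : {ffun 'I_n -> 'I_k.+1}, (\sum_i g i <= k)%N ->
    mu.-integrable setT (EFin \o G c g) /\
    \int[mu]_y G c g y = p ((moment f (fun i => g i : nat))%:C * \prod_i (0 +i* xi ord0 i) ^+ g i).
  move=> pc pr g gk; pose z := \prod_i (0 +i* xi ord0 i) ^+ g i.
  have GE : G c g = (fun y : 'rV[R]_n => (d g * p z) * (\prod_i (- y ord0 i) ^+ g i * f y)).
    apply/funext => y; rewrite /G mulrA; congr (_ * _).
    rewrite -mulrA [p z * _]mulrC -pr prod_coord_pow pc mulrCA; congr (_ * _).
    by rewrite big_split /= mulrC prodfV.
  have im := integrable_moment gk.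
  rewrite GE; split; first exact: integrable_scale.
  by rewrite RintegralZl// pr /moment -/(d g) -/z; ring.
have re_c m (a : R) : complex.Re ((0 -i* 1) ^+ m * a%:C) = expNi_re m * a.
  by rewrite Re_mulc /= mulr0 subr0.
have im_c m (a : R) : complex.Im ((0 -i* 1) ^+ m * a%:C) = expNi_im m * a.
  by rewrite Im_mulc /= mulr0 add0r.
have re_r (a : R) z : complex.Re (a%:C * z) = a * complex.Re z.
  by rewrite Re_mulc /= mul0r subr0.
have im_r (a : R) z : complex.Im (a%:C * z) = a * complex.Im z.
  by rewrite Im_mulc /= mul0r addr0.
have Hre := mul_re _ _ re_c re_r; have Him := mul_re _ _ im_c im_r.
have [ire ere] := Rintegral_sum (index_enum _) (fun g gk => (Hre g gk).1).
have [iim eim] := Rintegral_sum (index_enum _) (fun g gk => (Him g gk).1).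
have sumG (c : nat -> R) : (fun y => \sum_(g : {ffun 'I_n -> 'I_k.+1} | (\sum_i g i <= k)%N) G c g y) =
   (fun y => (\sum_(j < k.+1) c j * (dotp xi y ^+ j / j`!%:R)) * f y).
  by apply/funext => y; rewrite -mulr_suml multinomial_sum.
rewrite sumG in ire ere; rewrite sumG in iim eim.
have ic := integrable_cos_mul xi fk.1; have is' := integrable_sin_mul xi fk.1.
have TR : (fun y => taylor_re k.+1 (dotp xi y) * f y) = (fun y => cos (dotp xi y) * f y -
    (\sum_(j < k.+1) expNi_re j * (dotp xi y ^+ j / j`!%:R)) * f y).
  by apply/funext => y; rewrite -mulrBl.
have TI : (fun y => taylor_im k.+1 (dotp xi y) * f y) = (fun y => -1 * (sin (dotp xi y) * f y) -
    (\sum_(j < k.+1) expNi_im j * (dotp xi y ^+ j / j`!%:R)) * f y).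
  by apply/funext => y; rewrite /taylor_im; ring.
have is1 := integrable_scale (-1) is'.
split.
- rewrite /D Re_addc Re_oppc Re_fourier; last exact: fk.1.
  rewrite TR RintegralB// ere Re_sum; congr (_ - _).
  by apply: eq_bigr => g gk; rewrite (Hre g gk).2.
- rewrite /D Im_addc Im_oppc Im_fourier; last exact: fk.1.
  rewrite TI RintegralB// RintegralZl// mulN1r eim Im_sum; congr (_ - _).
  by apply: eq_bigr => g gk; rewrite (Him g gk).2.
- by rewrite TR; exact: (integrableB measurableT ic ire).
- by rewrite TI; exact: (integrableB measurableT is1 iim).
Qed.

(** The tail integrand extended by 0, so that it can be added to integrands living on the whole
    space. *)
Definition tail_fun r (y : 'rV[R]_n) : R := if r <= eucl_norm y then eucl_norm y ^+ k * `|f y| else 0.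

Lemma tail_fun_le r y : 0 <= tail_fun r y <= (1 + eucl_norm y) ^+ k * `|f y|.
Proof.
have N0 := eucl_norm_ge0 y.
rewrite /tail_fun; case: ifP => _; last by rewrite lexx mulr_ge0 ?exprn_ge0 ?addr_ge0.
by rewrite mulr_ge0 ?exprn_ge0//= ler_wpM2r// lerXn2r ?nnegrE ?addr_ge0// lerDr.
Qed.

Lemma measurable_tail_fun r : measurable_fun setT (tail_fun r).
Proof.
have mN : measurable_fun setT (@eucl_norm R n) by exact: measurable_eucl_norm.
apply: measurable_fun_ifT.
- exact: measurable_fun_ler.
- by apply: measurable_funM; [exact: measurable_funX|exact: measurableT_comp].
- exact: measurable_cst.
Qed.

Lemma integrable_tail_fun r : mu.-integrable setT (EFin \o tail_fun r).
Proof.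
apply: (integrable_dom (measurable_tail_fun r) _ ifk) => y.
by have /andP[t0 t1] := tail_fun_le r y; rewrite ger0_norm.
Qed.

Lemma tail_momentE r : tail_moment k r f = (\int[mu]_y tail_fun r y)%:E.
Proof.
rewrite /Rintegral fineK; last exact: (integrable_fin_num measurableT (integrable_tail_fun r)).
rewrite /tail_moment [LHS]integral_mkcond; apply: eq_integral => y _.
rewrite patchE /tail_fun; case: ifPn => [|].
  by rewrite inE /= => ->.
by rewrite notin_setE /= => /negP/negbTE ->.
Qed.

Definition L1w_val := \int[mu]_y ((1 + eucl_norm y) ^+ k * `|f y|).

Lemma L1w_normE : L1w_norm k f = L1w_val%:E.
Proof.
rewrite /L1w_norm Lnorm1 /L1w_val /Rintegral fineK; last exact: (integrable_fin_num measurableT ifk).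
apply: eq_integral => y _ /=.
by rewrite normrM ger0_norm// exprn_ge0// addr_ge0// eucl_norm_ge0.
Qed.

Lemma taylor_integral_le (T : R -> R) (xi : 'rV[R]_n) (r : R) : 0 < r ->
  (forall t, `|T t| <= `|t| ^+ k.+1) -> (forall t, `|T t| <= 2 * `|t| ^+ k) ->
  mu.-integrable setT (EFin \o (fun y => T (dotp xi y) * f y)) ->
  `|\int[mu]_y (T (dotp xi y) * f y)| <=
    r * L1w_val * eucl_norm xi ^+ k.+1 + 2 * (\int[mu]_y tail_fun r y) * eucl_norm xi ^+ k.
Proof.
move=> r0 T1 T2 iT; have N0 (x : 'rV[R]_n) := eucl_norm_ge0 x.
rewrite (le_trans (le_normr_Rintegral _ iT))//.
have iR := integrableD measurableT (integrable_scale (r * eucl_norm xi ^+ k.+1) ifk)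
   (integrable_scale (2 * eucl_norm xi ^+ k) (integrable_tail_fun r)).
apply: (@le_trans _ _ (\int[mu]_y (r * eucl_norm xi ^+ k.+1 * ((1 + eucl_norm y) ^+ k * `|f y|) +
    2 * eucl_norm xi ^+ k * tail_fun r y))); last first.
  by rewrite (Rintegral_lin2 _ _ ifk (integrable_tail_fun r)) -/L1w_val; lra.
apply: le_Rintegral => //; first exact: (integrable_norm iT).
move=> y _; rewrite normrM /tail_fun; case: ifPn => [ry|].
  apply: (@le_trans _ _ (2 * (eucl_norm xi * eucl_norm y) ^+ k * `|f y|)).
    rewrite ler_wpM2r// (le_trans (T2 _))// ler_wpM2l// lerXn2r ?nnegrE ?mulr_ge0//.
    exact: dotp_le.
  rewrite exprMn ler_wpDl//; first by rewrite !mulr_ge0 ?exprn_ge0 ?addr_ge0// ltW.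
  by rewrite !mulrA.
(* For |y| < r one of the k + 1 factors |y| is traded for [r], so that only k moments of [f] are
   spent. *)
rewrite -ltNge => yr; rewrite mulr0 addr0.
apply: (@le_trans _ _ ((eucl_norm xi * eucl_norm y) ^+ k.+1 * `|f y|)).
  rewrite ler_wpM2r// (le_trans (T1 _))// lerXn2r ?nnegrE ?mulr_ge0//.
  exact: dotp_le.
rewrite exprMn [leLHS](_ : _ = eucl_norm xi ^+ k.+1 * (eucl_norm y ^+ k.+1 * `|f y|)); last by ring.
rewrite (_ : r * _ * _ = eucl_norm xi ^+ k.+1 * (r * (1 + eucl_norm y) ^+ k * `|f y|)); last by ring.
rewrite ler_wpM2l ?exprn_ge0// ler_wpM2r// exprS ler_pM ?exprn_ge0 ?(ltW yr)//.
by rewrite lerXn2r ?nnegrE ?addr_ge0// lerDr.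
Qed.

End in_L1w.
End moment_expansion.

(** * L^2 bounds through Plancherel's inequality *)

Section L2_bound.
Context {R : realType} {n : nat}.
Local Open Scope complex_scope.
Local Notation mu := (lebesgue_rV n : {sigma_finite_measure set 'rV[R]_n -> \bar R}).
Implicit Types (s f : 'rV[R]_n -> R) (u v : 'rV[R]_n -> R[i]).

Lemma L2_norm_le u (M : R) : 0 <= M ->
  (\int[mu]_x (Normc.normc (u x) ^+ 2)%:E <= M%:E)%E ->
  (L2_norm u <= (Num.sqrt M)%:E)%E.
Proof.
move=> M0 uM; rewrite /L2_norm unlock /=.
rewrite (_ : \int[_]_x _ = \int[mu]_x (Normc.normc (u x) ^+ 2)%:E)%E; last first.
  apply: eq_integral => x _.
  rewrite (ger0_norm (normc_ge0 _)) /= powR_mulrn ?normc_ge0//.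
rewrite -powR12_sqrt// -poweR_EFin.
apply: gt0_ler_poweR => //.
- by rewrite in_itv/= leey andbT integral_ge0// => x _; rewrite lee_fin sqr_ge0.
- by rewrite in_itv/= leey andbT lee_fin.
Qed.

(** The 8 is a product of three factors 2: one for the square of a sum, one from [plancherel_le],
    one for the two parts of [u]. The normalization leaves a factor (2 pi)^(-n), bounded by 1. *)
Lemma L2_norm_inv_fourier_le u (M : R) : 0 <= M -> cintegrable u ->
  (\int[mu]_x (complex.Re (u x) ^+ 2)%:E <= M%:E)%E ->
  (\int[mu]_x (complex.Im (u x) ^+ 2)%:E <= M%:E)%E ->
  (L2_norm (inv_fourier u) <= (Num.sqrt (8 * M))%:E)%E.
Proof.
move=> M0 iu Ma Mb; have [ia ib] := iu.
apply: L2_norm_le; first by rewrite mulr_ge0.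
set a := fun x => complex.Re (u x); set b := fun x => complex.Im (u x).
pose c : R := (2 * pi) ^- n.
have p1 : 1 <= 2 * pi :> R by have := pi_ge2 R; lra.
have c0 : 0 < c by rewrite invr_gt0 exprn_gt0// (lt_le_trans ltr01).
have cp : c * (2 * pi) ^+ n = 1 by rewrite mulVf// expf_neq0// gt_eqF// (lt_le_trans ltr01).
have c1 : c <= 1 by rewrite invf_le1 ?exprn_ege1// exprn_gt0// (lt_le_trans ltr01).
pose Fa x := cos_transform a x ^+ 2 + sin_transform a x ^+ 2.
pose Fb x := cos_transform b x ^+ 2 + sin_transform b x ^+ 2.
have Fa0 x : 0 <= Fa x by rewrite addr_ge0 ?sqr_ge0.
have Fb0 x : 0 <= Fb x by rewrite addr_ge0 ?sqr_ge0.
have mFa : measurable_fun setT (EFin \o Fa).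
  apply/measurable_EFinP; apply: measurable_funD; apply: measurable_funX.
    exact: measurable_cos_transform.
  exact: measurable_sin_transform.
have mFb : measurable_fun setT (EFin \o Fb).
  apply/measurable_EFinP; apply: measurable_funD; apply: measurable_funX.
    exact: measurable_cos_transform.
  exact: measurable_sin_transform.
have c2 : (0 <= (2 * c ^+ 2)%:E)%E by rewrite lee_fin mulr_ge0// sqr_ge0.
apply: (@le_trans _ _ (\int[mu]_x ((2 * c ^+ 2)%:E * ((Fa x)%:E + (Fb x)%:E)))%E).
  apply: ge0_le_integral => //.
  - by move=> x _; rewrite lee_fin sqr_ge0.
  - apply/measurable_EFinP; apply: measurable_funX.
    have mA := measurable_cos_transform ia; have mB := measurable_sin_transform ia.
    have mC := measurable_cos_transform ib; have mD := measurable_sin_transform ib.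
    apply: measurable_normc; split.
      under eq_fun do rewrite Re_inv_fourier//.
      by apply: measurable_funM => //; exact: measurable_funB.
    under eq_fun do rewrite Im_inv_fourier//.
    by apply: measurable_funM => //; exact: measurable_funD.
  - by apply: measurable_funeM; exact: emeasurable_funD.
  - move=> x _; rewrite -EFinD -EFinM lee_fin normc_sqr Re_inv_fourier// Im_inv_fourier//.
    rewrite -/c -/a -/b !exprMn -mulrDr.
    rewrite [leRHS](_ : _ = c ^+ 2 * (2 * (Fa x + Fb x))); last by ring.
    rewrite ler_wpM2l ?sqr_ge0//.
    rewrite /Fa /Fb; set A := cos_transform a x; set B := sin_transform a x.
    set C := cos_transform b x; set D := sin_transform b x.
    by have := sqr_ge0 (A + D); have := sqr_ge0 (C - B); nra.
rewrite ge0_integralZl//; last 2 first.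
- exact: emeasurable_funD.
- by move=> x _; rewrite -EFinD lee_fin addr_ge0.
rewrite ge0_integralD//; last 2 first.
- by move=> x _; rewrite lee_fin.
- by move=> x _; rewrite lee_fin.
have K0 : (0 <= (2 * (2 * pi) ^+ n : R)%:E)%E by rewrite lee_fin mulr_ge0// exprn_ge0// (le_trans ler01).
have Ba : (\int[mu]_x (Fa x)%:E <= (2 * (2 * pi) ^+ n * M)%:E)%E.
  by rewrite (le_trans (plancherel_le ia))// [leRHS]EFinM lee_wpmul2l.
have Bb : (\int[mu]_x (Fb x)%:E <= (2 * (2 * pi) ^+ n * M)%:E)%E.
  by rewrite (le_trans (plancherel_le ib))// [leRHS]EFinM lee_wpmul2l.
apply: le_trans (lee_wpmul2l c2 (leeD Ba Bb)) _.
rewrite -EFinD -EFinM lee_fin.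
rewrite [leLHS](_ : _ = 8 * (c * (c * (2 * pi) ^+ n)) * M); last by ring.
by rewrite cp mulr1 ler_wpM2r// -[leRHS]mulr1 ler_wpM2l.
Qed.

End L2_bound.

Section L2_error.
Context {R : realType} {n : nat}.
Local Open Scope complex_scope.
Local Notation mu := (lebesgue_rV n : {sigma_finite_measure set 'rV[R]_n -> \bar R}).

Lemma L2_error_le (s f : 'rV[R]_n -> R) (k : nat) (r M1 M2 : R) :
  measurable_fun setT s -> rapid (fun xi => (s xi)%:C) -> in_L1w k f -> 0 < r ->
  0 <= M1 -> 0 <= M2 ->
  (\int[mu]_xi ((s xi * eucl_norm xi ^+ k.+1) ^+ 2)%:E <= M1%:E)%E ->
  (\int[mu]_xi ((s xi * eucl_norm xi ^+ k) ^+ 2)%:E <= M2%:E)%E ->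
  (L2_norm (fun x => fourier_multiplier s f x -
     moment_expansion k f (inv_fourier (fun xi => (s xi)%:C)) x)%R <=
   (8 * (r * Num.sqrt M1))%:E * L1w_norm k f +
   (8 * Num.sqrt M2)%:E * tail_moment k r f)%E.
Proof.
move=> ms rs fk r0 M10 M20 sM1 sM2.
rewrite (L1w_normE fk) (tail_momentE fk).
set L := L1w_val k f; set T := \int[mu]_y tail_fun k f r y.
have L0 : 0 <= L.
  by apply: Rintegral_ge0 => y _; rewrite mulr_ge0// exprn_ge0// addr_ge0// eucl_norm_ge0.
have T0 : 0 <= T by apply: Rintegral_ge0 => y _; have /andP[] := tail_fun_le k f r y.
have is' : mu.-integrable setT (EFin \o s) := (rapid_cintegrable rs).1.
pose D xi := fourier (fun x => (f x)%:C) xi - moment_symbol k f xi.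
pose G xi := (s xi)%:C * D xi.
have GE : G = (fun xi => (s xi)%:C * fourier (fun x => (f x)%:C) xi +
    (-1) * (moment_symbol k f xi * (s xi)%:C)).
  by apply/funext => xi; rewrite /G /D; ring.
have iF := cintegrable_mul_fourier is' fk.1.
have iP := (moment_expansion_inv_fourier k f 0 rs).1.
have iG : cintegrable G.
  by rewrite GE; apply: cintegrableD => //; exact: cintegrableZ.
have -> : (fun x => fourier_multiplier s f x -
     moment_expansion k f (inv_fourier (fun xi => (s xi)%:C)) x) = inv_fourier G.
  apply/funext => x; rewrite (moment_expansion_inv_fourier k f x rs).2.
  rewrite /fourier_multiplier GE inv_fourierD//; last exact: cintegrableZ.
  by rewrite inv_fourierZ// mulN1r.
(* From (Y + Z)^2 <= 2 Y^2 + 2 Z^2, where Z already carries a factor 2: hence the 2 and the 8. *)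
pose M := 2 * (r * L) ^+ 2 * M1 + 8 * T ^+ 2 * M2.
have M0 : 0 <= M by rewrite addr_ge0// mulr_ge0// mulr_ge0// sqr_ge0.
have mN : measurable_fun setT (@eucl_norm R n) by exact: measurable_eucl_norm.
have m1 j : measurable_fun setT (fun xi => ((s xi * eucl_norm xi ^+ j) ^+ 2)%:E).
  apply/measurable_EFinP; apply: measurable_funX; apply: measurable_funM => //.
  exact: measurable_funX.
have bound (p : R[i] -> R) : (forall (a : R) z, p (a%:C * z) = a * p z) ->
    measurable_fun setT (fun xi => p (G xi)) ->
    (forall xi, `|p (D xi)| <= r * L * eucl_norm xi ^+ k.+1 + 2 * T * eucl_norm xi ^+ k) ->
    (\int[mu]_xi (p (G xi) ^+ 2)%:E <= M%:E)%E.
  move=> pM mp pD.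
  apply: (@le_trans _ _ (\int[mu]_xi ((2 * (r * L) ^+ 2)%:E * ((s xi * eucl_norm xi ^+ k.+1) ^+ 2)%:E +
      (8 * T ^+ 2)%:E * ((s xi * eucl_norm xi ^+ k) ^+ 2)%:E))%E).
    apply: ge0_le_integral => //.
    - by move=> x _; rewrite lee_fin sqr_ge0.
    - by apply/measurable_EFinP; exact: measurable_funX.
    - by apply: emeasurable_funD; apply: measurable_funeM.
    - move=> xi _; rewrite -!EFinM -EFinD lee_fin /G pM exprMn.
      rewrite [leRHS](_ : _ = s xi ^+ 2 * (2 * (r * L * eucl_norm xi ^+ k.+1) ^+ 2 +
         2 * (2 * T * eucl_norm xi ^+ k) ^+ 2)); last by ring.
      rewrite ler_wpM2l ?sqr_ge0// -(real_normK (num_real (p (D xi)))).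
      have := pD xi; have := normr_ge0 (p (D xi)).
      set X := `|p _|; set Y := r * L * _; set Z := 2 * T * _ => X0 XYZ.
      have : X ^+ 2 <= (Y + Z) ^+ 2 by rewrite lerXn2r ?nnegrE// (le_trans X0).
      have := sqr_ge0 (Y - Z); nra.
  have p1 : (0 <= (2 * (r * L) ^+ 2)%:E)%E by rewrite lee_fin mulr_ge0 ?sqr_ge0.
  have p2 : (0 <= (8 * T ^+ 2)%:E)%E by rewrite lee_fin mulr_ge0 ?sqr_ge0.
  have q1 j xi : (0 <= ((s xi * eucl_norm xi ^+ j) ^+ 2)%:E)%E by rewrite lee_fin sqr_ge0.
  rewrite ge0_integralD//; last 4 first.
  - by move=> x _; rewrite mule_ge0.
  - exact: measurable_funeM.
  - by move=> x _; rewrite mule_ge0.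
  - exact: measurable_funeM.
  rewrite !ge0_integralZl//.
  rewrite [leRHS](_ : _ = (2 * (r * L) ^+ 2)%:E * M1%:E + (8 * T ^+ 2)%:E * M2%:E)%E; last first.
    by rewrite -!EFinM -EFinD.
  by apply: leeD; apply: lee_wpmul2l.
have [cmG1 cmG2] := cmeasurable_integrable iG.
have tb xi := fourier_sub_moment_symbol fk xi.
have bre : (\int[mu]_xi (complex.Re (G xi) ^+ 2)%:E <= M%:E)%E.
  apply: bound => //.
    by move=> a z; rewrite Re_mulc /= mul0r subr0.
  move=> xi; have [-> _ iT _] := tb xi.
  apply: (taylor_integral_le fk r0 _ _ iT) => t.
    exact: (taylor_bound _ _).1.
  exact: (taylor_bound_double _ _).1.
have bim : (\int[mu]_xi (complex.Im (G xi) ^+ 2)%:E <= M%:E)%E.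
  apply: bound => //.
    by move=> a z; rewrite Im_mulc /= mul0r addr0.
  move=> xi; have [_ -> _ iT] := tb xi.
  apply: (taylor_integral_le fk r0 _ _ iT) => t.
    exact: (taylor_bound _ _).2.
  exact: (taylor_bound_double _ _).2.
apply: le_trans (L2_norm_inv_fourier_le M0 iG bre bim) _.
rewrite -!EFinM -EFinD lee_fin.
set A := Num.sqrt M1; set B := Num.sqrt M2.
have A0 : 0 <= A by exact: sqrtr_ge0.
have B0 : 0 <= B by exact: sqrtr_ge0.
have r0' := ltW r0.
(* Comparing squares: 8 M contributes the coefficients 16 and 64, both covered by the 64 of the
   squared right-hand side. *)
rewrite -(@ler_pXn2r _ 2) ?nnegrE ?sqrtr_ge0 ?addr_ge0 ?mulr_ge0//.
rewrite sqr_sqrtr ?mulr_ge0// /M -(sqr_sqrtr M10) -(sqr_sqrtr M20) -/A -/B.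
rewrite [leLHS](_ : _ = 16 * (r * L * A) ^+ 2 + 64 * (T * B) ^+ 2); last by ring.
rewrite [leRHS](_ : _ = 64 * (r * L * A) ^+ 2 + 64 * (T * B) ^+ 2 + 128 * ((r * L * A) * (T * B))); last by ring.
have h1 := sqr_ge0 (r * L * A).
have h2 : 0 <= r * L * A * (T * B) by rewrite !mulr_ge0.
by lra.
Qed.

End L2_error.

(** * Moments of Gaussian symbols *)

Section gaussian.
Context {R : realType}.

Lemma integral_itv_derivative (f F : R -> R) (T : R) : 0 < T ->
  (forall x : R, 0 <= x -> is_derive x 1 F (f x)) ->
  (forall x : R, 0 <= x -> {for x, continuous f}) ->
  (\int[lebesgue_measure]_(x in `[0%R, T]) (f x)%:E = (F T - F 0)%:E)%E.
Proof.
move=> T0 dF cf.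
have cF (x : R) : 0 <= x -> {for x, continuous F}.
  move=> x0; apply: differentiable_continuous; apply/derivable1_diffP.
  by apply: ex_derive; exact: dF.
rewrite (@continuous_FTC2 _ f F 0 T T0)//.
- apply: continuous_in_subspaceT => x; rewrite inE/= in_itv/= => /andP[x0 _].
  exact: cf.
- split.
  + move=> x; rewrite in_itv/= => /andP[x0 _].
    by apply: ex_derive; exact: dF (ltW x0).
  + by apply: cvg_at_right_filter; exact: cF.
  + by apply: cvg_at_left_filter; apply: cF; exact: ltW.
- move=> x; rewrite in_itv/= => /andP[x0 _].
  by rewrite derive1E; apply: derive_val; exact: dF (ltW x0).
Qed.

Variable n : nat.
Local Notation mu := (lebesgue_rV n : {sigma_finite_measure set 'rV[R]_n -> \bar R}).

Definition gaussian (c : R) (x : 'rV[R]_n) : R := expR (- (c * eucl_norm x ^+ 2)).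

Lemma gaussian_ge0 c x : 0 <= gaussian c x.
Proof. exact: expR_ge0. Qed.

Lemma measurable_gaussian c : measurable_fun setT (gaussian c).
Proof.
apply: measurableT_comp => //; apply: measurableT_comp => //.
by apply: measurable_funM => //; apply: measurable_funX; exact: measurable_eucl_norm.
Qed.

Lemma integral_gaussian (c : R) : 0 < c ->
  (\int[mu]_x (gaussian c x)%:E = (Num.sqrt (pi / c) ^+ n)%:E)%E.
Proof.
move=> c0.
transitivity (\int[mu]_x (\prod_i expR (- (c * x ord0 i ^+ 2)))%:E)%E.
  apply: eq_integral => x _; congr EFin.
  by rewrite /gaussian eucl_norm_sqr mulr_sumr -sumrN expR_sum.
rewrite (@ge0_integral_prod _ _ (fun _ t => expR (- (c * t ^+ 2))) (fun=> Num.sqrt (pi / c))).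
- by rewrite prodr_const card_ord.
- move=> _; apply: continuous_measurable_fun.
  by apply: continuous_derivable => y; exact: ex_derive.
- by move=> _ t; exact: expR_ge0.
- by move=> _; exact: integral_gauss.
Qed.

Lemma integrable_gaussian (c : R) : 0 < c -> mu.-integrable setT (EFin \o gaussian c).
Proof.
move=> c0; apply: (@integrable_ge0_integral R _ _ _ _ (Num.sqrt (pi / c) ^+ n)).
- exact: measurable_gaussian.
- exact: gaussian_ge0.
- by rewrite integral_gaussian.
Qed.

Lemma expr_le_expR (u : R) m : 0 <= u -> u ^+ m <= m`!%:R * expR u.
Proof.
move=> u0; case: m => [|m]; first by rewrite expr0 fact0 mul1r -expR0 ler_expR.
have f0 : (0 : R) < (m.+1)`!%:R by rewrite ltr0n fact_gt0.
rewrite mulrC -ler_pdivrMr// (le_trans _ (expR_ge1Dxn m u0))//.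
by rewrite lerDr.
Qed.

(** Squaring gives two Gaussian factors: one absorbs the power of |x|^2, the other is left for the
    integration. *)
Lemma gaussian_moment_pointwise (b : R) m (x : 'rV[R]_n) : 0 < b ->
  (gaussian b x * eucl_norm x ^+ m) ^+ 2 <= m`!%:R * b ^- m * gaussian b x.
Proof.
move=> b0; set u := b * eucl_norm x ^+ 2.
have u0 : 0 <= u by rewrite mulr_ge0 ?sqr_ge0// ltW.
have -> : (gaussian b x * eucl_norm x ^+ m) ^+ 2 = b ^- m * (gaussian b x * (gaussian b x * u ^+ m)).
  have B0 : b ^+ m != 0 by rewrite expf_neq0// gt_eqF.
  rewrite exprMn -exprM mulnC exprM /u [X in _ = _ * (_ * (_ * X))]exprMn.
  by field.
rewrite [leRHS](_ : _ = b ^- m * (gaussian b x * m`!%:R)); last by ring.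
rewrite ler_wpM2l ?invr_ge0 ?exprn_ge0 ?(ltW b0)// ler_wpM2l ?gaussian_ge0//.
by rewrite /gaussian -/u expRN ler_pdivrMl ?expR_gt0// mulrC expr_le_expR.
Qed.

(** Absorbing the power costs b^(-m) and the remaining Gaussian integral b^(-n/2). *)
Lemma gaussian_moment_le (m : nat) : exists2 C : R, 0 < C & forall b, 0 < b ->
  (\int[mu]_x ((gaussian b x * eucl_norm x ^+ m) ^+ 2)%:E <=
   (C * b `^ (- (m%:R + n%:R / 2)))%:E)%E.
Proof.
exists (m`!%:R * Num.sqrt pi ^+ n).
  by rewrite mulr_gt0 ?ltr0n ?fact_gt0// exprn_gt0// sqrtr_gt0 pi_gt0.
move=> b b0.
have c0 : 0 <= m`!%:R * b ^- m :> R by rewrite mulr_ge0 ?invr_ge0 ?exprn_ge0 ?(ltW b0).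
apply: (@le_trans _ _ (\int[mu]_x ((m`!%:R * b ^- m)%:E * (gaussian b x)%:E))%E).
  apply: ge0_le_integral => //.
  - by move=> x _; rewrite lee_fin sqr_ge0.
  - apply/measurable_EFinP; apply: measurable_funX; apply: measurable_funM.
      exact: measurable_gaussian.
    by apply: measurable_funX; exact: measurable_eucl_norm.
  - by apply: measurable_funeM; apply/measurable_EFinP; exact: measurable_gaussian.
  - by move=> x _; rewrite -EFinM lee_fin gaussian_moment_pointwise.
rewrite ge0_integralZl//; last 2 first.
- by apply/measurable_EFinP; exact: measurable_gaussian.
- by move=> x _; rewrite lee_fin gaussian_ge0.
rewrite integral_gaussian// -EFinM lee_fin.
rewrite opprD powRD; last by rewrite (gt_eqF b0) implybT.
rewrite powR_invn ?(ltW b0)//.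
rewrite sqrtrM ?pi_ge0// exprMn sqrtrV ?(ltW b0)// exprVn.
rewrite (_ : n%:R / 2 = 2^-1 * n%:R); last by ring.
rewrite powRN powRrM powR12_sqrt ?(ltW b0)// powR_mulrn ?sqrtr_ge0//.
by rewrite le_eqVlt; apply/orP; left; apply/eqP; ring.
Qed.

Lemma rapid_gaussian_dom (s : 'rV[R]_n -> R) (b S : R) : 0 < b ->
  measurable_fun setT s -> (forall x, `|s x| <= S * gaussian b x) ->
  rapid (fun x => (s x)%:C%C).
Proof.
move=> b0 ms sS; split; first exact: cmeasurable_real.
move=> m; pose K : R := 1 + m`!%:R * (b / 2) ^- m.
have b2 : 0 < b / 2 by rewrite divr_gt0.
apply: (integrable_dom _ _ (integrable_scale (S * K) (integrable_gaussian b2))).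
  apply: measurable_funM; first by apply: measurable_funX; exact: measurable_eucl_norm.
  by apply: measurable_normc; exact: cmeasurable_real.
move=> x; rewrite normrM normc_real normr_id (ger0_norm (exprn_ge0 _ (eucl_norm_ge0 _))).
have N0 := eucl_norm_ge0 x.
have S0 : 0 <= S * gaussian b x by exact: le_trans (sS x).
have gg : gaussian b x = gaussian (b / 2) x * gaussian (b / 2) x.
  by rewrite /gaussian -expRD; congr expR; field.
(* The exponent 2 m is an integer power of b / 2 * |x|^2, to which [expr_le_expR] applies; this
   explains the form of [K]. *)
have h1 : eucl_norm x ^+ m <= 1 + eucl_norm x ^+ m ^+ 2.
  have := exprn_ge0 m N0; set y := _ ^+ m => y0; have := sqr_ge0 (y - 1); nra.
have h2 : eucl_norm x ^+ m * gaussian (b / 2) x <= K.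
  have g1 : gaussian (b / 2) x <= 1.
    by rewrite /gaussian -[leRHS]expR0 ler_expR oppr_le0 mulr_ge0 ?sqr_ge0// ltW.
  have := gaussian_ge0 (b / 2) x => g0.
  rewrite (le_trans (ler_wpM2r g0 h1))// mulrDl mul1r lerD//.
  set u := b / 2 * eucl_norm x ^+ 2.
  have u0 : 0 <= u by rewrite mulr_ge0 ?sqr_ge0// ltW.
  have -> : eucl_norm x ^+ m ^+ 2 * gaussian (b / 2) x = (b / 2) ^- m * (u ^+ m * gaussian (b / 2) x).
    have B0 : (b / 2) ^+ m != 0 by rewrite expf_neq0// gt_eqF.
    by rewrite -exprM mulnC exprM /u [X in _ = _ * (X * _)]exprMn -[X in _ = _ * X]mulrA mulKf.
  rewrite mulrC ler_wpM2r ?invr_ge0 ?exprn_ge0 ?(ltW b2)//.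
  by rewrite /gaussian -/u expRN ler_pdivrMr ?expR_gt0// expr_le_expR.
rewrite mulrC; apply: le_trans (ler_wpM2r (exprn_ge0 m N0) (sS x)) _.
(* The sign of [S] follows from the domination, the Gaussian being positive. *)
have S1 : 0 <= S by rewrite -(pmulr_lge0 _ (expR_gt0 (- (b * eucl_norm x ^+ 2)))).
rewrite gg -!mulrA ler_wpM2l// [leRHS]mulrC ler_wpM2l ?gaussian_ge0//.
by rewrite mulrC.
Qed.

End gaussian.

(** * The heat bound for sine symbols *)

Section heat_kernel.
Context {R : realType} {n : nat}.
Local Notation mu := (lebesgue_rV n : {sigma_finite_measure set 'rV[R]_n -> \bar R}).
Local Notation leb := (@lebesgue_measure R).

(** An indicator replaces the interval so that Tonelli applies on the full product space; the
    measurability of the inner integral is recorded for the comparison in [heat_bound]. *)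
Lemma heat_tonelli (b T : R) : 0 < b ->
  measurable_fun setT (fun x : 'rV[R]_n =>
    \int[leb]_(c in `[0%R, T]) (gaussian (b + c) x)%:E)%E /\
  (\int[mu]_x \int[leb]_(c in `[0%R, T]) (gaussian (b + c) x)%:E =
   \int[leb]_(c in `[0%R, T]) (Num.sqrt (pi / (b + c)) ^+ n)%:E)%E.
Proof.
move=> b0; pose D : set R := `[0, T]%classic.
have mD : measurable D by exact: measurable_itv.
pose g (p : 'rV[R]_n * measurableTypeR R) := (gaussian (b + p.2) p.1 * \1_D p.2)%:E.
have mg : measurable_fun setT g.
  apply/measurable_EFinP; apply: measurable_funM.
    apply: measurableT_comp => //; apply: measurableT_comp => //.
    apply: measurable_funM; first exact: measurable_funD.
    by apply: measurable_funX; exact: measurable_eucl_norm.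
  have m1 : measurable_fun setT (\1_D : measurableTypeR R -> R) by exact: measurable_indic.
  exact: (measurableT_comp m1).
have g0 p : (0 <= g p)%E by rewrite lee_fin mulr_ge0 ?gaussian_ge0.
have condE (h : R -> R) : ((fun c => (h c)%:E) \_ D)%E = (fun c => (h c * \1_D c)%:E).
  apply/funext => c; rewrite patchE indicE; case: ifP => _; by rewrite ?mulr1 ?mulr0.
have gE : (fun x : 'rV[R]_n => \int[leb]_(c in `[0%R, T]) (gaussian (b + c) x)%:E)%E =
    (fun x => \int[leb]_c g (x, c))%E.
  by apply/funext => x; rewrite integral_mkcond condE.
split; first by rewrite gE; exact: measurable_fun_fubini_tonelli_F mg g0.
transitivity (\int[mu]_x \int[leb]_c g (x, c))%E.
  by apply: eq_integral => x _; rewrite integral_mkcond condE.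
rewrite (fubini_tonelli _ mg g0) [RHS]integral_mkcond condE.
apply: eq_integral => c _; rewrite /g /=.
have [cD|cD] := boolP (c \in D).
  have c0 : 0 < b + c.
    by move: cD; rewrite inE /D /= in_itv/= => /andP[c0 _]; rewrite ltr_wpDr.
  by rewrite indicE cD mulr1 -(integral_gaussian n c0); apply: eq_integral => x _; rewrite mulr1.
rewrite indicE (negbTE cD) mulr0.
by under eq_integral do rewrite mulr0; rewrite integral0.
Qed.

(** From expR v >= 1 + v one gets 1 - expR (- v) >= v / (1 + v), which is at least half of min (1,
    v), as seen for v >= 1 and v < 1 separately. *)
Lemma one_sub_expRN_ge (v : R) : 0 <= v -> Num.min 1 v <= 2 * (1 - expR (- v)).
Proof.
move=> v0; have := expR_ge1Dx v => h.
have e0 : 0 < expR v by exact: expR_gt0.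
have d0 : 0 < 1 + v by rewrite ltr_pwDl.
have : expR (- v) <= (1 + v)^-1 by rewrite expRN lef_pV2 ?posrE.
move=> h1; have h2 : 1 - (1 + v)^-1 <= 1 - expR (- v) by rewrite lerD2l lerN2.
have h3 : (1 + v)^-1 * (1 + v) = 1 by rewrite mulVf// gt_eqF.
have h4 : 0 < (1 + v)^-1 by rewrite invr_gt0.
rewrite ge_min; have [v1|v1] := leP 1 v.
  by apply/orP; left; nra.
by apply/orP; right; nra.
Qed.

Lemma integral_gaussian_param (b T : R) (x : 'rV[R]_n) : 0 < T -> 0 < eucl_norm x ->
  (\int[leb]_(c in `[0%R, T]) (gaussian (b + c) x)%:E =
   (gaussian b x * ((1 - expR (- (T * eucl_norm x ^+ 2))) / eucl_norm x ^+ 2))%:E)%E.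
Proof.
move=> T0 x0; set r2 := eucl_norm x ^+ 2.
have r20 : r2 != 0 by rewrite gt_eqF// exprn_gt0.
pose F (c : R) := - expR (- ((b + c) * r2)) / r2.
have dF (c : R) : 0 <= c -> is_derive c 1 F (gaussian (b + c) x).
  move=> _; rewrite /F; apply: is_derive_eq; rewrite /gaussian -/r2 /GRing.scale/=.
  by field.
have cf (c : R) : 0 <= c -> {for c, continuous (fun c => gaussian (b + c) x)}.
  move=> _; apply: (@continuous_derivable _ (fun c => gaussian (b + c) x)) => y.
  by rewrite /gaussian; exact: ex_derive.
rewrite (integral_itv_derivative T0 dF cf).
congr EFin; rewrite /F /gaussian -/r2 addr0 !mulrDl opprD expRD; ring.
Qed.

Lemma heat_bound (s : 'rV[R]_n -> R) (b T K : R) : 0 < b -> 0 < T -> 0 <= K ->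
  measurable_fun setT s ->
  (forall x, eucl_norm x = 0 -> s x = 0) ->
  (forall x, 0 < eucl_norm x -> s x ^+ 2 <=
     K * (gaussian b x * (Num.min 1 (T * eucl_norm x ^+ 2) / eucl_norm x ^+ 2))) ->
  (\int[mu]_x (s x ^+ 2)%:E <=
   (2 * K)%:E * \int[leb]_(c in `[0%R, T]) (Num.sqrt (pi / (b + c)) ^+ n)%:E)%E.
Proof.
move=> b0 T0 K0 ms s0 sK; have [mI <-] := heat_tonelli T b0.
have K2 : (0 <= (2 * K)%:E)%E by rewrite lee_fin mulr_ge0.
have I0 x : (0 <= \int[leb]_(c in `[0%R, T]) (gaussian (b + c) x)%:E)%E.
  by apply: integral_ge0 => c _; rewrite lee_fin gaussian_ge0.
rewrite -ge0_integralZl//.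
apply: ge0_le_integral => //.
- by move=> x _; rewrite lee_fin sqr_ge0.
- by apply/measurable_EFinP; exact: measurable_funX.
- exact: measurable_funeM.
- move=> x _; have := eucl_norm_ge0 x; rewrite le_eqVlt => /predU1P[x0|x0].
    (* The comparison is pointwise, so the origin is treated apart: the formula with quotients is of
       no use there, but [s] vanishes. *)
    by rewrite s0// expr0n /= mule_ge0.
  rewrite integral_gaussian_param// -EFinM lee_fin (le_trans (sK _ x0))//.
  rewrite [leRHS](_ : _ = K * (gaussian b x *
     (2 * (1 - expR (- (T * eucl_norm x ^+ 2))) / eucl_norm x ^+ 2))); last by ring.
  rewrite ler_wpM2l// ler_wpM2l ?gaussian_ge0// ler_wpM2r ?invr_ge0 ?exprn_ge0 ?(ltW x0)//.
  by apply: one_sub_expRN_ge; rewrite mulr_ge0 ?sqr_ge0// ltW.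
Qed.

End heat_kernel.

(** * Integrals in the heat parameter, by dimension *)

Section heat_integrals.
Context {R : realType}.
Local Notation leb := (@lebesgue_measure R).
Variables b T : R.
Hypotheses (b0 : 0 < b) (T0 : 0 < T).

Let bc (c : R) : 0 <= c -> 0 < b + c. Proof. by move=> ?; rewrite ltr_wpDr. Qed.

Let sqrt_pi_div (c : R) : 0 <= c -> Num.sqrt (pi / (b + c)) = Num.sqrt pi / Num.sqrt (b + c).
Proof. by move=> c0; rewrite sqrtrM ?pi_ge0// sqrtrV// ltW// bc. Qed.

Let eq_itv (f g : R -> R) : (forall c, 0 <= c -> f c = g c) ->
  (\int[leb]_(c in `[0%R, T]) (f c)%:E = \int[leb]_(c in `[0%R, T]) (g c)%:E)%E.
Proof.
by move=> fg; apply: eq_integral => c; rewrite inE/= in_itv/= => /andP[c0 _]; rewrite fg.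
Qed.

Let dshift (c : R) : is_derive c 1 (fun c => b + c) 1.
Proof. by apply: is_derive_eq; rewrite mulr1 add0r. Qed.

Let dsqrt (c : R) : 0 <= c ->
  is_derive c 1 (fun c => Num.sqrt (b + c)) (2 * Num.sqrt (b + c))^-1.
Proof.
move=> c0; have d := is_derive1_sqrt (bc c0).
have := @is_derive1_comp R Num.sqrt (fun c => b + c) c _ _ d (dshift c).
by rewrite mulr1.
Qed.

Let csqrt (c : R) : 0 <= c -> {for c, continuous (fun c => Num.sqrt (b + c))}.
Proof.
move=> c0; apply: differentiable_continuous; apply/derivable1_diffP.
by apply: ex_derive; exact: dsqrt.
Qed.

Let cinv (c : R) : 0 <= c -> {for c, continuous (fun c => pi / (b + c))}.
Proof.
move=> c0; apply: cvgM; first exact: cvg_cst.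
apply: cvgV; first by rewrite gt_eqF// bc.
by apply: cvgD; [exact: cvg_cst|exact: cvg_id].
Qed.

Let meas_itv (f : R -> R) : (forall c : R, 0 <= c -> {for c, continuous f}) ->
  measurable_fun `[0%R, T] f.
Proof.
move=> cf; apply: subspace_continuous_measurable_fun => //.
apply: continuous_in_subspaceT => c; rewrite inE/= in_itv/= => /andP[c0 _].
exact: cf.
Qed.

Lemma heat_integral1 :
  (\int[leb]_(c in `[0%R, T]) (Num.sqrt (pi / (b + c)) ^+ 1)%:E <=
   (2 * Num.sqrt pi * Num.sqrt (b + T))%:E)%E.
Proof.
rewrite (eq_itv (g := fun c => Num.sqrt pi / Num.sqrt (b + c))); last first.
  by move=> c c0; rewrite expr1 sqrt_pi_div.
have dF (c : R) : 0 <= c -> is_derive c 1 (fun c => 2 * Num.sqrt pi * Num.sqrt (b + c))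
    (Num.sqrt pi / Num.sqrt (b + c)).
  move=> c0; have d := dsqrt c0; apply: is_derive_eq; rewrite /GRing.scale/=.
  have : Num.sqrt (b + c) != 0 by rewrite gt_eqF// sqrtr_gt0 bc.
  by move=> s0; field.
have cf (c : R) : 0 <= c -> {for c, continuous (fun c => Num.sqrt pi / Num.sqrt (b + c))}.
  move=> c0; apply: cvgM; first exact: cvg_cst.
  by apply: cvgV; [rewrite gt_eqF// sqrtr_gt0 bc|exact: csqrt].
rewrite (integral_itv_derivative T0 dF cf) lee_fin lerBlDr lerDl.
by rewrite !mulr_ge0 ?sqrtr_ge0.
Qed.

Lemma heat_integral2 :
  (\int[leb]_(c in `[0%R, T]) (Num.sqrt (pi / (b + c)) ^+ 2)%:E =
   (pi * (ln (b + T) - ln b))%:E)%E.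
Proof.
rewrite (eq_itv (g := fun c => pi / (b + c))); last first.
  by move=> c c0; rewrite sqr_sqrtr// divr_ge0 ?pi_ge0// ltW// bc.
have dF (c : R) : 0 <= c -> is_derive c 1 (fun c => pi * ln (b + c)) (pi / (b + c)).
  move=> c0; have d := is_derive1_ln (bc c0).
  have d' := @is_derive1_comp R (@ln R) (fun c => b + c) c _ _ d (dshift c).
  by apply: is_derive_eq; rewrite /GRing.scale/= mulr1.
by rewrite (integral_itv_derivative T0 dF cinv) addr0 mulrBr.
Qed.

(** Replacing b + c by b in all but three of the square roots leaves (b + c)^(-3/2), integrable at
    infinity: one antiderivative serves every n >= 3, and the bound does not depend on [T]. *)
Lemma heat_integral3 n : (3 <= n)%N ->
  (\int[leb]_(c in `[0%R, T]) (Num.sqrt (pi / (b + c)) ^+ n)%:E <=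
   (2 * Num.sqrt pi ^+ n * Num.sqrt b ^- (n - 2))%:E)%E.
Proof.
move=> n3; have [m ->] : exists m, n = (m + 3)%N by exists (n - 3)%N; rewrite subnK.
have sp0 : 0 <= Num.sqrt (pi : R) by exact: sqrtr_ge0.
have sb0 : 0 < Num.sqrt b by rewrite sqrtr_gt0.
have sc0 (c : R) : 0 <= c -> 0 < Num.sqrt (b + c) by move=> c0; rewrite sqrtr_gt0 bc.
pose K := Num.sqrt pi ^+ (m + 3) * Num.sqrt b ^- m.
have K0 : 0 <= K by rewrite mulr_ge0 ?invr_ge0 ?exprn_ge0// ltW.
have dF (c : R) : 0 <= c -> is_derive c 1 (fun c => - (2 * K) * (Num.sqrt (b + c))^-1)
    (K * Num.sqrt (b + c) ^- 3).
  move=> c0; have d := dsqrt c0; have s0 : Num.sqrt (b + c) != 0 by rewrite gt_eqF// sc0.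
  have dV := @is_deriveV R (fun c => Num.sqrt (b + c)) c _ 1 s0 d.
  by apply: is_derive_eq; rewrite /GRing.scale/=; field.
have cf (c : R) : 0 <= c -> {for c, continuous (fun c => K * Num.sqrt (b + c) ^- 3)}.
  move=> c0; apply: cvgM; first exact: cvg_cst.
  apply: cvgV; first by rewrite gt_eqF// exprn_gt0// sc0.
  by apply: (@continuous_comp _ _ _ (fun c => Num.sqrt (b + c)) (fun y => y ^+ 3));
    [exact: csqrt|exact: exprn_continuous].
have cmp c : 0 <= c -> Num.sqrt (pi / (b + c)) ^+ (m + 3) <= K * Num.sqrt (b + c) ^- 3.
  move=> c0; rewrite sqrt_pi_div// exprMn /K -mulrA ler_wpM2l ?exprn_ge0//.
  rewrite exprVn exprD invfM ler_wpM2r ?invr_ge0 ?exprn_ge0 ?sqrtr_ge0//.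
  rewrite lef_pV2 ?posrE ?exprn_gt0// ?sc0// lerXn2r ?nnegrE ?sqrtr_ge0//.
  by rewrite ler_sqrt ?lerDl// ltW// bc.
apply: (@le_trans _ _ (\int[leb]_(c in `[0%R, T]) (K * Num.sqrt (b + c) ^- 3)%:E)%E).
  apply: ge0_le_integral => //.
  - apply/measurable_EFinP; apply: meas_itv => c c0.
    apply: (@continuous_comp _ _ _ (fun c => Num.sqrt (pi / (b + c))) (fun y => y ^+ (m + 3))).
      apply: (@continuous_comp _ _ _ (fun c => pi / (b + c)) Num.sqrt); last exact: sqrt_continuous.
      exact: cinv.
    exact: exprn_continuous.
  - by apply/measurable_EFinP; exact: meas_itv cf.
  - by move=> c; rewrite /= in_itv/= => /andP[c0 _]; rewrite lee_fin cmp.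
rewrite (integral_itv_derivative T0 dF cf) lee_fin addr0.
have s3 := ltW (sc0 T (ltW T0)).
rewrite (_ : _ - _ = 2 * K / Num.sqrt b - 2 * K / Num.sqrt (b + T)); last by ring.
apply: (@le_trans _ _ (2 * K / Num.sqrt b)).
  by rewrite gerBl divr_ge0// mulr_ge0.
(* The antiderivative at 0 brings one more factor 1 / sqrt b, which turns the exponent n - 3 into n
   - 2. *)
rewrite /K (_ : (m + 3 - 2 = m.+1)%N); last by rewrite addn3 subn2.
by rewrite exprS invfM le_eqVlt; apply/orP; left; apply/eqP; ring.
Qed.

End heat_integrals.

(** * Error estimates *)

Section symbols.
Context {R : realType} {n : nat}.
Local Notation mu := (lebesgue_rV n : {sigma_finite_measure set 'rV[R]_n -> \bar R}).
Local Notation leb := (@lebesgue_measure R).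
Implicit Types xi : 'rV[R]_n.

Lemma measurable_inv_nonneg d (T : measurableType d) (f : T -> R) :
  measurable_fun setT f -> (forall x, 0 <= f x) ->
  measurable_fun setT (fun x => (f x)^-1).
Proof.
move=> mf f0; rewrite (_ : (fun _ => _) = (fun x => f x `^ (-1))).
  exact: (measurableT_comp (@measurable_powR R (-1)) mf).
by apply/funext => x; rewrite powR_inv1.
Qed.

Let mN : measurable_fun setT (@eucl_norm R n).
Proof. exact: measurable_eucl_norm. Qed.

Lemma measurable_riesz (N l : 'I_n) : measurable_fun setT (@riesz R n N l).
Proof.
apply: measurable_funM; first by apply: measurable_funM; exact: measurable_rV_coord.
apply: measurable_inv_nonneg; first exact: measurable_funX.
by move=> x; exact: sqr_ge0.
Qed.

Lemma riesz_le1 (N l : 'I_n) xi : `|riesz N l xi| <= 1.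
Proof.
rewrite /riesz normrM normfV (ger0_norm (sqr_ge0 _)).
have := eucl_norm_ge0 xi; rewrite le_eqVlt => /predU1P[<-|x0].
  (* At the origin the quotient takes its default value 0. *)
  by rewrite expr0n invr0 mulr0.
rewrite ler_pdivrMr ?exprn_gt0// mul1r normrM expr2.
by rewrite ler_pM// le_coord_eucl_norm.
Qed.

Section parameters.
Variables alpha beta t : R.
Hypotheses (alpha0 : 0 < alpha) (beta0 : 0 < beta).

Lemma measurable_symb_c : measurable_fun setT (@symb_c R n alpha beta t).
Proof.
apply: measurable_funM.
  by apply: measurableT_comp => //; apply: measurable_funM => //; exact: measurable_funX.
by apply: (measurableT_comp measurable_cos); exact: measurable_funM.
Qed.

Lemma measurable_symb_s : measurable_fun setT (@symb_s R n alpha beta t).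
Proof.
apply: measurable_funM.
  by apply: measurableT_comp => //; apply: measurable_funM => //; exact: measurable_funX.
apply: measurable_funM.
  by apply: (measurableT_comp measurable_sin); exact: measurable_funM.
apply: measurable_inv_nonneg; first exact: measurable_funM.
by move=> x; rewrite mulr_ge0 ?eucl_norm_ge0// ltW.
Qed.

Lemma symb_c_le xi : `|symb_c alpha beta t xi| <= gaussian beta xi.
Proof.
rewrite /symb_c mulNr normrM (ger0_norm (expR_ge0 _)) ler_piMr ?expR_ge0//.
exact: cos_max.
Qed.

Lemma normr_sin_le (u : R) : `|sin u| <= `|u|.
Proof.
have := (taylor_bound 1 u).2.
by rewrite /taylor_im big_ord1 /expNi_im expr0 /= mul0r subr0 normrN expr1.
Qed.

Lemma symb_s0 xi : eucl_norm xi = 0 -> symb_s alpha beta t xi = 0.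
Proof. by rewrite /symb_s => ->; rewrite !mulr0 sin0 mul0r mulr0. Qed.

(** This bound grows with [t] and only serves to make the symbol [rapid]; the estimates rest on
    [symb_s_norm_le] and [symb_s_heat]. *)
Lemma symb_s_le xi : `|symb_s alpha beta t xi| <= `|t| * gaussian beta xi.
Proof.
have := eucl_norm_ge0 xi; rewrite le_eqVlt => /predU1P[x0|x0].
  by rewrite symb_s0// normr0 mulr_ge0// gaussian_ge0.
rewrite /symb_s mulNr normrM (ger0_norm (expR_ge0 _)) mulrC ler_wpM2r ?expR_ge0//.
have ax : 0 < alpha * eucl_norm xi by exact: mulr_gt0.
rewrite normrM normfV (gtr0_norm ax) ler_pdivrMr// (le_trans (normr_sin_le _))//.
by rewrite -mulrA normrM (gtr0_norm ax).
Qed.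

(** One factor |xi| cancels the denominator of the symbol, so the bound is uniform in [t]. *)
Lemma symb_s_norm_le xi :
  `|symb_s alpha beta t xi| * eucl_norm xi <= alpha^-1 * gaussian beta xi.
Proof.
have := eucl_norm_ge0 xi; rewrite le_eqVlt => /predU1P[x0|x0].
  by rewrite symb_s0// normr0 mul0r mulr_ge0 ?gaussian_ge0// invr_ge0 ltW.
rewrite /symb_s mulNr normrM (ger0_norm (expR_ge0 _)) -[leLHS]mulrA [leRHS]mulrC.
rewrite /gaussian ler_wpM2l ?expR_ge0//.
have ax : 0 < alpha * eucl_norm xi by exact: mulr_gt0.
rewrite normrM normfV (gtr0_norm ax) invfM mulrA divfK ?gt_eqF//.
by rewrite ler_piMl ?invr_ge0 ?(ltW alpha0)// sin_max.
Qed.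

(** Both |sin u| <= 1 and |sin u| <= |u| are kept, whence the minimum; the second one tames the
    origin. Squaring doubles [beta] in the Gaussian. *)
Lemma symb_s_heat xi : 0 < eucl_norm xi -> symb_s alpha beta t xi ^+ 2 <=
  alpha ^- 2 * (gaussian (2 * beta) xi *
    (Num.min 1 ((t * alpha) ^+ 2 * eucl_norm xi ^+ 2) / eucl_norm xi ^+ 2)).
Proof.
move=> x0; have a0 : alpha != 0 by rewrite gt_eqF.
have r0 : eucl_norm xi != 0 by rewrite gt_eqF.
have gg : expR (- beta * eucl_norm xi ^+ 2) ^+ 2 = gaussian (2 * beta) xi.
  by rewrite expr2 -expRD /gaussian; congr expR; ring.
rewrite /symb_s exprMn gg.
rewrite [leLHS](_ : _ = alpha ^- 2 * (gaussian (2 * beta) xi *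
  (sin (t * alpha * eucl_norm xi) ^+ 2 / eucl_norm xi ^+ 2))); last by field; rewrite ?a0 ?r0.
rewrite ler_wpM2l ?invr_ge0 ?sqr_ge0// ler_wpM2l ?gaussian_ge0//.
rewrite ler_wpM2r ?invr_ge0 ?sqr_ge0// -exprMn le_min.
rewrite -(real_normK (num_real (sin _))).
rewrite -[X in _ && (_ <= X)](real_normK (num_real _)) -[X in (_ <= X) && _](expr1n _ 2).
by rewrite !lerXn2r ?nnegrE ?sin_max ?normr_sin_le.
Qed.

End parameters.
End symbols.

(** * Error bounds for dominated symbols *)

Section estimates.
Context {R : realType} {n : nat}.
Local Open Scope complex_scope.
Local Notation mu := (lebesgue_rV n : {sigma_finite_measure set 'rV[R]_n -> \bar R}).
Local Notation leb := (@lebesgue_measure R).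
Implicit Types (s f : 'rV[R]_n -> R).

Definition multiplier_error s k f (x : 'rV[R]_n) : R[i] :=
  fourier_multiplier s f x - moment_expansion k f (inv_fourier (fun xi => (s xi)%:C)) x.

Let mN : measurable_fun setT (@eucl_norm R n).
Proof. exact: measurable_eucl_norm. Qed.

Lemma sqr_integral_le (u v : 'rV[R]_n -> R) (c M : R) : 0 <= c ->
  measurable_fun setT u -> measurable_fun setT v ->
  (forall x, `|u x| <= c * `|v x|) ->
  (\int[mu]_x (v x ^+ 2)%:E <= M%:E)%E ->
  (\int[mu]_x (u x ^+ 2)%:E <= (c ^+ 2 * M)%:E)%E.
Proof.
move=> c0 mu' mv uv vM.
have c2 : (0 <= (c ^+ 2)%:E)%E by rewrite lee_fin sqr_ge0.
have v2 x : (0 <= (v x ^+ 2)%:E)%E by rewrite lee_fin sqr_ge0.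
have mv2 : measurable_fun setT (fun x => (v x ^+ 2)%:E).
  by apply/measurable_EFinP; exact: measurable_funX.
apply: (@le_trans _ _ (\int[mu]_x ((c ^+ 2)%:E * (v x ^+ 2)%:E))%E).
  apply: ge0_le_integral => //.
  - by move=> x _; rewrite lee_fin sqr_ge0.
  - by apply/measurable_EFinP; exact: measurable_funX.
  - exact: measurable_funeM.
  - move=> x _; rewrite -EFinM lee_fin -(real_normK (num_real (u x))) -(real_normK (num_real (v x))).
    by rewrite -exprMn lerXn2r ?nnegrE ?mulr_ge0.
by rewrite ge0_integralZl// [leRHS]EFinM lee_wpmul2l.
Qed.

Lemma moment_sqr_le s (v : 'rV[R]_n -> R) (c M : R) j : 0 <= c ->
  measurable_fun setT s -> measurable_fun setT v ->
  (forall x, `|s x| <= c * `|v x|) ->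
  (\int[mu]_x ((v x * eucl_norm x ^+ j) ^+ 2)%:E <= M%:E)%E ->
  (\int[mu]_x ((s x * eucl_norm x ^+ j) ^+ 2)%:E <= (c ^+ 2 * M)%:E)%E.
Proof.
move=> c0 ms mv sv; apply: sqr_integral_le => //.
- by apply: measurable_funM => //; exact: measurable_funX.
- by apply: measurable_funM => //; exact: measurable_funX.
- by move=> x; rewrite !normrM mulrA ler_wpM2r.
Qed.

Lemma L1w_val_ge0 k f : 0 <= L1w_val k f.
Proof.
by apply: Rintegral_ge0 => y _; rewrite mulr_ge0// exprn_ge0// addr_ge0// eucl_norm_ge0.
Qed.

Lemma tail_val_ge0 k f r : 0 <= \int[mu]_y tail_fun k f r y.
Proof. by apply: Rintegral_ge0 => y _; have /andP[] := tail_fun_le k f r y. Qed.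

(** The radius is b^(1/4). Square roots halve the exponents of the two moments, and the radius adds
    1/4 to the first. *)
Lemma multiplier_error_power s k f (b A1 A2 e1 e2 C : R) : 0 < b -> 0 < A1 -> 0 < A2 ->
  measurable_fun setT s -> rapid (fun xi => (s xi)%:C) -> in_L1w k f ->
  (\int[mu]_xi ((s xi * eucl_norm xi ^+ k.+1) ^+ 2)%:E <= (A1 * b `^ e1)%:E)%E ->
  (\int[mu]_xi ((s xi * eucl_norm xi ^+ k) ^+ 2)%:E <= (A2 * b `^ e2)%:E)%E ->
  8 * Num.sqrt A1 <= C -> 8 * Num.sqrt A2 <= C ->
  (L2_norm (multiplier_error s k f) <=
    (C * b `^ (1 / 4 + e1 / 2))%:E * L1w_norm k f +
    (C * b `^ (e2 / 2))%:E * tail_moment k (b `^ (1 / 4)) f)%E.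
Proof.
move=> b0 A10 A20 ms rs fk I1 I2 C1 C2.
have p0 e : 0 < b `^ e by exact: powR_gt0.
have sq e (D : R) : 0 < D -> Num.sqrt (D * b `^ e) = Num.sqrt D * b `^ (e / 2).
  move=> D0; rewrite sqrtrM ?(ltW D0)//; congr (_ * _).
  by rewrite -powR12_sqrt ?(ltW (p0 _))// -powRrM.
have n0 : b != 0 by rewrite gt_eqF.
apply: le_trans (L2_error_le ms rs fk (p0 (1 / 4)) _ _ I1 I2) _.
- by rewrite mulr_ge0 ?(ltW (p0 _))// ltW.
- by rewrite mulr_ge0 ?(ltW (p0 _))// ltW.
rewrite !sq// (L1w_normE fk) (tail_momentE fk) -!EFinM -!EFinD lee_fin.
apply: lerD; apply: ler_wpM2r; rewrite ?L1w_val_ge0 ?tail_val_ge0//.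
- rewrite (mulrCA (b `^ (1 / 4))) (mulrA 8) -powRD ?n0 ?implybT//.
  by rewrite ler_wpM2r ?(ltW (p0 _)).
- by rewrite mulrA ler_wpM2r ?(ltW (p0 _)).
Qed.

(** Stated for any symbol below the Gaussian, so that one constant serves both cosine symbols and
    every [t]. *)
Lemma gaussian_dominated_error (k : nat) : exists2 C : R, 0 < C &
  forall beta, 0 < beta -> forall s, measurable_fun setT s ->
  (forall x, `|s x| <= gaussian beta x) ->
  forall f, in_L1w k f ->
  (L2_norm (multiplier_error s k f) <=
    (C * beta `^ (- ((n%:R - 1) / 4) - (k%:R + 1) / 2))%:E * L1w_norm k f +
    (C * beta `^ (- (n%:R / 4) - k%:R / 2))%:E * tail_moment k (beta `^ (1 / 4)) f)%E.
Proof.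
have [C1 C10 H1] := @gaussian_moment_le R n k.+1.
have [C2 C20 H2] := @gaussian_moment_le R n k.
exists (8 * Num.sqrt C1 + 8 * Num.sqrt C2).
  by rewrite addr_gt0// mulr_gt0// sqrtr_gt0.
move=> b b0 s ms sg f fk.
have rs : rapid (fun xi => (s xi)%:C).
  by apply: (rapid_gaussian_dom b0 ms (S := 1)) => x; rewrite mul1r.
have sg1 x : `|s x| <= 1 * `|gaussian b x| by rewrite mul1r (le_trans (sg x))// ler_norm.
have mg := @measurable_gaussian R n b.
have I1 := moment_sqr_le ler01 ms mg sg1 (H1 b b0); rewrite expr1n mul1r in I1.
have I2 := moment_sqr_le ler01 ms mg sg1 (H2 b b0); rewrite expr1n mul1r in I2.
have -> : - ((n%:R - 1) / 4) - (k%:R + 1) / 2 = 1 / 4 + - (k.+1%:R + n%:R / 2) / 2 :> R.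
  by rewrite -natr1; field.
have -> : - (n%:R / 4) - k%:R / 2 = - (k%:R + n%:R / 2) / 2 :> R by field.
have h1 : 8 * Num.sqrt C1 <= 8 * Num.sqrt C1 + 8 * Num.sqrt C2 by rewrite lerDl mulr_ge0// sqrtr_ge0.
have h2 : 8 * Num.sqrt C2 <= 8 * Num.sqrt C1 + 8 * Num.sqrt C2 by rewrite lerDr mulr_ge0// sqrtr_ge0.
exact: (multiplier_error_power b0 C10 C20 ms rs fk I1 I2 h1 h2).
Qed.

Section sine.
Variable alpha : R.
Hypothesis alpha0 : 0 < alpha.

(** One power of |xi| cancels the denominator and leaves a Gaussian moment of order one less, in any
    dimension. *)
Lemma sine_moment_succ (beta t M : R) s j : 0 < beta -> measurable_fun setT s ->
  (forall x, `|s x| <= `|symb_s alpha beta t x|) ->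
  (\int[mu]_x ((gaussian beta x * eucl_norm x ^+ j) ^+ 2)%:E <= M%:E)%E ->
  (\int[mu]_x ((s x * eucl_norm x ^+ j.+1) ^+ 2)%:E <= (alpha ^- 2 * M)%:E)%E.
Proof.
move=> b0 ms ss; rewrite -exprVn; apply: sqr_integral_le.
- by rewrite invr_ge0 ltW.
- by apply: measurable_funM => //; exact: measurable_funX.
- by apply: measurable_funM; [exact: measurable_gaussian|exact: measurable_funX].
- move=> x; have N0 := eucl_norm_ge0 x.
  rewrite exprS mulrA !normrM (ger0_norm N0) (ger0_norm (gaussian_ge0 _ _)) mulrA.
  rewrite ler_wpM2r// (le_trans _ (symb_s_norm_le beta t alpha0 x))//.
  by rewrite ler_wpM2r.
Qed.

(** The zeroth power is kept so that the left-hand side is the moment of weight |x|^k at k = 0. *)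
Lemma sine_heat_le (beta t : R) s : 0 < beta -> 0 < t -> measurable_fun setT s ->
  (forall x, `|s x| <= `|symb_s alpha beta t x|) ->
  (\int[mu]_x ((s x * eucl_norm x ^+ 0) ^+ 2)%:E <= (2 * alpha ^- 2)%:E *
    \int[leb]_(c in `[0%R, ((t * alpha) ^+ 2)%R]) (Num.sqrt (pi / (2 * beta + c)) ^+ n)%:E)%E.
Proof.
move=> b0 t0 ms ss; under eq_integral do rewrite expr0 mulr1.
apply: heat_bound => //.
- by rewrite mulr_gt0.
- by rewrite exprn_gt0// mulr_gt0.
- by rewrite invr_ge0 sqr_ge0.
- move=> x x0; apply/eqP; rewrite -normr_le0 (le_trans (ss x))//.
  by rewrite symb_s0// normr0.
- move=> x x0; apply: le_trans (symb_s_heat beta t alpha0 x0).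
  by rewrite -(real_normK (num_real (s x))) -[leRHS](real_normK (num_real _)) lerXn2r ?nnegrE.
Qed.

Lemma sine_rapid (beta t : R) s : 0 < beta -> measurable_fun setT s ->
  (forall x, `|s x| <= `|symb_s alpha beta t x|) -> rapid (fun xi => (s xi)%:C).
Proof.
move=> b0 ms ss; apply: (rapid_gaussian_dom b0 ms (S := `|t|)) => x.
by rewrite (le_trans (ss x))// symb_s_le.
Qed.

(** For k >= 1 the weight cancels the denominator. For k = 0 the singularity |xi|^(-2) remains, and
    n >= 3 makes the heat integral bounded uniformly in [t]. *)
Lemma sine_tail_moment (k : nat) : (1 <= k)%N \/ (3 <= n)%N -> exists2 A : R, 0 < A &
  forall beta t, 0 < beta -> 0 < t -> forall s, measurable_fun setT s ->
  (forall x, `|s x| <= `|symb_s alpha beta t x|) ->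
  (\int[mu]_x ((s x * eucl_norm x ^+ k) ^+ 2)%:E <=
    (A * beta `^ (- ((n%:R - 2) / 2) - k%:R))%:E)%E.
Proof.
case: k => [[//|n3]|k _]; last first.
  have [C C0 H] := @gaussian_moment_le R n k.
  exists (alpha ^- 2 * C); first by rewrite mulr_gt0// invr_gt0 exprn_gt0.
  move=> b t b0 t0 s ms ss.
  have := sine_moment_succ b0 ms ss (H b b0).
  rewrite mulrA (_ : - ((n%:R - 2) / 2) - k.+1%:R = - (k%:R + n%:R / 2))//.
  by rewrite -natr1; field.
have s20 : 0 < Num.sqrt (2 : R) by rewrite sqrtr_gt0.
exists (2 * alpha ^- 2 * (2 * Num.sqrt pi ^+ n * Num.sqrt 2 ^- (n - 2))).
  by rewrite !mulr_gt0// ?invr_gt0 ?exprn_gt0// sqrtr_gt0 pi_gt0.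
move=> b t b0 t0 s ms ss.
have b20 : 0 < 2 * b by rewrite mulr_gt0.
have T0 : 0 < (t * alpha) ^+ 2 by rewrite exprn_gt0// mulr_gt0.
apply: le_trans (sine_heat_le b0 t0 ms ss) _.
have a2 : (0 <= (2 * alpha ^- 2)%:E)%E by rewrite lee_fin mulr_ge0// invr_ge0 sqr_ge0.
apply: le_trans (lee_wpmul2l a2 (heat_integral3 b20 T0 n3)) _.
rewrite -EFinM lee_fin sqrtrM// exprMn invfM subr0.
rewrite (_ : - ((n%:R - 2) / 2) = 2^-1 * - (n - 2)%:R); last by rewrite natrB ?(leq_trans _ n3)//; field.
rewrite powRrM powR12_sqrt ?(ltW b0)// powR_invn ?sqrtr_ge0//.
by rewrite invfM -!mulrA.
Qed.

Lemma sine_dominated_error (k : nat) : (1 <= k)%N \/ (3 <= n)%N -> exists2 C : R, 0 < C &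
  forall beta t, 0 < beta -> 0 < t -> forall s, measurable_fun setT s ->
  (forall x, `|s x| <= `|symb_s alpha beta t x|) ->
  forall f, in_L1w k f ->
  (L2_norm (multiplier_error s k f) <=
    (C * beta `^ (- ((n%:R - 3) / 4) - (k%:R + 1) / 2))%:E * L1w_norm k f +
    (C * beta `^ (- ((n%:R - 2) / 4) - k%:R / 2))%:E * tail_moment k (beta `^ (1 / 4)) f)%E.
Proof.
move=> nk; have [C1 C10 H1] := @gaussian_moment_le R n k.
have [A2 A20 H2] := sine_tail_moment nk.
have A10 : 0 < alpha ^- 2 * C1 by rewrite mulr_gt0// invr_gt0 exprn_gt0.
exists (8 * Num.sqrt (alpha ^- 2 * C1) + 8 * Num.sqrt A2).
  by rewrite addr_gt0// mulr_gt0// sqrtr_gt0.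
move=> b t b0 t0 s ms ss f fk.
have rs := sine_rapid b0 ms ss.
have I1 := sine_moment_succ b0 ms ss (H1 b b0); rewrite mulrA in I1.
(* The exponent differs by 1/2 from the cosine one, since the Gaussian moment behind it has order k
   instead of k + 1. *)
have -> : - ((n%:R - 3) / 4) - (k%:R + 1) / 2 = 1 / 4 + - (k%:R + n%:R / 2) / 2 :> R by field.
have -> : - ((n%:R - 2) / 4) - k%:R / 2 = (- ((n%:R - 2) / 2) - k%:R) / 2 :> R by field.
have I2 := H2 b t b0 t0 s ms ss.
set C := 8 * Num.sqrt (alpha ^- 2 * C1) + 8 * Num.sqrt A2.
have h1 : 8 * Num.sqrt (alpha ^- 2 * C1) <= C by rewrite lerDl mulr_ge0// sqrtr_ge0.
have h2 : 8 * Num.sqrt A2 <= C by rewrite lerDr mulr_ge0// sqrtr_ge0.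
exact: (multiplier_error_power b0 A10 A20 ms rs fk I1 I2 h1 h2).
Qed.

End sine.
End estimates.

(** * Growth of order zero in low dimension *)

Section little_o.
Context {R : realType} {n : nat}.
Local Open Scope complex_scope.
Local Notation mu := (lebesgue_rV n : {sigma_finite_measure set 'rV[R]_n -> \bar R}).
Implicit Types (s f : 'rV[R]_n -> R).

Lemma in_L1w0 k f : in_L1w k f -> in_L1w 0 f.
Proof.
move=> [fi _]; split => //.
by rewrite (_ : (fun x => _) = EFin \o f)//; apply/funext => x /=; rewrite expr0 mul1r.
Qed.

Lemma moment_expansion0 f u x : moment_expansion 0 f u x =
  (moment f (fun=> 0%N))%:C * u x.
Proof.
rewrite /moment_expansion (big_pred1 [ffun=> ord0]).
  have -> : (fun i : 'I_n => [ffun=> ord0 : 'I_1] i : nat) = (fun=> 0%N).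
    by apply/funext => i; rewrite ffunE.
  congr (_ * _); rewrite /multi_deriv.
  by elim: (enum 'I_n) => //= i r ->.
move=> g; rewrite /= (_ : g = [ffun=> ord0]) ?eqxx.
  by rewrite big1// => i _; rewrite ffunE.
by apply/ffunP => i; rewrite ffunE; exact: ord1.
Qed.

(** Dominated convergence along the radii j + 1: at each point the truncated integrand is eventually
    0. *)
Lemma tail_small f : in_L1w 0 f -> forall e : R, 0 < e ->
  exists2 r : R, 0 < r & \int[mu]_y tail_fun 0 f r y <= e.
Proof.
move=> f0 e e0.
pose F (j : nat) (y : 'rV[R]_n) := (tail_fun 0 f j.+1%:R y)%:E.
have mF j : measurable_fun setT (F j).
  by apply/measurable_EFinP; exact: (measurable_tail_fun f0).
have Fc (y : 'rV[R]_n) : setT y -> F ^~ y @ \oo --> ((cst 0 : 'rV[R]_n -> \bar R) y).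
  move=> _; apply: cvg_near_cst.
  near=> j; rewrite /F /tail_fun leNgt (_ : eucl_norm y < j.+1%:R)//.
  near: j; exists (Num.truncn (eucl_norm y)) => // j /= ltj.
  by rewrite (lt_le_trans (truncnS_gt _))// ler_nat.
have gi : mu.-integrable setT (fun y => ((1 + eucl_norm y) ^+ 0 * `|f y|)%:E).
  have := integrable_norm f0.2.
  rewrite (_ : Num.norm \o _ = (fun y => (1 + eucl_norm y) ^+ 0 * `|f y|))//.
  by apply/funext => y /=; rewrite !expr0 !mul1r.
have Fg j (y : 'rV[R]_n) : setT y -> (`|F j y| <= ((1 + eucl_norm y) ^+ 0 * `|f y|)%:E)%E.
  by move=> _; have /andP[h1 h2] := tail_fun_le 0 f j.+1%:R y; rewrite /F abse_EFin lee_fin ger0_norm.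
have := dominated_cvg (mu := mu) measurableT mF Fc
  (fun y _ => isT : ((1 + eucl_norm y) ^+ 0 * `|f y|)%:E \is a fin_num) gi Fg.
rewrite integral_cst// mul0e => /fine_cvgP[_].
move=> /cvgr0Pnorm_le /(_ e e0)[j _ /(_ j (leqnn j)) /= le].
exists j.+1%:R => //; exact: (le_trans (ler_norm _) le).
Unshelve. all: by end_near.
Qed.

(** The radius is chosen so that the tail term is at most half of e sqrt (phi t). The other term is
    then a constant, which the divergence of [phi] pushes below the other half. *)
Lemma multiplier_error_little_o (s : R -> 'rV[R]_n -> R) f (M1 C : R) (phi g : R -> R) :
  in_L1w 0 f -> 0 <= M1 -> 0 < C ->
  (\forall t \near +oo, [/\ measurable_fun setT (s t), rapid (fun xi => (s t xi)%:C),
     (\int[mu]_xi ((s t xi * eucl_norm xi ^+ 1) ^+ 2)%:E <= M1%:E)%E,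
     (\int[mu]_xi ((s t xi * eucl_norm xi ^+ 0) ^+ 2)%:E <= (C * phi t)%:E)%E &
     g t = Num.sqrt (phi t)]) ->
  phi t @[t --> +oo] --> +oo ->
  ereal_littleo (fun t => L2_norm (multiplier_error (s t) 0 f)) g.
Proof.
move=> f0 M10 C0 st phiy.
pose u t := L2_norm (multiplier_error (s t) 0 f).
have u0 t : (0 <= u t)%E by exact: Lnorm_ge0.
have ule r : 0 < r -> \forall t \near +oo,
    (u t <= (8 * (r * Num.sqrt M1) * L1w_val 0 f +
      8 * Num.sqrt (C * phi t) * \int[mu]_y tail_fun 0 f r y)%:E)%E.
  move=> r0; near=> t.
  have [ms rs I1 I2 _] : [/\ measurable_fun setT (s t), rapid (fun xi => (s t xi)%:C),
     (\int[mu]_xi ((s t xi * eucl_norm xi ^+ 1) ^+ 2)%:E <= M1%:E)%E,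
     (\int[mu]_xi ((s t xi * eucl_norm xi ^+ 0) ^+ 2)%:E <= (C * phi t)%:E)%E &
     g t = Num.sqrt (phi t)] by near: t.
  have C1 : 0 <= C * phi t.
    by rewrite -lee_fin (le_trans _ I2)// integral_ge0// => x _; rewrite lee_fin sqr_ge0.
  have := L2_error_le ms rs f0 r0 M10 C1 I1 I2.
  by rewrite (L1w_normE f0) (tail_momentE f0) -!EFinM -EFinD.
(* The radius 1 already shows that the norm is finite for large [t], as [ereal_littleo] demands. *)
have uf : \forall t \near +oo, u t \is a fin_num.
  have := ule 1 ltr01; apply: filterS => t h.
  by rewrite ge0_fin_numE// (le_lt_trans h)// ltry.
exists (fun t => fine (u t)).
  by near=> t; rewrite fineK//; near: t.
apply/eqoP => e e0.
have q0 : 0 < e / 2 / (8 * Num.sqrt C) by rewrite !divr_gt0// mulr_gt0// sqrtr_gt0.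
have [r r0 rs] := tail_small f0 q0.
have A0 : 0 <= 8 * (r * Num.sqrt M1) * L1w_val 0 f.
  by rewrite !mulr_ge0 ?sqrtr_ge0 ?L1w_val_ge0// ltW.
near=> t.
have [_ _ _ _ ->] : [/\ measurable_fun setT (s t), rapid (fun xi => (s t xi)%:C),
     (\int[mu]_xi ((s t xi * eucl_norm xi ^+ 1) ^+ 2)%:E <= M1%:E)%E,
     (\int[mu]_xi ((s t xi * eucl_norm xi ^+ 0) ^+ 2)%:E <= (C * phi t)%:E)%E &
     g t = Num.sqrt (phi t)] by near: t.
have phiA : (8 * (r * Num.sqrt M1) * L1w_val 0 f / (e / 2)) ^+ 2 <= phi t.
  by near: t; move/cvgryPge : phiy; apply.
rewrite !ger0_norm ?sqrtr_ge0 ?fine_ge0// -lee_fin fineK; last by near: t.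
have h : (u t <= (8 * (r * Num.sqrt M1) * L1w_val 0 f +
      8 * Num.sqrt (C * phi t) * \int[mu]_y tail_fun 0 f r y)%:E)%E.
  by near: t; exact: ule.
apply: (le_trans h); rewrite lee_fin (splitr e) [leRHS]mulrDl.
apply: lerD.
  rewrite [leRHS]mulrC -ler_pdivrMr ?divr_gt0//.
  move/ler_wsqrtr: phiA; rewrite sqrtr_sqr => h1; exact: (le_trans (ler_norm _) h1).
rewrite sqrtrM ?(ltW C0)// mulrA mulrAC.
rewrite ler_wpM2r ?sqrtr_ge0//.
by rewrite mulrC -ler_pdivlMr// mulr_gt0// sqrtr_gt0.
Unshelve. all: by end_near.
Qed.

End little_o.

(** * From multipliers to the kernels of the statement *)

Section assembly.
Context {R : realType} {n : nat}.
Local Open Scope complex_scope.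
Local Notation mu := (lebesgue_rV n : {sigma_finite_measure set 'rV[R]_n -> \bar R}).
Implicit Types (s f : 'rV[R]_n -> R).

Lemma convolution_errorE s k f : measurable_fun setT s -> rapid (fun xi => (s xi)%:C) ->
  in_L1w k f ->
  (fun x => convolution (inv_fourier (fun xi => (s xi)%:C)) f x -
     moment_expansion k f (inv_fourier (fun xi => (s xi)%:C)) x) = multiplier_error s k f.
Proof.
move=> ms rs fk; apply/funext => x; rewrite /multiplier_error convolutionE//.
  exact: (rapid_cintegrable rs).1.
exact: fk.1.
Qed.

Lemma multiplier_error0 s f :
  (fun x => fourier_multiplier s f x -
     (moment f (fun=> 0%N))%:C * inv_fourier (fun xi => (s xi)%:C) x) =
  multiplier_error s 0 f.
Proof. by apply/funext => x; rewrite /multiplier_error moment_expansion0. Qed.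

(** [p + z * 0] and [q + 0] match the goal with vanishing o(1) terms; adding two errors with the
    same bound doubles the constant. *)
Lemma adde_same_bound (u v : \bar R) (C p q z r : R) k f : in_L1w k f ->
  (u <= (C * p)%:E * L1w_norm k f + (C * q)%:E * tail_moment k r f)%E ->
  (v <= (C * p)%:E * L1w_norm k f + (C * q)%:E * tail_moment k r f)%E ->
  (u + v <= (2 * C * (p + z * 0))%:E * L1w_norm k f + (2 * C * (q + 0))%:E * tail_moment k r f)%E.
Proof.
move=> fk uh vh; apply: (le_trans (leeD uh vh)).
rewrite (L1w_normE fk) (tail_momentE fk) -!EFinM -!EFinD lee_fin; lra.
Qed.

Section sine_little_o.
Variables (alpha beta : R) (s : R -> 'rV[R]_n -> R) (f : 'rV[R]_n -> R).
Hypotheses (alpha0 : 0 < alpha) (beta0 : 0 < beta) (f0 : in_L1w 0 f).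
Hypothesis ms : forall t, measurable_fun setT (s t).
Hypothesis ss : forall t x, `|s t x| <= `|symb_s alpha beta t x|.

(** [phi] measures the growth in [t] of the heat integral. The moment with one power of |xi| is
    bounded uniformly in [t], so all the growth sits in the tail term. *)
Lemma sine_error_little_o (C : R) (phi g : R -> R) : 0 < C ->
  (\forall t \near +oo,
    ((2 * alpha ^- 2)%:E *
      \int[@lebesgue_measure R]_(c in `[0%R, ((t * alpha) ^+ 2)%R])
        (Num.sqrt (pi / (2 * beta + c)) ^+ n)%:E <= (C * phi t)%:E)%E) ->
  (\forall t \near +oo, g t = Num.sqrt (phi t)) ->
  phi t @[t --> +oo] --> +oo ->
  ereal_littleo (fun t => L2_norm (multiplier_error (s t) 0 f)) g.
Proof.
move=> C0 Cphi gE; have [C1 C10 H1] := @gaussian_moment_le R n 0.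
have M10 : 0 <= alpha ^- 2 * (C1 * beta `^ (- (0%:R + n%:R / 2))).
  by rewrite !mulr_ge0 ?powR_ge0 ?invr_ge0 ?sqr_ge0// ltW.
apply: (multiplier_error_little_o f0 M10 C0).
near=> t; have t0 : 0 < t by near: t; exact: nbhs_pinfty_gt.
split; [exact: ms|exact: (sine_rapid alpha0 beta0 (ms t) (ss t))| | |].
- exact: (sine_moment_succ alpha0 beta0 (ms t) (ss t) (H1 _ beta0)).
- apply: (le_trans (sine_heat_le alpha0 beta0 t0 (ms t) (ss t))).
  by near: t; exact: Cphi.
- by near: t; exact: gE.
Unshelve. all: by end_near.
Qed.

Let b20 : 0 < 2 * beta.
Proof. by rewrite mulr_gt0. Qed.

Let a2 : 0 < 2 * alpha ^- 2.
Proof. by rewrite mulr_gt0// invr_gt0 exprn_gt0. Qed.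

Lemma sine_error_little_o1 : n = 1%N ->
  ereal_littleo (fun t => L2_norm (multiplier_error (s t) 0 f)) (fun t => t `^ (1 / 2)).
Proof.
move=> n1; have D0 : 0 < 2 * beta + alpha ^+ 2 by rewrite addr_gt0// exprn_gt0.
(* For t >= 1, 2 beta + (t alpha)^2 <= (2 beta + alpha^2) t^2, so the heat integral grows at most
   linearly and [phi] is the identity. *)
apply: (@sine_error_little_o (2 * alpha ^- 2 * (2 * Num.sqrt pi * Num.sqrt (2 * beta + alpha ^+ 2))) id).
- by rewrite !mulr_gt0 ?sqrtr_gt0 ?pi_gt0 ?invr_gt0 ?exprn_gt0.
- near=> t; have t1 : 1 <= t by near: t; apply: nbhs_pinfty_ge; exact: num_real.
  have t0 : 0 < t by exact: lt_le_trans t1.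
  have T0 : 0 < (t * alpha) ^+ 2 by rewrite exprn_gt0// mulr_gt0.
  (* The exponent is generalized so that [n = 1] is applied to it alone, [n] also occurring in the
     types. *)
  have H m : m = 1%N -> (\int[@lebesgue_measure R]_(c in `[0%R, ((t * alpha) ^+ 2)%R])
        (Num.sqrt (pi / (2 * beta + c)) ^+ m)%:E <=
    (2 * Num.sqrt pi * Num.sqrt (2 * beta + (t * alpha) ^+ 2))%:E)%E.
    by move=> ->; exact: heat_integral1.
  apply: le_trans (lee_wpmul2l _ (H _ n1)) _; first by rewrite lee_fin ltW.
  rewrite -EFinM lee_fin -!mulrA !ler_wpM2l ?sqrtr_ge0 ?invr_ge0 ?sqr_ge0//.
  have -> : Num.sqrt (2 * beta + alpha ^+ 2) * t = Num.sqrt ((2 * beta + alpha ^+ 2) * t ^+ 2).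
    by rewrite sqrtrM ?(ltW D0)// sqrtr_sqr gtr0_norm.
  apply: ler_wsqrtr; rewrite [leRHS]mulrDl exprMn (mulrC (t ^+ 2)) lerD2r.
  by rewrite ler_peMr ?(ltW b20)// exprn_ege1.
- by apply: filterS (nbhs_pinfty_ge (num_real 0)) => t t0; rewrite mul1r powR12_sqrt.
- exact: cvg_id.
Unshelve. all: by end_near.
Qed.

Lemma ln_shift_cvgy : ln (t + 2 : R) @[t --> +oo] --> +oo.
Proof.
apply/cvgryPge => A; near=> t.
rewrite -[leLHS]expRK ler_ln ?posrE ?expR_gt0//.
  by rewrite (@le_trans _ _ t) ?lerDl//; near: t; apply: nbhs_pinfty_ge; exact: num_real.
by rewrite addr_gt0//; near: t; exact: nbhs_pinfty_gt.
Unshelve. all: by end_near.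
Qed.

Lemma sine_error_little_o2 : n = 2%N ->
  ereal_littleo (fun t => L2_norm (multiplier_error (s t) 0 f))
    (fun t => Num.sqrt (ln (t + 2))).
Proof.
move=> n2; pose B := 2 * beta + alpha ^+ 2.
(* The 3 comes from 2 beta + (t alpha)^2 <= (t + 2)^2 B <= (t + 2)^3 (2 beta), the last inequality
   for t >= B / (2 beta); subtracting ln (2 beta) leaves 3 ln (t + 2). *)
apply: (@sine_error_little_o (2 * alpha ^- 2 * (pi * 3)) (fun t => ln (t + 2))).
- by rewrite !mulr_gt0 ?pi_gt0 ?invr_gt0 ?exprn_gt0.
- near=> t; have t0 : 0 < t by near: t; exact: nbhs_pinfty_gt.
  have T0 : 0 < (t * alpha) ^+ 2 by rewrite exprn_gt0// mulr_gt0.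
  have tB : B / (2 * beta) <= t by near: t; apply: nbhs_pinfty_ge; exact: num_real.
  have t20 : 0 < t + 2 by rewrite addr_gt0.
  have H m : m = 2%N -> (\int[@lebesgue_measure R]_(c in `[0%R, ((t * alpha) ^+ 2)%R])
        (Num.sqrt (pi / (2 * beta + c)) ^+ m)%:E =
    (pi * (ln (2 * beta + (t * alpha) ^+ 2) - ln (2 * beta)))%:E)%E.
    by move=> ->; exact: heat_integral2.
  rewrite (H _ n2) -EFinM lee_fin -!mulrA !ler_wpM2l ?pi_ge0 ?invr_ge0 ?sqr_ge0//.
  rewrite lerBlDr (mulr_natl (ln (t + 2)) 3) -lnXn// -lnM ?posrE ?exprn_gt0//.
  rewrite ler_ln ?posrE ?addr_gt0 ?mulr_gt0 ?exprn_gt0//.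
  have h : B <= (t + 2) * (2 * beta).
    by rewrite -ler_pdivrMr// (le_trans tB)// lerDl.
  have B1 : 2 * beta + (t * alpha) ^+ 2 <= (t + 2) ^+ 2 * B.
    have h1 : 1 <= (t + 2) ^+ 2 by apply: exprn_ege1; lra.
    have h2 : t ^+ 2 <= (t + 2) ^+ 2 by rewrite lerXn2r ?nnegrE ?(ltW t0) ?(ltW t20)// lerDl.
    rewrite /B mulrDr exprMn lerD//; first by rewrite ler_peMl ?(ltW b20).
    by rewrite ler_wpM2r ?sqr_ge0.
  by rewrite (le_trans B1)// (exprSr _ 2) -mulrA ler_wpM2l ?sqr_ge0.
- exact: nearW.
- exact: ln_shift_cvgy.
Unshelve. all: by end_near.
Qed.

End sine_little_o.
End assembly.

Unset Implicit Arguments.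
Set Strict Implicit.

Theorem proposition3p3 (R : realType) (n k : nat) (hn : (1 <= n)%N)
    (alpha : R) (halpha : 0 < alpha) (N l : 'I_n) :
  (exists2 C : R, 0 < C &
    forall beta : R, 0 < beta ->
    exists o1 o2 : R -> R,
      [/\ o1 t @[t --> +oo] --> 0,
          o2 t @[t --> +oo] --> 0 &
          \forall t \near +oo, forall f : 'rV[R]_n -> R, in_L1w k f ->
            (L2_norm (err_c alpha beta t k f) +
             L2_norm (err_tc alpha beta t k N l f) <=
             (C * (beta `^ (- ((n%:R - 1) / 4) - (k%:R + 1) / 2)
                   + beta `^ (1 / 4) * o1 t))%:E * L1w_norm k f +
             (C * (beta `^ (- (n%:R / 4) - k%:R / 2) + o2 t))%:E
               * tail_moment k (beta `^ (1 / 4)) f)%E])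
  /\
  ((3 <= n)%N \/ ((n = 1%N \/ n = 2%N) /\ (1 <= k)%N) ->
   exists2 C : R, 0 < C &
    forall beta : R, 0 < beta ->
    exists o1 o2 : R -> R,
      [/\ o1 t @[t --> +oo] --> 0,
          o2 t @[t --> +oo] --> 0 &
          \forall t \near +oo, forall f : 'rV[R]_n -> R, in_L1w k f ->
            (L2_norm (err_s alpha beta t k f) +
             L2_norm (err_ts alpha beta t k N l f) <=
             (C * (beta `^ (- ((n%:R - 3) / 4) - (k%:R + 1) / 2)
                   + beta `^ (1 / 4) * o1 t))%:E * L1w_norm k f +
             (C * (beta `^ (- ((n%:R - 2) / 4) - k%:R / 2) + o2 t))%:E
               * tail_moment k (beta `^ (1 / 4)) f)%E])
  /\
  (n = 1%N ->
   forall beta : R, 0 < beta -> forall f : 'rV[R]_n -> R, in_L1w k f ->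
     ereal_littleo (fun t => L2_norm (err0_s alpha beta t f))
       (fun t => t `^ (1 / 2)))
  /\
  (n = 2%N ->
   forall beta : R, 0 < beta -> forall f : 'rV[R]_n -> R, in_L1w k f ->
     ereal_littleo (fun t => L2_norm (err0_s alpha beta t f))
       (fun t => Num.sqrt (ln (t + 2)))
     /\
     ereal_littleo (fun t => L2_norm (err0_ts alpha beta t N l f))
       (fun t => Num.sqrt (ln (t + 2)))).
Proof.
have mc beta t : measurable_fun setT (@symb_c R n alpha beta t) by exact: measurable_symb_c.
have ms beta t : measurable_fun setT (@symb_s R n alpha beta t) by exact: measurable_symb_s.
have mtc beta t : measurable_fun setT (@symb_tc R n alpha beta t N l).
  by apply: measurable_funM => //; exact: measurable_riesz.
have mts beta t : measurable_fun setT (@symb_ts R n alpha beta t N l).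
  by apply: measurable_funM => //; exact: measurable_riesz.
have ltc beta t (x : 'rV[R]_n) : `|symb_tc alpha beta t N l x| <= gaussian beta x.
  rewrite /symb_tc normrM (le_trans _ (symb_c_le alpha beta t x))//.
  by rewrite ler_piMr// riesz_le1.
have lts beta t (x : 'rV[R]_n) : `|symb_ts alpha beta t N l x| <= `|symb_s alpha beta t x|.
  by rewrite /symb_ts normrM ler_piMr// riesz_le1.
have lss beta t (x : 'rV[R]_n) : `|symb_s alpha beta t x| <= `|symb_s alpha beta t x| by [].
have cE beta t (f : 'rV[R]_n -> R) : 0 < beta -> in_L1w k f ->
    err_c alpha beta t k f = multiplier_error (symb_c alpha beta t) k f.
  move=> b0 fk; apply: (convolution_errorE (mc beta t) _ fk).
  apply: (rapid_gaussian_dom (S := 1) b0 (mc beta t) _) => x.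
  by rewrite mul1r symb_c_le.
(* The order [j] stays free: it is [k] in part (i) and 0 in part (ii). *)
have sE beta t j (f : 'rV[R]_n -> R) : 0 < beta -> in_L1w j f ->
    err_s alpha beta t j f = multiplier_error (symb_s alpha beta t) j f.
  move=> b0 fk; apply: (convolution_errorE (ms beta t) _ fk).
  exact: (sine_rapid halpha b0 (ms beta t) (lss beta t)).
have s0E beta t (f : 'rV[R]_n -> R) : 0 < beta -> in_L1w 0 f ->
    err0_s alpha beta t f = multiplier_error (symb_s alpha beta t) 0 f.
  move=> b0 f0; rewrite -sE//; apply/funext => x.
  by rewrite /err_s moment_expansion0.
split.
  have [C C0 H] := @gaussian_dominated_error R n k.
  exists (2 * C); first by rewrite mulr_gt0.
  move=> beta b0; exists (fun=> 0), (fun=> 0); split; [exact: cvg_cst|exact: cvg_cst|].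
  apply: nearW => t f fk; apply: adde_same_bound => //.
    by rewrite cE//; apply: H => // x; exact: symb_c_le.
  (* [err_tc] unfolds to a [multiplier_error], so no convolution has to be rewritten. *)
  by apply: (H _ b0 (symb_tc alpha beta t N l)).
split.
  move=> hk; have nk : (1 <= k)%N \/ (3 <= n)%N by case: hk => [|[_]]; [right|left].
  have [C C0 H] := sine_dominated_error halpha nk.
  exists (2 * C); first by rewrite mulr_gt0.
  move=> beta b0; exists (fun=> 0), (fun=> 0); split; [exact: cvg_cst|exact: cvg_cst|].
  (* Positivity of [t] makes the heat interval [0, (t alpha)^2] nondegenerate. *)
  apply: filterS (nbhs_pinfty_gt (num_real 0)) => t t0 f fk; apply: adde_same_bound => //.
    by rewrite sE//; apply: (H _ t).
  by apply: (H _ t b0 t0 (symb_ts alpha beta t N l)).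
(* Part (ii) involves the zeroth moment only, so [f] is regarded as an element of L^(1,0). *)
split=> [n1 beta b0 f /in_L1w0 f0|n2 beta b0 f /in_L1w0 f0].
  under [X in ereal_littleo X]eq_fun do rewrite s0E//.
  by apply: (sine_error_little_o1 halpha b0).
split.
  under [X in ereal_littleo X]eq_fun do rewrite s0E//.
  by apply: (sine_error_little_o2 halpha b0).
under [X in ereal_littleo X]eq_fun do rewrite [err0_ts _ _ _ _ _ _]multiplier_error0.
exact: (sine_error_little_o2 halpha b0).
Qed.
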